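(* Consider the stochastic matching model defined in the context. Let $\mathcal{I}\in\mathbb{I}$ be an independent set that is maximal with respect to inclusion. Let $p_i>0$ for $i\in\mathcal{I}$ and $q_i>0$ for $i\in\mathcal{V}\setminus\mathcal{I}$ satisfy $\sum_{i\in\mathcal{I}}p_i=\sum_{i\in\mathcal{V}\setminus\mathcal{I}}q_i=1$, and for $\rho\in(0,1)$ let the arrival rates be $$\alpha_i=\begin{cases}p_i\dfrac{\rho}{1+\rho},& i\in\mathcal{I},\\[2mm] q_i\dfrac{1}{1+\rho},& i\in\mathcal{V}\setminus\mathcal{I}.\end{cases}$$ Assume that there exists $\rho^*\in[0,1)$ such that, for each $\rho\in(\rho^*,1)$, the stability conditions $\alpha(\mathcal{J})<\alpha(\mathcal{E}(\mathcal{J}))$ for all $\mathcal{J}\in\mathbb{I}$ are satisfied, and that $$\lim_{\rho\uparrow1}\alpha(\mathcal{J})<\lim_{\rho\uparrow1}\alpha(\mathcal{E}(\mathcal{J})),\qquad \mathcal{J}\in\mathbb{I}\setminus\{\mathcal{I}\}.$$ Then the following limiting results hold (all stationary quantities being those of the model with parameter $\rho\in(\rho^*,1)$): (14-a) The stationary distribution of the set of unmatched item classes satisfies $\pi(\mathcal{I})\xrightarrow[\rho\uparrow1]{}1$ and $\pi(\mathcal{J})\xrightarrow[\rho\uparrow1]{}0$ for each $\mathcal{J}\in\mathbb{I}_0\setminus\{\mathcal{I}\}$. (14-b) The waiting probability of each item class satisfies $\omega_i\xrightarrow[\rho\uparrow1]{}1$ for $i\in\mathcal{I}$, and $\omega_i\xrightarrow[\rho\uparrow1]{}0$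 for $i\in\mathcal{V}\setminus\mathcal{I}$. (14-c) The mean number of unmatched items of each class satisfies $L_i=\mathbb{E}[X_i]\underset{\rho\uparrow1}{\sim}p_i\frac{\rho}{1-\rho}$ for $i\in\mathcal{I}$, and $L_i=\mathbb{E}[X_i]\xrightarrow[\rho\uparrow1]{}0$ for $i\in\mathcal{V}\setminus\mathcal{I}$. In particular, the mean number $L$ of unmatched items (over all classes) satisfies $L\underset{\rho\uparrow1}{\sim}\frac{\rho}{1-\rho}$. (14-d) The number of unmatched items of each class has the following limit in distribution: $$(1-\rho)(X_i)_{i\in\mathcal{I}}\xrightarrow[\rho\uparrow1]{d}\mathrm{Exp}(1)\,(p_i)_{i\in\mathcal{I}},\qquad (X_i)_{i\in\mathcal{V}\setminus\mathcal{I}}\xrightarrow[\rho\uparrow1]{d}0,$$ where $\mathrm{Exp}(1)$ represents a (single) unit-mean exponentially distributed random variable. (14-e) The mean matching time of each class satisfies $\mathbb{E}[T_i]\underset{\rho\uparrow1}{\sim}\frac{2}{1-\rho}$ for $i\in\mathcal{I}$, and $\mathbb{E}[T_i]\xrightarrow[\rho\uparrow1]{}0$ for $i\in\mathcal{V}\setminus\mathcal{I}$. (14-f) The matching time of each class has the following limit in distribution: $(1-\rho)T_i\xrightarrow[\rho\uparrow1]{d}\mathrm{Exp}\left(\frac12\right)$ for $i\in\mathcal{I}$, and $T_i\xrightarrow[\rho\uparrow1]{d}0$ for $i\in\mathcal{V}\setminus\mathcal{I}$, where $\mathrm{Exp}(\frac12)$ represents an exponentially distributed random variable with rate $\frac1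2$.
   Context: **Matching model.** Let $\mathcal{V}=\{1,2,\ldots,N\}$ be a finite set of item classes and consider an undirected connected non-bipartite graph without loops with vertex set $\mathcal{V}$, called the compatibility graph. Write $i\sim j$ if there is an edge between $i$ and $j$, and $i\nsim j$ otherwise. Let $\mathcal{E}_i\subseteq\mathcal{V}$ be the set of neighbors of $i$, and for $\mathcal{A}\subseteq\mathcal{V}$ let $\mathcal{E}(\mathcal{A})=\bigcup_{i\in\mathcal{A}}\mathcal{E}_i$. For each $i\in\mathcal{V}$, class-$i$ items arrive according to an independent Poisson process with rate $\alpha_i>0$, with $\sum_{i\in\mathcal{V}}\alpha_i=1$; for $\mathcal{A}\subseteq\mathcal{V}$ let $\alpha(\mathcal{A})=\sum_{i\in\mathcal{A}}\alpha_i$. Unmatched items are stored in a buffer in arrival order. Each incoming item is matched with the compatible item that has been in the buffer the longest, if any (two items are compatible if their classes are adjacent), in which case both items disappear immediately; otherwise it is added at the end of the buffer (first-come-first-matched policy). The system state is the sequence $c=(c_1,\ldots,c_n)$ of classes of unmatched items, from the oldest to the newest ($c=\varnothing$ if $n=0$). The state evolves as a continuous-time Markov process: in state $c=(c_1,\ldots,c_n)$, for each $i\in\mathcal{V}$, at rate $\alpha_i$ a class-$i$ item arrives and the new state is $(c_1,\ldots,c_n,i)$ if $c_p\nsim i$ for all $p$, and $(c_1,\ldots,c_{q-1},c_{q+1},\ldots,c_n)$ with $q=\min\{p:c_p\sim i\}$ otherwise. **Independent sets and state space.** A nonempty set $\mathcal{J}\subseteq\mathcal{V}$ is an independent set if $i\nsim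 j$ for all $i,j\in\mathcal{J}$. $\mathbb{I}$ is the set of all (nonempty) independent sets and $\mathbb{I}_0=\mathbb{I}\cup\{\emptyset\}$. For a finite sequence $c$ over $\mathcal{V}$, $\mathcal{V}(c)$ is the set of classes appearing in $c$; for $\mathcal{J}\in\mathbb{I}_0$, $\mathcal{C}_{\mathcal{J}}$ is the set of finite sequences $c$ over $\mathcal{V}$ with $\mathcal{V}(c)=\mathcal{J}$. The state space of the Markov process is $\mathcal{C}=\bigcup_{\mathcal{J}\in\mathbb{I}_0}\mathcal{C}_{\mathcal{J}}$, and the process is irreducible on it. The stability condition $\alpha(\mathcal{J})<\alpha(\mathcal{E}(\mathcal{J}))$ for all $\mathcal{J}\in\mathbb{I}$ is equivalent to ergodicity of this process; under it, $\pi$ denotes the stationary distribution. **Stationary quantities.** For $\mathcal{J}\in\mathbb{I}_0$, $\pi(\mathcal{J})=\sum_{c\in\mathcal{C}_{\mathcal{J}}}\pi(c)$ is the stationary probability that the set of unmatched item classes is $\mathcal{J}$. The waiting probability of class $i$ is $\omega_i=\sum_{\mathcal{J}\in\mathbb{I}_0:\,i\notin\mathcal{E}(\mathcal{J})}\pi(\mathcal{J})$. $X=(X_1,\ldots,X_N)$ is distributed as the vector of numbers of unmatched items of each class in the stationary regime (under $\pi$); $L_i=\mathbb{E}[X_i]$ and $L=\sum_{i\in\mathcal{V}}L_i$. $T_i$ is distributed as the matching time of a class-$i$ item in the stationary regime, i.e., the time between the arrival of a class-$i$ item and its matching with another item (equal to $0$ if it is matched immediately upon arrival). **Notation.** For functions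 $f,g$ defined on $(\rho^*,1)$ with $g>0$, $f(\rho)\underset{\rho\uparrow1}{\sim}g(\rho)$ means $f(\rho)/g(\rho)\to1$ as $\rho\uparrow1$. $\xrightarrow{d}$ denotes convergence in distribution. *)

(* Defs.v *)
From HB Require Import structures.
From mathcomp Require Import all_boot all_order all_algebra.
From mathcomp Require Import all_classical all_reals all_analysis.

Set Implicit Arguments.
Unset Strict Implicit.
Unset Printing Implicit Defensive.
Import Order.TTheory GRing.Theory Num.Theory.
Import numFieldNormedType.Exports.

Local Open Scope classical_set_scope.
Local Open Scope card_scope.
Local Open Scope ring_scope.

Definition simple_graph (N : nat) (e : rel 'I_N) : Prop :=
  symmetric e /\ irreflexive e.

Definition connected_graph (N : nat) (e : rel 'I_N) : Prop :=
  forall i j, connect e i j.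

Definition bipartite (N : nat) (e : rel 'I_N) : Prop :=
  exists A : {set 'I_N}, forall i j, e i j -> (i \in A) != (j \in A).

Definition nbrs (N : nat) (e : rel 'I_N) (A : {set 'I_N}) : {set 'I_N} :=
  (\bigcup_(i in A) [set j | e i j])%SET.

(* Independent sets are nonempty; [indep0] adds the empty set. *)
Definition indep (N : nat) (e : rel 'I_N) (J : {set 'I_N}) : bool :=
  (J != finset.set0) && [forall i in J, forall j in J, ~~ e i j].

Definition indep0 (N : nat) (e : rel 'I_N) (J : {set 'I_N}) : bool :=
  (J == finset.set0) || indep e J.

(* Classes of the unmatched items, oldest item first. *)

Definition buffer (N : nat) : Type := seq 'I_N.

HB.instance Definition _ (N : nat) := Choice.on (buffer N).
HB.instance Definition _ (N : nat) := isPointed.Build (buffer N) [::].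
HB.instance Definition _ (N : nat) :=
  @isMeasurable.Build default_measure_display (buffer N)
    discrete_measurable discrete_measurable0
    discrete_measurableC discrete_measurableU.

Definition classes (N : nat) (c : buffer N) : {set 'I_N} := [set:: c]%SET.

Definition buffers_of (N : nat) (J : {set 'I_N}) : set (buffer N) :=
  [set c | classes c = J].

Definition state_space (N : nat) (e : rel 'I_N) : set (buffer N) :=
  [set c | indep0 e (classes c)].

(** First-come-first-matched policy. Items live in an arbitrary type [T] and
    have a class [cls]; this lets the same policy act on plain states ([T] is
    ['I_N]) and on buffers in which one item is tagged. *)
Definition fcfm (N : nat) (e : rel 'I_N) (T : Type) (cls : T -> 'I_N)
    (s : seq T) (x : T) : seq T :=
  let q := find (fun y => e (cls y) (cls x)) s in
  if (q < size s)%N then take q s ++ drop q.+1 s else rcons s x.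

Definition trans_rate (R : realType) (N : nat) (e : rel 'I_N) (a : 'I_N -> R)
    (c c' : buffer N) : R :=
  \sum_(i | fcfm e id c i == c') a i.

(** Stationary distribution of a continuous-time Markov process with state
    space [D] and transition rates [q]: a probability on [D] that solves the
    global balance equations (flow into [x] = flow out of [x]). *)
Definition global_balance (R : realType) (T : choiceType) (D : set T)
    (q : T -> T -> R) (mu : set T -> \bar R) : Prop :=
  forall x, D x ->
    (\esum_(y in D `\ x) (mu [set y] * (q y x)%:E) =
     mu [set x] * \esum_(y in D `\ x) (q x y)%:E)%E.

Definition stationary_distribution (R : realType) (N : nat) (e : rel 'I_N)
    (a : 'I_N -> R) (pi : probability (buffer N) R) : Prop :=
  pi (state_space e) = 1%E /\
  global_balance (state_space e) (trans_rate e a) pi.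

Definition waiting_prob (R : realType) (N : nat) (e : rel 'I_N)
    (pi : probability (buffer N) R) (i : 'I_N) : \bar R :=
  (\sum_(J : {set 'I_N} | indep0 e J && (i \notin nbrs e J))
     pi (buffers_of J))%E.

Definition unmatched (R : realType) (N : nat) (i : 'I_N) (c : buffer N) : R :=
  (count_mem i c)%:R.

Definition mean_unmatched (R : realType) (N : nat)
    (pi : probability (buffer N) R) (i : 'I_N) : \bar R :=
  ('E_pi[unmatched R i])%E.

(** Matching time. A class-[i] item (the tagged item) arrives at time 0 and
    finds the buffer in state [c]; the later arrivals occur at the times
    [s 0 < s 1 < ...], the [n]-th one being of class [k n]. The tagged item is
    the only item of [tagged_buffer] whose label is [true]. *)
Fixpoint tagged_buffer (N : nat) (e : rel 'I_N) (i : 'I_N) (c : buffer N)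
    (k : nat -> 'I_N) (n : nat) : seq ('I_N * bool) :=
  if n is m.+1 then fcfm e fst (tagged_buffer e i c k m) (k m, false)
  else fcfm e fst [seq (j, false) | j <- c] (i, true).

(* The time at which the tagged item leaves; it is 0 if the item is matched on
   arrival and +oo (the infimum of the empty set) if it is never matched. *)
Definition matching_time (R : realType) (N : nat) (e : rel 'I_N) (i : 'I_N)
    (c : buffer N) (s : nat -> R) (k : nat -> 'I_N) : \bar R :=
  ereal_inf [set (if n is m.+1 then s m else 0)%:E |
             n in [set n | (i, true) \notin tagged_buffer e i c k n]].

(** What an item arriving at time 0 in the stationary regime is faced with: by
    the PASTA property the state [C] it finds has law [pi], and the later
    arrivals (at times [S], of classes [K]) form, for the various classes [j],
    Poisson processes of rates [a j], independent of each other and of [C].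
    The Poisson processes are characterized by their counts over successive
    intervals ]t_l, t_(l+1)], which are independent and Poisson distributed. *)
Definition class_arrivals (R : realType) (N : nat) (s : nat -> R)
    (k : nat -> 'I_N) (j : 'I_N) (t u : R) : set nat :=
  [set n | k n = j /\ t < s n <= u].

Record stationary_input (R : realType) (N : nat) (a : 'I_N -> R)
    (pi : probability (buffer N) R)
    (d : measure_display) (Om : measurableType d) (P : probability Om R)
    (C : Om -> buffer N) (S : nat -> Om -> R) (K : nat -> Om -> 'I_N) : Prop :=
  StationaryInput {
    input_measurable_state : measurable_fun setT C ;
    input_measurable_time : forall n, measurable_fun setT (S n) ;
    input_measurable_class : forall n j, measurable [set w | K n w = j] ;
    input_time_gt0 : forall w, 0 < S 0%N w ;
    input_time_increasing : forall n w, S n w < S n.+1 w ;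
    input_law : forall (c : buffer N) (m : nat) (t : nat -> R)
        (x : 'I_N -> nat -> nat),
      0 <= t 0%N -> (forall l, (l < m)%N -> t l < t l.+1) ->
      P [set w | C w = c /\ forall j l, (l < m)%N ->
           class_arrivals (S ^~ w) (K ^~ w) j (t l) (t l.+1) #= `I_(x j l)] =
      (pi [set c] *
       (\prod_j \prod_(l < m) poisson_pmf (a j * (t l.+1 - t l)) (x j l))%:E)%E
  }.

Definition asymp_equiv (R : realType) (F : set_system R)
    (f : R -> \bar R) (g : R -> R) : Prop :=
  (f r * (g r)^-1%:E)%E @[r --> F] --> 1%E.

(* Convergence in distribution along the filter [F] of random elements [X r],
   possibly defined on different probability spaces, to the random element [X']
   of a space with law [P']. *)
Definition cvg_in_distribution (R : realType) (T : topologicalType)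
    (F : set_system R)
    (d : R -> measure_display) (Om : forall r, measurableType (d r))
    (P : forall r, probability (Om r) R) (X : forall r, Om r -> T)
    (d' : measure_display) (Om' : measurableType d') (P' : set Om' -> \bar R)
    (X' : Om' -> T) : Prop :=
  forall h : T -> R, continuous h -> (exists M, forall y, `|h y| <= M) ->
    (\int[P r]_w (h (X r w))%:E)%E @[r --> F] --> (\int[P']_w (h (X' w))%:E)%E.

Definition arrival_rate (R : realType) (N : nat) (I : {set 'I_N})
    (p q : 'I_N -> R) (rho : R) (i : 'I_N) : R :=
  if i \in I then p i * (rho / (1 + rho)) else q i * (1 / (1 + rho)).

Definition load (R : realType) (N : nat) (a : 'I_N -> R) (A : {set 'I_N}) : R :=
  \sum_(i in A) a i.

Definition stability_condition (R : realType) (N : nat) (e : rel 'I_N)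
    (a : 'I_N -> R) : Prop :=
  forall J : {set 'I_N}, indep e J -> load a J < load a (nbrs e J).

(* Main.v *)
Require Import Defs.
From mathcomp Require Import all_boot all_order all_algebra.
From mathcomp Require Import all_classical all_reals all_analysis.
From mathcomp Require Import measurable_realfun.
From mathcomp Require Import ring lra zify.

Set Implicit Arguments.
Unset Strict Implicit.
Unset Printing Implicit Defensive.
Import Order.TTheory GRing.Theory Num.Theory.
Import numFieldNormedType.Exports.
Local Open Scope classical_set_scope.
Local Open Scope card_scope.
Local Open Scope ring_scope.

(** Why the theorem holds.

    Fix the parameter. The stationary probability of a buffer is the product, over
    its items, of the arrival rate of the item divided by the rate of the newcomers
    that find a match among this item and the older ones, up to the factor that is
    the probability of the empty buffer ([stationary_product_form]). These weights
    solve the balance equations ([weight_inflow]), and the stationary measure is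
    identified with them by comparing the two measures state by state. A
    consequence is partial balance: the matchings in a state balance the arrival of
    its newest item ([newest_item_balance]). Grouped by the set [J] of unmatched
    classes, partial balance becomes a finite recursion over independent sets for
    the probabilities of [J], for the generating functions of the numbers of items
    and for their means, in which the coefficient at [J] is the slack
    [load (nbrs J) - load J].

    When [rho] increases to 1, the slack of [I] is [(1 - rho) / (1 + rho)] and
    vanishes, while the other slacks stay away from 0. So whatever obeys such a
    recursion becomes negligible outside [I] ([vanishing_recursion]), and the
    recursion at [I] alone gives the limits: the probability of [I] tends to 1,
    [(1 - rho)] times the mean number of class-[i] items tends to [p i], and the
    joint generating function at points [z j = 1 - s j * (1 - rho)], up to smaller
    terms, tends to [1 / (1 + \sum_(j in I) p j * s j)] ([cvg_power_weight]).
    The last limit is the joint Laplace transform of an exponential variable times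
    the vector [p]. In dimension 1, convergence of Laplace transforms to that of an
    exponential variable implies convergence in distribution, by polynomial
    approximation in [expR (- x)] ([laplace_cvg_exponential]). This applies to the
    total of the classes in [I], and the individual numbers are close to their
    shares [p i] of the total in mean square ([cvg_profile]).

    A tagged item that finds the buffer [c] is still present at time [t] if it
    survives the classes of the later arrivals. Cutting time into short slots shows
    that these classes form a random word of independent letters, of Poisson length
    ([prob_late]); so the Laplace transform of the tail of the matching time is the
    stationary mean of a function of [c] that satisfies a first-step equation
    ([wait_transform_step]). Summing this function over the class-[i] items of a
    buffer, with a discount for the younger ones, gives a test function for the
    balance equations; its stationary drift is zero, which says that
    [expR (- s * T)] and [(1 - s / a i) ^+ X i] have the same mean
    ([laplace_matching_time]). The limits of the matching times of class [i] follow
    from those of the numbers of items, with the factor 2 because [a i] tends to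
    [p i / 2] for [i] in [I]. *)

(** * Polynomial approximation *)

Section Weierstrass.
Variable R : realType.

(** Continuity is uniform along the compact image of a segment, even towards
    points that lie near this curve but not on it. *)
Lemma near_compact_modulus (V : pseudoMetricType R) (h : V -> R) (phi : R -> V)
    (a b eps : R) : continuous h -> continuous phi -> 0 < eps ->
  exists2 del : R, 0 < del &
    forall x z, a <= x <= b -> ball (phi x) del z -> `|h z - h (phi x)| < eps.
Proof.
move=> ch cphi eps0.
have /compact_near_coveringP := @segment_compact R a b.
move=> /(_ R (0^'+) (fun (del : R) x =>
  forall z, ball (phi x) del z -> `|h z - h (phi x)| < eps) _) [].
- move=> x _.
  have e2 : 0 < eps / 2 by rewrite divr_gt0.
  have /cvgrPdist_lt/(_ _ e2)/nbhs_ballP[r /= r0 hr] := ch (phi x).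
  have r2 : 0 < r / 2 by rewrite divr_gt0.
  have nx : \forall x' \near x, ball (phi x) (r / 2) (phi x').
    by have /cvg_ballP/(_ _ r2) := cphi x.
  exists ([set x' | ball (phi x) (r / 2) (phi x')], [set d : R | 0 < d < r / 2]).
    split => //=; near=> d; apply/andP; split; near: d => //.
      exact: nbhs_right_gt.
    exact: nbhs_right_lt.
  case=> x' d /= [bx /andP[d0 dr]] z bz.
  have b1 : ball (phi x) r z.
    rewrite (splitr r); apply: ball_triangle bx _.
    exact: le_ball (ltW dr) _ bz.
  have b2 : ball (phi x) r (phi x').
    by apply: le_ball bx; rewrite ler_pdivrMr// ler_peMr// ?ltW// ltr1n.
  rewrite (_ : h z - h (phi x') = (h (phi x) - h (phi x')) - (h (phi x) - h z));
    last by ring.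
  rewrite (le_lt_trans (ler_normB _ _))// (splitr eps) ltrD//; exact: hr.
move=> e /= e0 Ke; exists (e / 2); first by rewrite divr_gt0.
move=> x z xab; apply: Ke => //=.
  by rewrite sub0r normrN gtr0_norm ?divr_gt0// ltr_pdivrMr// ltr_pMr// ltr1n.
by rewrite divr_gt0.
Unshelve. all: end_near. Qed.

(** At a point [x] of the unit interval, the expectation of [F] at the number of
    successes in [n] independent trials of probability [x]; the recursion is on
    the outcome of one trial. *)
Fixpoint bernstein n (F : nat -> R) : {poly R} :=
  if n is m.+1 then
    'X * bernstein m (fun k => F k.+1) + (1 - 'X) * bernstein m F
  else (F 0%N)%:P.

Lemma bernsteinS n F x : (bernstein n.+1 F).[x] =
  x * (bernstein n (fun k => F k.+1)).[x] + (1 - x) * (bernstein n F).[x].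
Proof. by rewrite /= !hornerE. Qed.

Lemma bernsteinD n F G x c : (bernstein n (fun k => F k + c * G k)).[x] =
  (bernstein n F).[x] + c * (bernstein n G).[x].
Proof.
elim: n F G => [|n IH] F G; first by rewrite /= !hornerE.
by rewrite !bernsteinS !IH; ring.
Qed.

Lemma ler_bernstein n F G x : 0 <= x <= 1 ->
  (forall k, (k <= n)%N -> F k <= G k) ->
  (bernstein n F).[x] <= (bernstein n G).[x].
Proof.
move=> /andP[x0 x1]; elim: n F G => [|n IH] F G FG.
  by rewrite /= !hornerE FG.
rewrite !bernsteinS lerD// ler_wpM2l ?subr_ge0//; apply: IH => k kn.
- exact: FG.
- by apply: FG; exact: leqW.
Qed.

Lemma bernstein_cst n c x : (bernstein n (fun=> c)).[x] = c.
Proof.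
elim: n => [|n IH]; first by rewrite /= hornerE.
by rewrite bernsteinS IH; ring.
Qed.

(** For [c = - n%:R * x] this is the variance of the binomial law. *)
Lemma bernstein_sqr n c x :
  (bernstein n (fun k => (k%:R + c) ^+ 2)).[x] =
  (n%:R * x + c) ^+ 2 + n%:R * x * (1 - x).
Proof.
elim: n c => [|n IH] c; first by rewrite /= hornerE; ring.
rewrite bernsteinS IH.
under [X in bernstein n X]eq_fun do rewrite -addn1 natrD -addrA.
by rewrite IH -addn1 natrD; ring.
Qed.

(** Bernstein's proof: by Chebyshev's inequality the proportion [k / n] of
    successes is rarely far from [x], so [g (k / n)] is close to [g x] on
    average. *)
Theorem weierstrass_itv01 (g : R -> R) (eps : R) : continuous g -> 0 < eps ->
  exists p : {poly R}, forall x : R, 0 <= x <= 1 -> `|g x - p.[x]| < eps.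
Proof.
move=> cg eps0.
have e2 : 0 < eps / 2 by rewrite divr_gt0.
have [|del del0 hdel] := @near_compact_modulus R^o g id 0 1 _ cg _ e2.
  by move=> x; exact: cvg_id.
have [M M0 hM] : exists2 M : R, 0 < M & forall x : R, 0 <= x <= 1 -> `|g x| <= M.
  have cg' : {within `[0, 1], continuous g} by exact: continuous_subspaceT.
  have [c1 _ h1] := @EVT_max R g 0 1 ler01 cg'.
  have [c2 _ h2] := @EVT_min R g 0 1 ler01 cg'.
  exists (`|g c1| + `|g c2| + 1); first by rewrite ltr_wpDl// addr_ge0.
  move=> x x01; rewrite ler_norml; apply/andP; split.
    rewrite -lerN2 opprK; have := h2 x; rewrite in_itv/= => /(_ x01).
    have := ler_norm (- g c2); rewrite normrN; have := normr_ge0 (g c1); lra.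
  have := h1 x; rewrite in_itv/= => /(_ x01).
  by have := ler_norm (g c1); have := normr_ge0 (g c2); lra.
(* [K] makes [K * (k / n - x) ^+ 2] exceed the crude bound [2 * M] wherever
   [k / n] is at distance [del] or more from [x]. *)
pose K : R := 2 * M / del ^+ 2.
have K0 : 0 < K by rewrite divr_gt0 ?mulr_gt0 ?exprn_gt0.
pose n := (Num.truncn (2 * K / eps)).+1.
have n0 : 0 < n%:R :> R by rewrite ltr0n.
have hn : K / n%:R < eps / 2.
  rewrite ltr_pdivrMr// mulrAC ltr_pdivlMr// mulrC [eps * _]mulrC -ltr_pdivrMr//.
  exact: truncnS_gt.
exists (bernstein n (fun k => g (k%:R / n%:R))) => x x01.
have nE (k : nat) : k%:R / n%:R - x = n%:R^-1 * (k%:R + (- (n%:R * x))).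
  by rewrite mulrDr [_ * k%:R]mulrC mulrN mulKf ?gt_eqF.
have key k : (k <= n)%N -> `|g (k%:R / n%:R) - g x| <=
    eps / 2 + K / n%:R ^+ 2 * (k%:R + (- (n%:R * x))) ^+ 2.
  move=> kn; have [lt_d|ge_d] := ltP `|x - k%:R / n%:R| del.
    rewrite ler_wpDr//.
      by rewrite mulr_ge0 ?sqr_ge0// ltW// divr_gt0// exprn_gt0.
    by apply/ltW/hdel.
  apply: (@le_trans _ _ (2 * M)).
    rewrite (le_trans (ler_normB _ _))// [leRHS]mulr_natl mulr2n lerD ?hM//.
    by rewrite divr_ge0//= ler_pdivrMr// mul1r ler_nat.
  apply: (ler_wpDl (ltW e2)).
  have -> : K / n%:R ^+ 2 * (k%:R + (- (n%:R * x))) ^+ 2 =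
            K * `|x - k%:R / n%:R| ^+ 2.
    by rewrite real_normK ?num_real//; field; rewrite gt_eqF.
  rewrite (_ : K * _ = 2 * M * (`|x - k%:R / n%:R| ^+ 2 / del ^+ 2));
    last by rewrite /K; ring.
  rewrite ler_pMr ?mulr_gt0// ler_pdivlMr ?exprn_gt0// mul1r.
  by apply: lerXn2r => //; rewrite nnegrE ltW.
rewrite distrC; set B := bernstein _ _.
have bnd : (bernstein n (fun k => eps / 2 +
    K / n%:R ^+ 2 * (k%:R + (- (n%:R * x))) ^+ 2)).[x] < eps.
  rewrite bernsteinD bernstein_cst bernstein_sqr subrr expr0n add0r.
  rewrite [ltRHS]splitr ltrD2l.
  apply: le_lt_trans hn; rewrite -[leLHS]mulrA ler_pM2l//.
  have nn : n%:R ^- 2 * (n%:R * x * (1 - x)) = n%:R^-1 * (x * (1 - x)).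
    by field; rewrite gt_eqF.
  rewrite nn ler_piMr ?invr_ge0//; case/andP: x01 => *; nra.
apply: le_lt_trans bnd; rewrite ler_norml.
have Bg c : B.[x] + c * g x = (bernstein n (fun k => g (k%:R / n%:R) + c * g x)).[x].
  by rewrite bernsteinD bernstein_cst.
rewrite -[- g x]mulN1r Bg; apply/andP; split; last first.
  apply: ler_bernstein => // k kn; apply: le_trans (key k kn).
  by rewrite mulN1r ler_norm.
set Q := (fun k : nat => _ + K / _ * _).
have <- : (bernstein n (fun k => 0 + (-1) * Q k)).[x] = - (bernstein n Q).[x].
  by rewrite (bernsteinD n (fun=> 0) Q) bernstein_cst add0r mulN1r.
apply: ler_bernstein => // k kn; rewrite add0r !mulN1r lerNl.
by apply: le_trans (key k kn); rewrite -normrN ler_norm.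
Qed.

End Weierstrass.

(** * Convergence of expectations from Laplace transforms *)

Section BoundedExpectation.
Context {R : realType} {d} {T : measurableType d} (P : probability T R).
Implicit Types f g : T -> R.

Lemma bounded_integrable f (M : R) : measurable_fun setT f ->
  (forall x, `|f x| <= M) -> P.-integrable setT (EFin \o f).
Proof.
move=> mf fM; apply: measurable_bounded_integrable => //.
  by rewrite (le_lt_trans (probability_le1 _ _))// ltry.
exists M; split; first by rewrite num_real.
by move=> x Mx y _; apply: le_trans (fM y) _; exact: ltW.
Qed.

Lemma EFin_Rintegral f : P.-integrable setT (EFin \o f) ->
  ((\int[P]_x f x)%:E = \int[P]_x (f x)%:E)%E.
Proof. by move=> fi; rewrite fineK//; exact: integrable_fin_num. Qed.

Lemma Rintegral_prob_cst (c : R) : \int[P]_x c = c.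
Proof.
rewrite /Rintegral (_ : \int[P]_x c%:E = c%:E)%E//.
by rewrite integral_cst// [X in (_ * X)%E]probability_setT mule1.
Qed.

Lemma dist_Rintegral f g (eps : R) :
  P.-integrable setT (EFin \o f) -> P.-integrable setT (EFin \o g) ->
  (forall x, `|f x - g x| <= eps) ->
  `|\int[P]_x f x - \int[P]_x g x| <= eps.
Proof.
move=> fi gi fg; rewrite -RintegralB//.
have fgi : P.-integrable setT (EFin \o (fun x => f x - g x)).
  exact: (integrableB measurableT fi gi).
apply: (le_trans (le_normr_Rintegral measurableT fgi)).
rewrite -[leRHS]Rintegral_prob_cst; apply: le_Rintegral => //.
  exact: (integrable_norm fgi).
by apply: (@bounded_integrable _ `|eps|).
Qed.

End BoundedExpectation.

(** An interchange of limits: the approximations [v] depend on [eps], and their error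
    is uniform along the filter. *)
Lemma cvg_approx {R : realType} {I : Type} (F : set_system I) {FF : Filter F}
    (u : I -> R) (l : R) :
  (forall eps, 0 < eps -> exists (v : I -> R) (l' : R),
     [/\ v @ F --> l', \forall r \near F, `|u r - v r| <= eps & `|l - l'| <= eps]) ->
  u @ F --> l.
Proof.
move=> H; apply/cvgrPdist_le => eps eps0.
have e3 : 0 < eps / 3 by rewrite divr_gt0.
have [v [l' [vl' uv ll']]] := H _ e3.
have /cvgrPdist_le/(_ _ e3) vn := vl'; apply: filterS2 uv vn => r uv vl.
have -> : l - u r = (l - l') + (l' - v r) - (u r - v r) by ring.
rewrite (le_trans (ler_normB _ _))// (_ : eps = eps / 3 + eps / 3 + eps / 3);
  last by field.
by rewrite lerD// (le_trans (ler_normD _ _))// lerD.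
Qed.

Lemma cvg_sumr {R : realType} {T I : Type} (F : set_system T) {FF : Filter F}
    (s : seq I) (Q : pred I) (f : I -> T -> R) (l : I -> R) :
  (forall i, Q i -> f i t @[t --> F] --> l i) ->
  (\sum_(i <- s | Q i) f i t) @[t --> F] --> \sum_(i <- s | Q i) l i.
Proof.
move=> fl; elim: s => [|i s IH].
  by under eq_fun do rewrite big_nil; rewrite big_nil; exact: cvg_cst.
under eq_fun do rewrite big_cons; rewrite big_cons.
by have [Qi|_] := boolP (Q i) => //; apply: cvgD => //; exact: fl.
Qed.

Section LaplaceConvergence.
Context {R : realType} (F : set_system R) {FF : Filter F}.
Context (d : R -> measure_display) (Om : forall r, measurableType (d r))
  (P : forall r, probability (Om r) R) (X : forall r, Om r -> R).
Context d' (Om' : measurableType d') (P' : probability Om' R) (X' : Om' -> R).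
Arguments X : clear implicits.
Variable lam : R.
Hypothesis lam0 : 0 < lam.
Hypothesis X_ok :
  \forall r \near F, measurable_fun setT (X r) /\ forall w, 0 <= X r w.
Hypothesis mX' : measurable_fun setT X'.
Hypothesis X'_ge0 : forall w, 0 <= X' w.
Hypothesis lapX : forall th : R, 0 <= th ->
  \int[P r]_w expR (- th * X r w) @[r --> F] --> lam / (lam + th).
Hypothesis lapX' : forall th : R, 0 <= th ->
  \int[P']_w expR (- th * X' w) = lam / (lam + th).

(** Test functions whose expectations converge. They form a linear space, closed
    under uniform approximation on the half-line. *)
Let good (f : R -> R) := [/\ measurable_fun setT f,
  exists M : R, forall x : R, 0 <= x -> `|f x| <= M &
  \int[P r]_w f (X r w) @[r --> F] --> \int[P']_w f (X' w)].

Let compI {d0} {T : measurableType d0} (Q : probability T R) (Y : T -> R) (f : R -> R) (M : R) :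
  measurable_fun setT Y -> (forall w, 0 <= Y w) -> measurable_fun setT f ->
  (forall x : R, 0 <= x -> `|f x| <= M) -> Q.-integrable setT (EFin \o (f \o Y)).
Proof.
move=> mY Y0 mf fM; apply: (@bounded_integrable _ _ _ _ _ M) => /=.
  exact: measurableT_comp.
by move=> x; exact: fM.
Qed.

Let goodD (f g : R -> R) (c : R) : good f -> good g -> good (fun x => f x + c * g x).
Proof.
move=> [mf [M fM] cf] [mg [K gK] cg].
have mcg : measurable_fun setT (fun x => c * g x) by exact: measurable_funM.
have cgK : forall x : R, 0 <= x -> `|c * g x| <= `|c| * K.
  by move=> x x0; rewrite normrM ler_wpM2l// gK.
have lin d0 (T : measurableType d0) (Q : probability T R) (Y : T -> R) :
    measurable_fun setT Y -> (forall w, 0 <= Y w) ->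
    \int[Q]_w (f (Y w) + c * g (Y w)) =
    \int[Q]_w f (Y w) + c * \int[Q]_w g (Y w).
  move=> mY Y0; rewrite RintegralD//.
  - by rewrite RintegralZl//; exact: (compI Q mY Y0 mg gK).
  - exact: (compI Q mY Y0 mf fM).
  - exact: (compI Q mY Y0 mcg cgK).
split; first exact: measurable_funD.
  exists (M + `|c| * K) => x x0; rewrite (le_trans (ler_normD _ _))//.
  by rewrite lerD ?fM ?cgK.
rewrite lin//.
apply: (@cvg_trans _ ((\int[P r]_w f (X r w) + c * \int[P r]_w g (X r w)) @[r --> F])).
  apply: near_eq_cvg; apply: filterS X_ok => r [mX X0]; rewrite /= lin//.
by apply: cvgD => //; apply: cvgM => //; exact: cvg_cst.
Qed.

Let good_exp (th : R) : 0 <= th -> good (fun x : R => expR (- th * x)).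
Proof.
move=> th0; split.
- by apply: measurableT_comp => //; exact: measurable_funM.
- exists 1 => x x0; rewrite ger0_norm ?expR_ge0// -expR0 ler_expR.
  by rewrite mulNr oppr_le0 mulr_ge0.
- by rewrite lapX'//; exact: lapX.
Qed.

(** Exponentials are the monomials in the variable [expR (- eta * x)]. *)
Let good_poly (eta : R) (p : {poly R}) : 0 <= eta ->
  good (fun x : R => p.[expR (- eta * x)]).
Proof.
move=> eta0.
have -> : (fun x => p.[expR (- eta * x)]) =
    (fun x => \sum_(i < size p) p`_i * expR (- (i%:R * eta) * x)).
  apply/funext => x; rewrite horner_coef; apply: eq_bigr => i _.
  by rewrite -expRM_natl; congr (_ * expR _); ring.
elim: (size p) => [|n IH].
  under eq_fun do rewrite big_ord0.
  split; first exact: measurable_cst.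
    by exists 0 => x _; rewrite normr0.
  rewrite Rintegral_prob_cst; under eq_fun do rewrite Rintegral_prob_cst.
  exact: cvg_cst.
under eq_fun do rewrite big_ord_recr/=.
by apply: goodD => //; apply: good_exp; rewrite mulr_ge0.
Qed.

Let good_approx (f : R -> R) : measurable_fun setT f ->
  (exists M : R, forall x : R, 0 <= x -> `|f x| <= M) ->
  (forall eps, 0 < eps -> exists2 g, good g &
     forall x : R, 0 <= x -> `|f x - g x| <= eps) -> good f.
Proof.
move=> mf [M fM] H; split => //; first by exists M.
apply: cvg_approx => eps eps0; have [g [mg [K gK] cg] fg] := H _ eps0.
exists (fun r => \int[P r]_w g (X r w)), (\int[P']_w g (X' w)); split => //.
  apply: filterS X_ok => r [mX X0]; apply: dist_Rintegral.
  - exact: (compI (P r) mX X0 mf fM).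
  - exact: (compI (P r) mX X0 mg gK).
  - by move=> w; exact: fg.
apply: dist_Rintegral.
- exact: (compI P' mX' X'_ge0 mf fM).
- exact: (compI P' mX' X'_ge0 mg gK).
- by move=> w; exact: fg.
Qed.

(** As a function of [u = expR (- eta * x)], the product [expR (- eta * x) * h x]
    extends continuously to [u = 0], that is, to [x = +oo], where it vanishes; so
    it is uniformly close to a polynomial in [u]. *)
Let good_damped (h : R -> R) (M eta : R) : continuous h ->
  (forall x, `|h x| <= M) -> 0 < eta ->
  good (fun x => expR (- eta * x) * h x).
Proof.
move=> ch hM eta0.
have M0 : 0 <= M by exact: le_trans (hM 0).
pose g (u : R) := if 0 < u then u * h (- ln u / eta) else 0.
have cg : continuous g.
  move=> u; have [u0|u0] := ltP 0 u.
    have gE : {near u, g =1 (fun v => v * h (- ln v / eta))}.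
      near=> v; rewrite /g ifT//; near: v; exact: lt_nbhsr.
    have gu : g u = u * h (- ln u / eta) by rewrite /g u0.
    rewrite /continuous_at gu.
    apply: (@cvg_trans _ ((v * h (- ln v / eta)) @[v --> u])).
      by apply: near_eq_cvg; apply: filterS gE => v ->.
    apply: (@cvgM R R (nbhs u) _ id (fun v => h (- ln v / eta)) u);
      first exact: cvg_id.
    apply: (@cvg_comp _ _ _ (fun v => - ln v / eta) h _ (nbhs (- ln u / eta)));
      last exact: ch.
    by apply: cvgM; [apply: cvgN; exact: continuous_ln|exact: cvg_cst].
  have gu : g u = 0 by rewrite /g ltNge u0.
  rewrite /continuous_at gu.
  apply/cvgr0Pnorm_lt => eps eps0.
  have M1 : 0 < M + 1 by rewrite ltr_wpDl.
  near=> v; rewrite /g; case: ifPn => v0; last by rewrite normr0.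
  rewrite normrM gtr0_norm//; apply: (@le_lt_trans _ _ (v * (M + 1))).
    by rewrite ler_pM2l// (le_trans (hM _))// lerDl.
  rewrite -ltr_pdivlMr//; near: v.
  by apply: lt_nbhsl; rewrite (le_lt_trans u0)// divr_gt0.
have gE (x : R) : expR (- eta * x) * h x = g (expR (- eta * x)).
  rewrite /g expR_gt0 expRK; congr (_ * h _); field; rewrite gt_eqF//.
have e1 (x : R) : 0 <= x -> expR (- eta * x) <= 1.
  by move=> x0; rewrite -expR0 ler_expR mulNr oppr_le0 mulr_ge0// ltW.
apply: good_approx.
- apply: measurable_funM.
    by apply: measurableT_comp => //; exact: measurable_funM.
  exact: continuous_measurable_fun.
- exists M => x x0; rewrite normrM ger0_norm ?expR_ge0//.
  by rewrite -[leRHS]mul1r ler_pM ?expR_ge0// e1.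
- move=> eps eps0; have [p pg] := weierstrass_itv01 cg eps0.
  exists (fun x => p.[expR (- eta * x)]); first exact/good_poly/ltW.
  by move=> x x0; rewrite gE; apply/ltW/pg; rewrite expR_ge0 e1.
Unshelve. all: end_near. Qed.

(** Damping [h] by [expR (- eta * x)] costs at most [M * (1 - expR (- eta * x))],
    and the expectation of this bound is given by the transforms themselves; this
    takes the place of a tightness argument. *)
Theorem laplace_cvg (h : R -> R) (M : R) : continuous h ->
  (forall x, `|h x| <= M) ->
  \int[P r]_w h (X r w) @[r --> F] --> \int[P']_w h (X' w).
Proof.
move=> ch hM.
have M0 : 0 <= M by exact: le_trans (hM 0).
apply: cvg_approx => eps eps0.
have [eta eta0 small] : exists2 eta : R, 0 < eta & M * (1 - lam / (lam + eta)) < eps.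
  have e0 : 0 < eps * lam / (M + 1) by rewrite divr_gt0 ?mulr_gt0// ltr_wpDl.
  (* [M * (1 - lam / (lam + eta))] is [M * eta / (lam + eta)]. *)
  exists (eps * lam / (M + 1)) => //; set eta := (X in lam + X).
  have -> : M * (1 - lam / (lam + eta)) = M * eta / (lam + eta).
    by field; rewrite gt_eqF// addr_gt0.
  rewrite ltr_pdivrMr ?addr_gt0//.
  have etaE : eta * (M + 1) = eps * lam.
    by rewrite /eta divfK// gt_eqF// ltr_wpDl.
  have : 0 < eta by []. have : 0 < eps * eta by rewrite mulr_gt0.
  nra.
have [mf [K fK] cf] := good_damped ch hM eta0.
have mh : measurable_fun setT h by exact: continuous_measurable_fun.
have hM' (x : R) : 0 <= x -> `|h x| <= M by [].
have e1 (x : R) : 0 <= x -> expR (- eta * x) <= 1.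
  by move=> x0; rewrite -expR0 ler_expR mulNr oppr_le0 mulr_ge0// ltW.
have bound d0 (T : measurableType d0) (Q : probability T R) (Y : T -> R) :
    measurable_fun setT Y -> (forall w, 0 <= Y w) ->
    `|\int[Q]_w h (Y w) - \int[Q]_w (expR (- eta * Y w) * h (Y w))| <=
    M * (1 - \int[Q]_w expR (- eta * Y w)).
  move=> mY Y0.
  have i1 := compI Q mY Y0 mh hM'.
  have i2 := compI Q mY Y0 mf fK.
  have me : measurable_fun setT (fun x : R => expR (- eta * x)).
    by apply: measurableT_comp => //; exact: measurable_funM.
  have i3 : Q.-integrable setT (EFin \o (fun w => expR (- eta * Y w))).
    apply: (@compI _ _ Q Y _ 1 mY Y0 me) => x x0.
    by rewrite ger0_norm ?expR_ge0// e1.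
  have i4 : Q.-integrable setT (EFin \o (fun w : T => 1 : R)).
    by apply: (@bounded_integrable _ _ _ _ _ 1) => //= x; rewrite normr1.
  have m5 : measurable_fun setT (fun x : R => h x - expR (- eta * x) * h x).
    by apply: measurable_funB.
  have b5 (x : R) : 0 <= x -> `|h x - expR (- eta * x) * h x| <= M * (1 - expR (- eta * x)).
    move=> x0; rewrite -{1}[h x]mul1r -mulrBl normrM mulrC ler_pM//.
    by rewrite ger0_norm// subr_ge0 e1.
  have m6 : measurable_fun setT (fun x : R => M * (1 - expR (- eta * x))).
    by apply: measurable_funM => //; exact: measurable_funB.
  have b6 (x : R) : 0 <= x -> `|M * (1 - expR (- eta * x))| <= M.
    move=> x0; rewrite ger0_norm ?mulr_ge0// ?subr_ge0 ?e1//.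
    by rewrite ler_piMr// lerBlDr lerDl expR_ge0.
  have b5' (x : R) : 0 <= x -> `|h x - expR (- eta * x) * h x| <= M.
    move=> x0; rewrite (le_trans (b5 x x0))//.
    by rewrite ler_piMr// lerBlDr lerDl expR_ge0.
  rewrite -RintegralB//.
  have i5 := compI Q mY Y0 m5 b5'.
  have i6 := compI Q mY Y0 m6 b6.
  apply: (le_trans (le_normr_Rintegral measurableT i5)).
  have -> : M * (1 - \int[Q]_w expR (- eta * Y w)) =
      \int[Q]_w (M * (1 - expR (- eta * Y w))).
    rewrite RintegralZl//; last exact: (integrableB measurableT i4 i3).
    by rewrite RintegralB// Rintegral_prob_cst.
  apply: le_Rintegral => //; first exact: (integrable_norm i5).
  by move=> w _; exact: b5.
exists (fun r => \int[P r]_w (expR (- eta * X r w) * h (X r w))).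
exists (\int[P']_w (expR (- eta * X' w) * h (X' w))); split => //.
- have cl : M * (1 - \int[P r]_w expR (- eta * X r w)) @[r --> F] -->
      M * (1 - lam / (lam + eta)).
    apply: cvgM; first exact: cvg_cst.
    by apply: cvgB; [exact: cvg_cst|exact/lapX/ltW].
  have nl : \forall r \near F, M * (1 - \int[P r]_w expR (- eta * X r w)) < eps.
    exact: (cvgr_lt _ cl).
  apply: filterS2 X_ok nl => r [mX X0] lt_eps.
  by rewrite (le_trans (bound _ _ _ _ mX X0))// ltW.
- rewrite (le_trans (bound _ _ _ _ mX' X'_ge0))// lapX'; last exact: ltW.
  exact: ltW.
Qed.

End LaplaceConvergence.

(** * Integrals of tail probabilities *)

Section TailIntegrals.
Context {R : realType}.
Notation mu := (@lebesgue_measure R).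

Section TailIntegral.
Context {d : measure_display} {T : measurableType d} (P : probability T R).
Context (X : T -> \bar R) (phi : R -> R).
Hypothesis mX : measurable_fun setT X.
Hypothesis mphi : measurable_fun setT phi.
Hypothesis phi0 : forall t, 0 <= phi t.

Let f (z : T * R) : \bar R :=
  if (0 <= z.2) && (z.2%:E < X z.1)%E then (phi z.2)%:E else 0%E.

Let mf : measurable_fun setT f.
Proof.
apply: measurable_fun_ifT => //=.
  apply: measurable_and.
    by apply: measurable_fun_ler => //; exact: measurable_snd.
  apply: measurable_fun_lte.
    by apply/measurable_EFinP; exact: measurable_snd.
  by apply: measurableT_comp => //; exact: measurable_fst.
by apply/measurable_EFinP; apply: measurableT_comp => //; exact: measurable_snd.
Qed.

Let f0 z : (0 <= f z)%E. Proof. by rewrite /f; case: ifP => // _; rewrite lee_fin. Qed.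

Let tail_integralE w :
  (\int[mu]_(t in [set t | (0 <= t)%R /\ t%:E < X w]) (phi t)%:E =
   \int[mu]_t f (w, t))%E.
Proof.
rewrite integral_mkcond; apply: eq_integral => t _.
rewrite patchE /f/=; case: ifPn => [/set_mem[-> ->]//|/negP nt].
by rewrite ifF//; apply/negbTE/negP => /andP[t0 tX]; apply: nt; apply/mem_set.
Qed.

Lemma measurable_tail_integral : measurable_fun setT (fun w =>
  \int[mu]_(t in [set t | (0 <= t)%R /\ t%:E < X w]) (phi t)%:E)%E.
Proof.
under eq_fun do rewrite tail_integralE.
exact: (@measurable_fun_fubini_tonelli_F _ _ _ _ _ mu f mf f0).
Qed.

(** Fubini's theorem on the region below the graph of [X]. When [phi] is the
    derivative of a function that vanishes at 0, the left-hand side is the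
    expectation of this function of [X]. *)
Lemma integral_tail :
  (\int[P]_w \int[mu]_(t in [set t | (0 <= t)%R /\ t%:E < X w]) (phi t)%:E =
   \int[mu]_(t in `[0%R, +oo[) ((phi t)%:E * P [set w | t%:E < X w]))%E.
Proof.
under eq_integral do rewrite tail_integralE.
rewrite (@fubini_tonelli _ _ _ _ _ P mu f mf f0) [RHS]integral_mkcond; apply: eq_integral => t _.
rewrite patchE mem_setE in_itv/= andbT; case: ifPn => t0; last first.
  by rewrite /f/= (negbTE t0) integral0.
have mt : measurable [set w | (t%:E < X w)%E].
  by rewrite -[X in measurable X]setTI; exact: measurable_lte.
rewrite /f/= t0/=.
transitivity (\int[P]_(w in [set w | t%:E < X w]) (phi t)%:E)%E.
  rewrite [RHS]integral_mkcond; apply: eq_integral => w _; rewrite patchE.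
  case: ifPn => [tX|tX]; first by rewrite mem_set.
  by rewrite memNset//=; exact/negP.
by rewrite integral_cst.
Qed.

End TailIntegral.

Lemma integral_lt_cst1 (x : \bar R) : (0 <= x)%E ->
  (\int[mu]_(t in [set t | (0 <= t)%R /\ t%:E < x]) 1 = x)%E.
Proof.
case: x => [r| |//] r0.
- have -> : [set t | 0 <= t /\ (t%:E < r%:E)%E] = `[0, r[%classic.
    by apply/seteqP; split => t /=; rewrite in_itv/= lte_fin => /andP.
  rewrite integral_cst//= mul1e lebesgue_measure_itv/= lte_fin sube0.
  by case: ltP => // rle0; congr EFin; apply/le_anti; rewrite rle0 -lee_fin r0.
- have -> : [set t : R | 0 <= t /\ (t%:E < +oo)%E] = [set` `[(0 : R), +oo[].
    apply/seteqP; split => t /=; rewrite in_itv/= andbT; first by case.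
    by move=> t0; split => //; rewrite ltry.
  by rewrite integral_cst//= mul1e lebesgue_measure_itv/= ltry.
Qed.

Lemma continuous_expRN (s : R) : continuous (fun t : R => expR (- s * t)).
Proof.
move=> t; apply: continuous_comp; last exact: continuous_expR.
by apply: cvgM; [exact: cvg_cst|exact: cvg_id].
Qed.

Lemma integral_lt_expR (s r : R) : 0 < s -> 0 <= r ->
  (\int[mu]_(t in [set t | (0 <= t)%R /\ t%:E < r%:E]) (expR (- s * t))%:E =
   ((1 - expR (- s * r)) / s)%:E)%E.
Proof.
move=> s0 r0.
have -> : [set t | 0 <= t /\ (t%:E < r%:E)%E] = `[0, r[%classic.
  by apply/seteqP; split => t /=; rewrite in_itv/= lte_fin => /andP.
have [->|r_neq0] := eqVneq r 0.
  by rewrite set_itvco0 integral_set0 mulr0 expR0 subrr mul0r.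
have rp : 0 < r by rewrite lt_neqAle eq_sym r_neq0.
have me : measurable_fun setT (fun t : R => expR (- s * t)).
  by apply: continuous_measurable_fun; exact: continuous_expRN.
rewrite integral_itv_bndo_bndc; last exact/measurable_EFinP/measurable_funTS.
have dF (t : R) : is_derive t 1 (fun t : R => - (expR (- s * t) / s)) (expR (- s * t)).
  apply: is_derive_eq.
  by rewrite /GRing.scale/=; field; rewrite gt_eqF.
have cF : continuous (fun t : R => - (expR (- s * t) / s)).
  move=> t; apply: cvgN; apply: cvgM; last exact: cvg_cst.
  exact: continuous_expRN.
rewrite (@continuous_FTC2 _ _ (fun t : R => - (expR (- s * t) / s)))//.
- by rewrite mulr0 expR0 -EFinB; congr EFin; field; rewrite gt_eqF.
- by apply: continuous_subspaceT; exact: continuous_expRN.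
- split.
  + by move=> t _; exact: ex_derive.
  + by apply/cvg_at_right_filter; exact: cF.
  + by apply/cvg_at_left_filter; exact: cF.
- by move=> t _; rewrite derive1E derive_val.
Qed.

(** Obtained by [n] integrations by parts. *)
Fixpoint gamma_primitive (b : R) n (t : R) : R :=
  if n is m.+1 then b^-1 * (gamma_primitive b m t - expR (- b * t) * (t ^+ n / n`!%:R))
  else - (expR (- b * t) / b).

Lemma is_derive_gamma_primitive (b : R) n (t : R) : b != 0 ->
  is_derive t 1 (gamma_primitive b n) (expR (- b * t) * (t ^+ n / n`!%:R)).
Proof.
move=> b0; elim: n => [|n IH] /=.
  apply: is_derive_eq.
  by rewrite fact0 expr0 /GRing.scale/=; field.
have f0 : (n`!)%:R != 0 :> R by rewrite pnatr_eq0 -lt0n fact_gt0.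
have n0 : n%:R + 1 != 0 :> R by rewrite natr1 pnatr_eq0.
have dterm : is_derive t 1
    (fun t : R => expR (- b * t) * (t ^+ n.+1 / (n.+1)`!%:R))
    (expR (- b * t) * (t ^+ n / n`!%:R - b * (t ^+ n.+1 / (n.+1)`!%:R))).
  have dpow : is_derive t 1 (fun t : R => t ^+ n.+1 / (n.+1)`!%:R)
      (t ^+ n / n`!%:R).
    have := is_derive_poly ((n.+1)`!%:R^-1 *: 'X^(n.+1)) t.
    have -> : horner ((n.+1)`!%:R^-1 *: 'X^(n.+1)) = (fun t : R => t ^+ n.+1 / (n.+1)`!%:R) :> (R -> R).
      by apply/funext => x; rewrite hornerZ hornerXn mulrC.
    move=> dp; apply: (@is_derive_eq _ _ _ _ _ _ _ _ dp).
    rewrite derivZ derivXn hornerZ hornerMn hornerXn factS natrM.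
    by rewrite -mulr_natl -natr1; field; rewrite f0 n0.
  have dexp : is_derive t 1 (fun t : R => expR (- b * t)) (expR (- b * t) * (- b)).
    by apply: is_derive_eq; rewrite /GRing.scale/=; ring.
  apply: (@is_derive_eq _ _ _ _ _ _ _ _ (is_deriveM dexp dpow)).
  by rewrite /GRing.scale/=; ring.
apply: (@is_derive_eq _ _ _ _ _ _ _ _ (is_deriveZ b^-1 (is_deriveB IH dterm))).
by rewrite /GRing.scale/=; field; rewrite b0 f0 pnatr_eq0 -lt0n fact_gt0.
Qed.

Lemma gamma_primitive0 (b : R) n : b != 0 -> gamma_primitive b n 0 = - b^-1 ^+ n.+1.
Proof.
move=> b0; elim: n => [|n IH] /=; first by rewrite mulr0 expR0 expr1 mul1r.
by rewrite IH expr0n/= mul0r !mulr0 subr0 mulrN -exprS.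
Qed.

Lemma cvg_expRN_pinfty (b : R) : 0 < b -> expR (- b * t) @[t --> +oo] --> (0 : R).
Proof.
move=> b0.
have -> : (fun t : R => expR (- b * t)) = (fun x => expR (- x)) \o (fun t => b * t).
  by apply/funext => t /=; rewrite mulNr.
apply: (@cvg_comp _ _ _ _ _ _ (pinfty_nbhs R)); last exact: cvgr_expR.
exact: gt0_cvgMry.
Qed.

(** The function is the [n]-th power of [expR (- c * t) * t] with [c = b / n], and
    half of the exponent [c * t] suffices to absorb the factor [t]. *)
Lemma cvg_expRN_mulXn (b : R) n : 0 < b ->
  expR (- b * t) * t ^+ n @[t --> +oo] --> (0 : R).
Proof.
move=> b0; case: n => [|n].
  by under eq_fun do rewrite expr0 mulr1; exact: cvg_expRN_pinfty.
pose c := b / n.+1%:R.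
have c0 : 0 < c by rewrite divr_gt0.
have c20 : 0 < c / 2 by rewrite divr_gt0.
have base : expR (- c * t) * t @[t --> +oo] --> (0 : R).
  apply: (@squeeze_cvgr _ _ _ _ (cst 0) (fun t => 2 / c * expR (- (c / 2) * t))).
  - near=> t; have t0 : 0 <= t by near: t; exact: nbhs_pinfty_ge.
    rewrite /cst mulr_ge0 ?expR_ge0//=.
    have -> : - c * t = - (c / 2) * t + - (c / 2) * t by field.
    rewrite expRD -mulrA [leRHS]mulrC ler_wpM2l ?expR_ge0//.
    have h : c / 2 * t <= expR (c / 2 * t).
      by rewrite (le_trans _ (expR_ge1Dx _))// lerDr.
    rewrite mulNr -ler_pdivlMl ?expR_gt0// -expRN opprK.
    by rewrite -ler_pdivrMr ?divr_gt0// invf_div mulrC.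
  - exact: cvg_cst.
  - rewrite -[X in _ --> X](mulr0 (2 / c)); apply: cvgM; first exact: cvg_cst.
    exact: cvg_expRN_pinfty.
have -> : (fun t : R => expR (- b * t) * t ^+ n.+1) =
          (fun t : R => (expR (- c * t) * t) ^+ n.+1).
  apply/funext => t; rewrite exprMn -expRM_natl; congr (expR _ * _).
  by rewrite mulrA mulrN [_ * c]mulrC /c divfK ?pnatr_eq0.
rewrite -[X in _ --> X](expr0n R n.+1).
apply: (@cvg_comp _ _ _ (fun t : R => expR (- c * t) * t) (fun x : R => x ^+ n.+1) _ (nbhs (0 : R))) => //.
exact: exprn_continuous.
Unshelve. all: end_near. Qed.

Lemma integral_gamma (b : R) n : 0 < b ->
  (\int[mu]_(t in `[0%R, +oo[) (expR (- b * t) * (t ^+ n / n`!%:R))%:E =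
   (b^-1 ^+ n.+1)%:E)%E.
Proof.
move=> b0; have b_neq0 : b != 0 by rewrite gt_eqF.
have dF := fun t => is_derive_gamma_primitive n t b_neq0.
rewrite (@ge0_continuous_FTC2y R _ (gamma_primitive b n) 0 0).
- by rewrite gamma_primitive0// sub0e -EFinN opprK.
- by move=> t t0; rewrite mulr_ge0 ?expR_ge0// divr_ge0// exprn_ge0.
- apply: continuous_subspaceT => t; apply: cvgM; first exact: continuous_expRN.
  by apply: cvgM; [exact: exprn_continuous|exact: cvg_cst].
- have lim_term k : expR (- b * t) * (t ^+ k / k`!%:R) @[t --> +oo] --> (0 : R).
    have -> : (fun t : R => expR (- b * t) * (t ^+ k / k`!%:R)) =
        (fun t : R => expR (- b * t) * t ^+ k * k`!%:R^-1).
      by apply/funext => t; rewrite mulrA.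
    rewrite -[X in _ --> X](mul0r (k`!%:R^-1 : R)); apply: cvgM; last exact: cvg_cst.
    exact: cvg_expRN_mulXn.
  elim: n {dF} => [|n IH] /=.
    rewrite [X in _ --> X](_ : (0 : R) = - (0 * b^-1)); last by rewrite mul0r oppr0.
    by apply: cvgN; apply: cvgM; [exact: cvg_expRN_pinfty|exact: cvg_cst].
  rewrite [X in _ --> X](_ : (0 : R) = b^-1 * (0 - 0)); last by rewrite subr0 mulr0.
  by apply: cvgM; [exact: cvg_cst|apply: cvgB => //; exact: lim_term].
- by move=> t _; exact: ex_derive.
- apply/cvg_at_right_filter/differentiable_continuous/derivable1_diffP.
  exact: ex_derive.
- by move=> t _; rewrite derive1E derive_val.
Qed.

End TailIntegrals.

(** * Convergence to an exponential law *)

Section ExponentialLimit.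
Context {R : realType} (lam : R) (lam0 : 0 < lam).
Notation mu := (@lebesgue_measure R).
Let Q :=
  exponential_distribution_exponential_prob__canonical__probability_measure_Probability lam0.

Lemma exponential_prob_gt (t : R) : 0 <= t ->
  Q [set x | t < Num.max 0 x] = (expR (- lam * t))%:E.
Proof.
move=> t0.
have -> : [set x | t < Num.max 0 x] = `]t, +oo[%classic.
  by apply/seteqP; split => x /=; rewrite in_itv/= andbT lt_max ltNge t0.
rewrite /Q/= /exponential_prob.
have me : measurable_fun setT (fun x : R => (exponential_pdf lam x)%:E).
  by apply/measurable_EFinP; exact: measurable_exponential_pdf.
rewrite integral_itv_obnd_cbnd; last exact: measurable_funTS.
have -> : (\int[mu]_(x in `[t, +oo[) (exponential_pdf lam x)%:E =
    \int[mu]_(x in `[t, +oo[) (lam * expR (- lam * x))%:E)%E.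
  apply: eq_integral => x /set_mem /=; rewrite in_itv/= andbT => tx.
  by rewrite exponential_pdfE// (le_trans t0).
have dF (x : R) :
    is_derive x 1 (fun x => - expR (- lam * x)) (lam * expR (- lam * x)).
  by apply: is_derive_eq; rewrite /GRing.scale/=; ring.
rewrite (@ge0_continuous_FTC2y R _ (fun x => - expR (- lam * x)) t 0).
- by rewrite sub0e -EFinN opprK.
- by move=> x _; rewrite mulr_ge0 ?expR_ge0// ltW.
- apply: continuous_subspaceT => x; apply: cvgM; first exact: cvg_cst.
  exact: continuous_expRN.
- rewrite [X in _ --> X](_ : (0 : R) = - 0); last by rewrite oppr0.
  by apply: cvgN; exact: cvg_expRN_pinfty.
- by move=> x _; exact: ex_derive.
- by apply/cvg_at_right_filter; apply: cvgN; exact: continuous_expRN.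
- by move=> x _; rewrite derive1E (@derive_val _ _ _ _ _ _ _ (dF x)).
Qed.

Lemma exponential_prob_lt0 : Q [set x | x < 0] = 0%E.
Proof.
rewrite /Q/= /exponential_prob; apply: integral0_eq => x /= x0.
by rewrite /exponential_pdf patchE ifF// memNset//= in_itv/= andbT leNgt x0.
Qed.

(** The exponential law charges no negative number: this is its identity variable,
    made nonnegative everywhere. *)
Let X' (x : R) : R := Num.max 0 x.

Let mX' : measurable_fun setT X'.
Proof. by apply: measurable_maxr. Qed.

Lemma exponential_laplace (th : R) : 0 <= th ->
  \int[Q]_x expR (- th * X' x) = lam / (lam + th).
Proof.
rewrite le_eqVlt => /predU1P[<-|th0].
  under eq_Rintegral do rewrite oppr0 mul0r expR0.
  by rewrite Rintegral_prob_cst addr0 divff// gt_eqF.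
have X'0 x : 0 <= X' x by rewrite /X' le_max lexx.
have me : measurable_fun setT (fun x : R => expR (- th * x)).
  by apply: continuous_measurable_fun; exact: continuous_expRN.
have b x : `|expR (- th * X' x)| <= 1.
  rewrite ger0_norm ?expR_ge0// -[leRHS]expR0 ler_expR mulNr oppr_le0.
  by rewrite mulr_ge0// ltW.
have i1 : Q.-integrable setT (EFin \o (fun x => expR (- th * X' x))).
  by apply: (@bounded_integrable _ _ _ _ _ 1) => //; exact: (measurableT_comp me mX').
have i2 : Q.-integrable setT (EFin \o (fun=> 1 : R)).
  by apply: (@bounded_integrable _ _ _ _ _ 1) => //= x; rewrite normr1.
have i3 : Q.-integrable setT (EFin \o (fun x => 1 - expR (- th * X' x))).
  exact: (integrableB measurableT i2 i1).
have mEX : measurable_fun setT (fun x => (X' x)%:E) by exact/measurable_EFinP.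
have := integral_tail Q mEX me (fun t => expR_ge0 _).
under eq_integral do rewrite integral_lt_expR//.
have -> : (\int[mu]_(t in `[0%R, +oo[)
    ((expR (- th * t))%:E * Q [set w | t%:E < (X' w)%:E]) =
    \int[mu]_(t in `[0%R, +oo[) (expR (- (th + lam) * t) * (t ^+ 0 / 0`!%:R))%:E)%E.
  apply: eq_integral => t /set_mem /=; rewrite in_itv/= andbT => t0.
  have -> : [set w | (t%:E < (X' w)%:E)%E] = [set x | t < Num.max 0 x] by [].
  rewrite exponential_prob_gt// -EFinM -expRD expr0 fact0 divr1 mulr1.
  by congr (expR _)%:E; ring.
rewrite integral_gamma ?addr_gt0// expr1 => E.
have : \int[Q]_x ((1 - expR (- th * X' x)) / th) = (th + lam)^-1.
  by rewrite /Rintegral E.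
rewrite RintegralZr// RintegralB// Rintegral_prob_cst.
set L := Rintegral _ _ _; move=> EL.
have -> : L = 1 - (1 - L) / th * th by rewrite divfK ?gt_eqF//; ring.
by rewrite EL; field; rewrite gt_eqF// addr_gt0.
Qed.

Theorem laplace_cvg_exponential (F : set_system R) {FF : Filter F}
    (d : R -> measure_display) (Om : forall r, measurableType (d r))
    (P : forall r, probability (Om r) R) (X : forall r : R, Om r -> R) :
  (\forall r \near F, measurable_fun setT (@X r) /\ forall w, 0 <= @X r w) ->
  (forall th : R, 0 <= th ->
     \int[P r]_w expR (- th * @X r w) @[r --> F] --> lam / (lam + th)) ->
  forall (h : R -> R), continuous h -> (exists M, forall x, `|h x| <= M) ->
  (\int[P r]_w (h (@X r w))%:E)%E @[r --> F] -->
  (\int[exponential_prob lam]_x (h x)%:E)%E.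
Proof.
move=> X_ok lapX h ch [M hM].
have X'0 x : 0 <= X' x by rewrite /X' le_max lexx.
have mh : measurable_fun setT h by exact: continuous_measurable_fun.
have -> : (\int[exponential_prob lam]_x (h x)%:E)%E = (\int[Q]_x h (X' x))%:E.
  rewrite EFin_Rintegral; last first.
    by apply: (@bounded_integrable _ _ _ _ _ M) => //; exact: measurableT_comp.
  apply: ae_eq_integral => //.
  - exact/measurable_EFinP.
  - by apply/measurable_EFinP; exact: measurableT_comp.
  - exists [set x | x < 0]; split.
    + by rewrite -set_itvNyo.
    + exact: exponential_prob_lt0.
    + move=> x /= /not_implyP[_ hx]; rewrite ltNge; apply/negP => x0.
      by apply: hx; rewrite /X' (max_idPr _).
apply: (@cvg_trans _ ((\int[P r]_w h (@X r w))%:E @[r --> F])).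
  apply: near_eq_cvg; apply: filterS X_ok => r [mX X0].
  rewrite EFin_Rintegral//; apply: (@bounded_integrable _ _ _ _ _ M) => //.
  exact: measurableT_comp.
apply: cvg_EFin; first exact: nearW.
exact: (laplace_cvg (P' := Q) lam0 X_ok mX' X'0 lapX (@exponential_laplace) ch hM).
Qed.

End ExponentialLimit.

(** * The first-come-first-matched policy *)

Section FCFM.
Context {N : nat} (e : rel 'I_N) {T : Type} (cls : T -> 'I_N).
Implicit Types (s u v : seq T) (x y : T).

Definition compatible s x := has (fun y => e (cls y) (cls x)) s.

Lemma compatible_rcons s y x :
  compatible (rcons s y) x = e (cls y) (cls x) || compatible s x.
Proof. by rewrite /compatible has_rcons. Qed.

Lemma compatible_cat u v x : compatible (u ++ v) x = compatible u x || compatible v x.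
Proof. by rewrite /compatible has_cat. Qed.

Lemma fcfm_append s x : ~~ compatible s x -> fcfm e cls s x = rcons s x.
Proof. by rewrite /compatible has_find /fcfm => /negbTE ->. Qed.

Lemma fcfm_catl u v x : compatible u x -> fcfm e cls (u ++ v) x = fcfm e cls u x ++ v.
Proof.
move=> hu; have fu : (find (fun y => e (cls y) (cls x)) u < size u)%N.
  by rewrite -has_find.
rewrite /fcfm find_cat -/(compatible u x) hu fu size_cat (leq_trans fu) ?leq_addr//.
rewrite takel_cat ?(ltnW fu)// -catA drop_cat.
have [//|le_u] := ltnP (find (fun y => e (cls y) (cls x)) u).+1 (size u).
have -> : (find (fun y => e (cls y) (cls x)) u).+1 = size u.
  by apply/eqP; rewrite eqn_leq fu le_u.
by rewrite subnn drop0 drop_size.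
Qed.

Lemma fcfm_catr u v x : ~~ compatible u x -> compatible v x ->
  fcfm e cls (u ++ v) x = u ++ fcfm e cls v x.
Proof.
move=> nu; rewrite {1}/compatible has_find => hv.
rewrite /fcfm find_cat -/(compatible u x) (negbTE nu) size_cat ltn_add2l hv.
rewrite -addnS [(size u + _.+1)%N]addnC -drop_drop drop_size_cat//.
by rewrite take_cat ltnNge leq_addr addKn catA.
Qed.

Lemma fcfm_hit y v x : e (cls y) (cls x) -> fcfm e cls (y :: v) x = v.
Proof. by move=> yx; rewrite /fcfm /= yx/= drop0. Qed.

Lemma size_fcfm_hit s x : compatible s x -> size s = (size (fcfm e cls s x)).+1.
Proof.
rewrite /compatible has_find /fcfm => hs; rewrite hs size_cat size_take hs.
by rewrite size_drop; lia.
Qed.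

Lemma mem_fcfm_hit (U : eqType) (f : T -> U) s x (y : U) : compatible s x ->
  y \in map f (fcfm e cls s x) -> y \in map f s.
Proof.
rewrite /compatible has_find /fcfm => hs; rewrite hs map_cat mem_cat map_take map_drop.
by case/orP => [/mem_take//|/mem_drop].
Qed.

End FCFM.

Lemma fcfm_map {N : nat} (e : rel 'I_N) (T T' : Type) (cls : T' -> 'I_N) (f : T -> T')
    (s : seq T) (x : T) :
  fcfm e cls (map f s) (f x) = map f (fcfm e (cls \o f) s x).
Proof.
rewrite /fcfm find_map size_map.
rewrite (eq_find (a2 := fun y => e ((cls \o f) y) ((cls \o f) x)))//.
by case: ifP => _; rewrite ?map_rcons// map_cat map_take map_drop.
Qed.

Definition insert {T : Type} (p : nat) (k : T) (c : seq T) := take p c ++ k :: drop p c.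

Lemma insert_rcons T p k (c : seq T) j : (p <= size c)%N ->
  insert p k (rcons c j) = rcons (insert p k c) j.
Proof.
move=> pc; rewrite /insert -cats1 takel_cat// drop_cat.
have [pl|le_cp] := ltnP p (size c); first by rewrite -cats1 -catA.
have -> : p = size c by apply/eqP; rewrite eqn_leq pc.
by rewrite subnn drop0 drop_size -cats1 -catA.
Qed.

Lemma insert_size T k (c : seq T) : insert (size c) k c = rcons c k.
Proof. by rewrite /insert take_size drop_size cats1. Qed.

Section States.
Context {N : nat} (e : rel 'I_N).
Hypotheses (e_sym : symmetric e) (e_irr : irreflexive e).
Implicit Types (c x : buffer N) (i j k m : 'I_N).

Notation adj := (compatible e id).
Notation arrive := (fcfm e id).

Definition admissible c := [forall i in c, forall j in c, ~~ e i j].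

Lemma admissibleP c :
  reflect (forall i j, i \in c -> j \in c -> ~~ e i j) (admissible c).
Proof.
apply: (iffP idP) => [H i j ic jc|H].
  by move/forallP/(_ i)/implyP/(_ ic)/forallP/(_ j)/implyP/(_ jc): H.
by apply/forallP => i; apply/implyP => ic; apply/forallP => j; apply/implyP; exact: H.
Qed.

Lemma adjP c m : reflect (exists2 i, i \in c & e i m) (adj c m).
Proof. exact: hasP. Qed.

Lemma eq_adj c x m : c =i x -> adj c m = adj x m.
Proof. by move=> cx; exact: eq_has_r. Qed.

Lemma admissible_rcons c j : admissible (rcons c j) = admissible c && ~~ adj c j.
Proof.
apply/admissibleP/andP => [H|[/admissibleP H nj] i k].
  split; first by apply/admissibleP => i k ic kc; apply: H; rewrite mem_rcons inE ?ic ?kc orbT.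
  apply/adjP => -[i ic]; apply/negP; apply: H; rewrite mem_rcons inE ?eqxx// ic orbT//.
rewrite !mem_rcons !inE => /predU1P[->|ic] /predU1P[->|kc]; first by rewrite e_irr.
- by rewrite e_sym; apply: contra nj => ekj; apply/adjP; exists k.
- by apply: contra nj => ekj; apply/adjP; exists i.
- exact: H.
Qed.

Lemma sub_admissible c x : {subset x <= c} -> admissible c -> admissible x.
Proof.
by move=> xc /admissibleP H; apply/admissibleP => i j ix jx; apply: H; exact: xc.
Qed.

Lemma arrive_hit_sub c m : adj c m -> {subset arrive c m <= c}.
Proof.
by move=> cm i; have := @mem_fcfm_hit _ e _ id _ id c m i cm; rewrite !map_id.
Qed.

Lemma arrive_admissible c m : admissible c -> admissible (arrive c m).
Proof.
move=> ac; have [cm|cm] := boolP (adj c m).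
  exact: sub_admissible (arrive_hit_sub cm) ac.
by rewrite fcfm_append// admissible_rcons ac cm.
Qed.

Lemma arrive_neq c m : arrive c m != c.
Proof.
apply/eqP => E; have [cm|cm] := boolP (adj c m).
  by have := size_fcfm_hit cm; rewrite E; lia.
by have := fcfm_append cm; rewrite E => /(congr1 size); rewrite size_rcons; lia.
Qed.

(** The newest item only matters to a newcomer that no older item can serve; this
    makes induction on the newest item work. *)
Lemma arrive_rcons_older c j m : adj c m -> arrive (rcons c j) m = rcons (arrive c m) j.
Proof. by move=> cm; rewrite -!cats1 fcfm_catl. Qed.

Lemma arrive_rcons_newest c j m : ~~ adj c m -> e j m -> arrive (rcons c j) m = c.
Proof.
move=> cm jm; rewrite -cats1 fcfm_catr//; last by rewrite /compatible/= jm.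
by rewrite fcfm_hit// cats0.
Qed.

(** A matching read backwards: the predecessors of a buffer are obtained by
    inserting the item that the newcomer has taken away. *)
Lemma arrive_hitE c m : admissible c -> adj c m ->
  exists p k, [/\ (p <= size (arrive c m))%N, c = insert p k (arrive c m), e k m,
    ~~ adj (take p (arrive c m)) m & ~~ adj (arrive c m) k].
Proof.
move=> /admissibleP ac cm; set p := find (fun y => e y m) c.
have pc : (p < size c)%N by rewrite -has_find.
exists p, (nth m c p).
have -> : arrive c m = take p c ++ drop p.+1 c by rewrite /fcfm -/p pc.
have szp : size (take p c) = p by rewrite size_take pc.
have tk : take p (take p c ++ drop p.+1 c) = take p c by rewrite take_size_cat.
split.
- by rewrite size_cat szp leq_addr.
- by rewrite /insert tk drop_size_cat// -drop_nth// cat_take_drop.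
- by rewrite (@nth_find _ m (fun y => e y m)).
- rewrite tk; apply/adjP => -[i it im].
  have := before_find m (a := fun y => e y m) (s := c) (i := index i (take p c)).
  have ip : (index i (take p c) < p)%N by rewrite -{2}szp index_mem.
  move=> /(_ ip)/=; rewrite -(nth_take m ip) nth_index// im//.
- apply/adjP => -[i ic]; apply/negP; apply: ac; last exact: mem_nth.
  by move: ic; rewrite mem_cat => /orP[/mem_take|/mem_drop].
Qed.

Lemma mem_classes c i : (i \in classes c) = (i \in c).
Proof. by rewrite /classes inE. Qed.

Lemma mem_nbrs (J : {set 'I_N}) m : (m \in nbrs e J) = [exists i in J, e i m].
Proof.
apply/bigcupP/existsP => [[i iJ]|[i /andP[iJ im]]]; first by rewrite inE => im; exists i; rewrite iJ.
by exists i => //; rewrite inE.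
Qed.

Lemma mem_nbrs_classes c m : (m \in nbrs e (classes c)) = adj c m.
Proof.
rewrite mem_nbrs; apply/existsP/adjP => [[i]|[i ic im]].
  by rewrite mem_classes => /andP[ic im]; exists i.
by exists i; rewrite mem_classes ic.
Qed.

Lemma indep0P (J : {set 'I_N}) :
  reflect (forall i j, i \in J -> j \in J -> ~~ e i j) (indep0 e J).
Proof.
apply: (iffP orP) => [[/eqP-> i j|]|H].
- by rewrite finset.inE.
- by case/andP => _ /forallP H i j iJ jJ; move/implyP/(_ iJ)/forallP/(_ j)/implyP/(_ jJ): (H i).
- have [->|J0] := eqVneq J finset.set0; [by left|right].
  rewrite /indep J0/=; apply/forallP => i; apply/implyP => iJ; apply/forallP => j.
  by apply/implyP; exact: H.
Qed.

Lemma indep0_classes c : indep0 e (classes c) = admissible c.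
Proof.
apply/indep0P/admissibleP => H i j; first by rewrite -!mem_classes; exact: H.
by rewrite !mem_classes; exact: H.
Qed.

Lemma classes_rcons c j : classes (rcons c j) = (j |: classes c)%SET.
Proof.
by apply/setP => i; rewrite mem_classes mem_rcons !finset.inE -[i \in c]mem_classes.
Qed.

End States.

(** * Product-form weights *)

Section ProductWeight.
Context {R : realType} {N : nat} (e : rel 'I_N) (a : 'I_N -> R).
Hypotheses (e_sym : symmetric e) (e_irr : irreflexive e).
Hypothesis no_isolated : forall i, exists j, e i j.
Hypothesis a_gt0 : forall i, 0 < a i.
Implicit Types (c x : buffer N) (i j k m : 'I_N).

Notation adj := (compatible e id).

Definition match_rate c : R := \sum_(m | adj c m) a m.

Lemma eq_match_rate c x : c =i x -> match_rate c = match_rate x.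
Proof. by move=> cx; apply: eq_bigl => m; exact: eq_adj. Qed.

Lemma match_rate_ge0 c : 0 <= match_rate c.
Proof. by apply: sumr_ge0 => m _; exact: ltW. Qed.

Lemma match_rate_gt0 c j : 0 < match_rate (rcons c j).
Proof.
have [m jm] := no_isolated j.
rewrite /match_rate (bigD1 m)/=; last by rewrite compatible_rcons jm.
by rewrite ltr_wpDr// sumr_ge0// => i _; exact: ltW.
Qed.

(** Each item contributes its own arrival rate, divided by the rate of the
    newcomers that find a match among this item and the older ones. The list is
    read from the newest item. *)
Fixpoint rev_weight (s : seq 'I_N) : R :=
  if s is j :: s' then rev_weight s' * (a j / match_rate s) else 1.

Definition weight c : R := rev_weight (rev c).

Lemma weight_nil : weight [::] = 1. Proof. by []. Qed.

Lemma weight_rcons c j :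
  weight (rcons c j) = weight c * (a j / match_rate (rcons c j)).
Proof.
rewrite /weight rev_rcons /=; congr (_ * (_ / _)); apply: eq_match_rate => i.
by rewrite inE mem_rev mem_rcons inE.
Qed.

Lemma weight_gt0 c : 0 < weight c.
Proof.
elim/last_ind: c => [|c j IH]; first by rewrite weight_nil.
by rewrite weight_rcons mulr_gt0// divr_gt0// match_rate_gt0.
Qed.

Lemma weight_rcons_rate c j : weight (rcons c j) * match_rate (rcons c j) = weight c * a j.
Proof. by rewrite weight_rcons -mulrA divfK// gt_eqF// match_rate_gt0. Qed.

(** Flow into [c] through the matchings that take away an item of class [k]: this
    item stood at some position [p], and the newcomer is one that no older item
    could serve. *)
Definition insertion_flow c k : R := \sum_(p < (size c).+1)
  weight (insert p k c) * \sum_(m | e k m && ~~ adj (take p c) m) a m.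

(** By induction on the newest item [j] of [c]. An insertion before [j] changes the
    factor of [j] into [a j / M], where [M] is the matching rate of [c] with [j] and
    [k] added; an insertion after [j] concerns only the newcomers matched by [k]
    alone. The two contributions add up because [M] is the sum of the two
    corresponding rates. *)
Lemma insertion_flowE c k : insertion_flow c k = a k * weight c.
Proof.
rewrite /insertion_flow; elim/last_ind: c => [|c j IH].
  rewrite big_ord1 weight_nil mulr1 /insert/= -[[:: k]]/(rcons [::] k).
  have -> : \sum_(m | e k m && ~~ adj [::] m) a m = match_rate (rcons [::] k).
    by apply: eq_bigl => m; rewrite compatible_rcons/= orbF andbT.
  by rewrite weight_rcons_rate weight_nil mul1r.
set cj := rcons c j; pose M := match_rate (rcons cj k).
have M_neq0 : M != 0 by rewrite gt_eqF// match_rate_gt0.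
rewrite size_rcons big_ord_recr/=.
have -> : \sum_(p < (size c).+1) weight (insert p k cj) *
    (\sum_(m | e k m && ~~ adj (take p cj) m) a m) =
    (a k * weight c) * (a j / M).
  rewrite -IH mulr_suml; apply: eq_bigr => p _.
  have pc : (p <= size c)%N by rewrite -ltnS.
  have tk : take p cj = take p c by rewrite /cj -cats1 takel_cat.
  rewrite tk insert_rcons// weight_rcons mulrAC; congr (_ * (_ / _)).
  apply: eq_match_rate => i.
  rewrite /cj !(mem_rcons, inE) -[in RHS](cat_take_drop p c) !mem_cat inE.
  by case: (i == j); case: (i == k); rewrite ?orbT.
have -> : (size c).+1 = size cj by rewrite size_rcons.
rewrite insert_size take_size weight_rcons -/M.
have -> : \sum_(m | e k m && ~~ adj cj m) a m = M - match_rate cj.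
  have -> : M = match_rate cj + \sum_(m | e k m && ~~ adj cj m) a m.
    rewrite /M /match_rate (bigID (fun m => adj cj m))/=.
    congr (_ + _); apply: eq_bigl => m; rewrite compatible_rcons.
      by case: (adj cj m); rewrite ?orbT ?andbF.
    by case: (adj cj m); rewrite ?orbT ?andbF ?orbF ?andbT.
  by rewrite addrAC subrr add0r.
have -> : a k * weight c * (a j / M) = weight cj * match_rate cj * a k / M.
  by rewrite weight_rcons_rate; ring.
by field.
Qed.

Hypothesis a_sum1 : \sum_i a i = 1.

(** Flow into [x] from its possible predecessors: an item [k] was removed from
    position [p] by an arrival that no older item could serve, or the last item
    of [x] has just been appended. *)
Definition inflow (W : buffer N -> R) x m : R :=
  (\sum_(p < (size x).+1) \sum_(k | [&& ~~ adj x k, e k m & ~~ adj (take p x) m])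
     W (insert p k x)) +
  (if x == rcons (take (size x).-1 x) m then W (take (size x).-1 x) else 0).

(** The weights solve the balance equations of a process whose states are left at
    rate 1: by [insertion_flowE] the matchings bring a flow [a k * weight x] for
    each class [k] that finds no match in [x], and the arrival of the newest item
    brings [match_rate x * weight x]. *)
Lemma weight_inflow x : admissible e x -> \sum_m a m * inflow weight x m = weight x.
Proof.
move=> ax; under eq_bigr do rewrite mulrDr; rewrite big_split/=.
have -> : \sum_m a m * (\sum_(p < (size x).+1)
    \sum_(k | [&& ~~ adj x k, e k m & ~~ adj (take p x) m]) weight (insert p k x)) =
    \sum_(k | ~~ adj x k) a k * weight x.
  under [RHS]eq_bigr => k _ do rewrite -insertion_flowE /insertion_flow.
  transitivity (\sum_m \sum_(p < (size x).+1) \sum_k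
      (if [&& ~~ adj x k, e k m & ~~ adj (take p x) m]
       then a m * weight (insert p k x) else 0)).
    apply: eq_bigr => m _; rewrite mulr_sumr; apply: eq_bigr => p _.
    by rewrite mulr_sumr big_mkcond.
  rewrite exchange_big/= [RHS]exchange_big/=; apply: eq_bigr => p _.
  rewrite exchange_big/= [RHS]big_mkcond/=; apply: eq_bigr => k _.
  case: ifPn => xk; last by rewrite big1// => m _; rewrite ?(negbTE xk).
  by rewrite mulr_sumr [RHS]big_mkcond; apply: eq_bigr => m _; rewrite ?xk/= mulrC.
have -> : \sum_m a m * (if x == rcons (take (size x).-1 x) m
    then weight (take (size x).-1 x) else 0) = match_rate x * weight x.
  have [->|[c [j ->]]] : x = [::] \/ exists c j, x = rcons c j.
    by case/lastP: x {ax} => [|c j]; [left|right; exists c, j].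
    rewrite big1 => [|m _]; last by rewrite mulr0.
    by rewrite /match_rate big1 ?mul0r.
  rewrite size_rcons/= -cats1 take_size_cat// cats1 (bigD1 j)//= eqxx.
  rewrite big1 ?addr0; first by rewrite mulrC -weight_rcons_rate mulrC.
  by move=> m /negbTE mj; rewrite eqseq_rcons eqxx/= eq_sym mj mulr0.
rewrite -mulr_suml -mulrDl -[RHS]mul1r; congr (_ * _).
by rewrite addrC -a_sum1 [RHS](bigID (fun m => adj x m)).
Qed.

Lemma inflow_cover (W : buffer N -> R) c x m : admissible e c ->
  fcfm e id c m = x -> (forall y, 0 <= W y) -> W c <= inflow W x m.
Proof.
move=> ac cmx W0; rewrite /inflow.
have A0 : 0 <= \sum_(p < (size x).+1)
    \sum_(k | [&& ~~ adj x k, e k m & ~~ adj (take p x) m]) W (insert p k x).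
  by apply: sumr_ge0 => p _; exact: sumr_ge0.
have [cm|cm] := boolP (adj c m).
  have [p [k [ple cE km tpm xk]]] := arrive_hitE ac cm.
  rewrite cmx in ple cE tpm xk.
  apply: ler_wpDr; first by case: ifP.
  have plt : (p < (size x).+1)%N by [].
  rewrite (bigD1 (Ordinal plt))//= ler_wpDr//.
    by apply: sumr_ge0 => q _; exact: sumr_ge0.
  by rewrite (bigD1 k) ?xk ?km//= cE lerDl; exact: sumr_ge0.
rewrite ler_wpDl//; move: cmx; rewrite fcfm_append// => <-.
have -> : take (size (rcons c m)).-1 (rcons c m) = c.
  by rewrite size_rcons -cats1 take_size_cat.
by rewrite eqxx.
Qed.

End ProductWeight.

(** * Integration over buffers *)

Section BufferMeasure.
Context {R : realType} {N : nat} (pi : probability (buffer N) R).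
Implicit Types (c x y : buffer N) (f : buffer N -> R).

Lemma measurable_buffer (A : set (buffer N)) : measurable A.
Proof. by []. Qed.

Lemma measurable_fun_buffer d (T : measurableType d) (D : set (buffer N))
  (f : buffer N -> T) : measurable_fun D f.
Proof. by move=> _ Y _; exact: measurable_buffer. Qed.

Hint Resolve measurable_fun_buffer measurable_buffer : core.

(** A surjection from [nat], which turns sums over buffers into series. *)
Definition decode (n : nat) : buffer N := odflt [::] (@unpickle (seq 'I_N) n).

Lemma decodeK c : decode (@pickle (seq 'I_N) c) = c.
Proof. by rewrite /decode pickleK. Qed.

(** The integral splits according to the value [decode n] of [h]; the test on
    [pickle] counts every buffer exactly once. *)
Lemma integral_fibres (w : buffer N -> R) (h : buffer N -> buffer N) f :
  (forall c, 0 <= w c) -> (forall c, 0 <= f c) ->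
  (\int[pi]_c (w c * f (h c))%:E =
   \sum_(n <oo) (if pickle (decode n : seq 'I_N) == n then f (decode n) else 0)%:E *
     \int[pi]_c (w c * (h c == decode n)%:R)%:E)%E.
Proof.
move=> w0 f0; pose B n := [set c | pickle (h c : seq 'I_N) = n].
have BT : \bigcup_n B n = setT by apply/seteqP; split => // c _; exists (pickle (h c : seq 'I_N)).
rewrite -{1}BT ge0_integral_bigcup//; last 2 first.
- by move=> c _; rewrite lee_fin mulr_ge0.
- by move=> i j _ _ [c [/= <- <-]].
apply: eq_eseriesr => n _; rewrite -ge0_integralZl//; last 2 first.
- by move=> c _; rewrite lee_fin mulr_ge0.
- by rewrite lee_fin; case: ifP.
rewrite integral_mkcond; apply: eq_integral => c _; rewrite patchE.
have [/set_mem/= hc|hc] := boolP (c \in B n).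
  by rewrite -hc decodeK !eqxx -EFinM mulr1 mulrC.
rewrite -EFinM; case: ifPn => [/eqP dn|_]; last by rewrite mul0r.
case: eqP => [hd|_]; last by rewrite !mulr0.
by move: hc; rewrite mem_set//= /B/= hd.
Qed.

(** This is how balance equations, which concern single states, are integrated
    against test functions. *)
Lemma functional_le (K1 K2 : finType) (w1 : K1 -> buffer N -> R)
    (h1 : K1 -> buffer N -> buffer N) (w2 : K2 -> buffer N -> R)
    (h2 : K2 -> buffer N -> buffer N) f :
  (forall k c, 0 <= w1 k c) -> (forall k c, 0 <= w2 k c) -> (forall c, 0 <= f c) ->
  (forall y, \sum_k \int[pi]_c (w1 k c * (h1 k c == y)%:R)%:E <=
             \sum_k \int[pi]_c (w2 k c * (h2 k c == y)%:R)%:E)%E ->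
  (\sum_k \int[pi]_c (w1 k c * f (h1 k c))%:E <=
   \sum_k \int[pi]_c (w2 k c * f (h2 k c))%:E)%E.
Proof.
move=> w10 w20 f0 H.
have I0 (w : buffer N -> R) (h : buffer N -> buffer N) y :
    (forall c, 0 <= w c) -> (0 <= \int[pi]_c (w c * (h c == y)%:R)%:E)%E.
  by move=> w0; apply: integral_ge0 => c _; rewrite lee_fin mulr_ge0.
have g0 n : (0 <= (if pickle (decode n : seq 'I_N) == n then f (decode n) else 0)%:E)%E.
  by rewrite lee_fin; case: ifP.
under eq_bigr do rewrite integral_fibres//.
under [leRHS]eq_bigr do rewrite integral_fibres//.
rewrite -!nneseries_sum; try by move=> k n _; rewrite mule_ge0 ?I0.
apply: lee_nneseries => n _; first by rewrite sume_ge0// => k _; rewrite mule_ge0 ?I0.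
rewrite -!ge0_sume_distrr; try by move=> k _; exact: I0.
by apply: lee_wpmul2l.
Qed.

Definition mass c : R := fine (pi [set c]).

Lemma massE c : (mass c)%:E = pi [set c].
Proof. by rewrite fineK// fin_num_measure. Qed.

Lemma mass_ge0 c : 0 <= mass c.
Proof. by rewrite fine_ge0. Qed.

Lemma integral_eq_mass (w : buffer N -> R) y : (forall c, 0 <= w c) ->
  (\int[pi]_c (w c * (c == y)%:R)%:E = (w y * mass y)%:E)%E.
Proof.
move=> w0; rewrite EFinM massE -[X in (_ * pi X)%E](setIT [set y]).
rewrite -integral_indic// -ge0_integralZl ?lee_fin//.
apply: eq_integral => c _; rewrite -EFinM indicE; congr (_%:E).
case: eqP => [->|cy]; first by rewrite mem_set.
by rewrite memNset ?mulr0.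
Qed.

Lemma integral_mass f : (forall c, 0 <= f c) ->
  (\int[pi]_c (f c)%:E = \esum_(c in setT) (f c * mass c)%:E)%E.
Proof.
move=> f0; have := @integral_fibres (fun=> 1) id f (fun=> ler01) f0.
under eq_integral do rewrite mul1r.
move=> ->.
under eq_eseriesr do rewrite (@integral_eq_mass (fun=> 1))// mul1r.
pose Q n := pickle (decode n : seq 'I_N) == n.
have -> : [set: buffer N] = decode @` Q.
  by apply/seteqP; split => // c _; exists (pickle (c : seq 'I_N)) => //; rewrite /Q/= decodeK.
rewrite (esum_pred_image (fun c => (f c * mass c)%:E)); last 2 first.
- by move=> n _; rewrite lee_fin mulr_ge0 ?mass_ge0.
- by move=> m n /set_mem/eqP Qm /set_mem/eqP Qn E; rewrite -Qm -Qn E.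
rewrite [RHS]eseries_mkcond; apply: eq_eseriesr => n _; rewrite /Q.
by case: ifP => _; rewrite -EFinM ?mul0r.
Qed.

End BufferMeasure.
#[global] Hint Resolve measurable_fun_buffer measurable_buffer : core.

(** * The stationary distribution *)

Section BoundedFunctions.
Context {R : realType} {N : nat} (pi : probability (buffer N) R).
Implicit Types (f g : buffer N -> R) (c x y : buffer N).

Definition bounded_fn f := exists M : R, forall c, `|f c| <= M.

Lemma bounded_cst (k : R) : bounded_fn (fun=> k).
Proof. by exists `|k|. Qed.

Lemma bounded_nat_bool (b : buffer N -> bool) : bounded_fn (fun c => (b c)%:R).
Proof. by exists 1 => c; case: (b c); rewrite ?normr1// normr0. Qed.

Lemma bounded_D f g : bounded_fn f -> bounded_fn g -> bounded_fn (fun c => f c + g c).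
Proof.
by move=> [M fM] [K gK]; exists (M + K) => c; rewrite (le_trans (ler_normD _ _))// lerD.
Qed.

Lemma bounded_N f : bounded_fn f -> bounded_fn (fun c => - f c).
Proof. by move=> [M fM]; exists M => c; rewrite normrN. Qed.

Lemma bounded_B f g : bounded_fn f -> bounded_fn g -> bounded_fn (fun c => f c - g c).
Proof. by move=> bf bg; apply: bounded_D => //; exact: bounded_N. Qed.

Lemma bounded_M f g : bounded_fn f -> bounded_fn g -> bounded_fn (fun c => f c * g c).
Proof. by move=> [M fM] [K gK]; exists (M * K) => c; rewrite normrM ler_pM. Qed.

Lemma bounded_comp f (h : buffer N -> buffer N) : bounded_fn f -> bounded_fn (fun c => f (h c)).
Proof. by move=> [M fM]; exists M => c. Qed.

Lemma bounded_sum (I : finType) (P : pred I) (F : I -> buffer N -> R) :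
  (forall i, bounded_fn (F i)) -> bounded_fn (fun c => \sum_(i | P i) F i c).
Proof.
move=> bF; have [M FM] := @choice _ _ (fun i M => forall c, `|F i c| <= M) bF.
exists (\sum_(i | P i) M i) => c; rewrite (le_trans (ler_norm_sum _ _ _))//.
exact: ler_sum.
Qed.

Lemma bounded_fn_integrable f : bounded_fn f -> pi.-integrable setT (EFin \o f).
Proof. by case=> M fM; exact: bounded_integrable fM. Qed.

Definition Ex f : R := \int[pi]_c f c.

Lemma EFin_Ex f : bounded_fn f -> ((Ex f)%:E = \int[pi]_c (f c)%:E)%E.
Proof. by move=> bf; rewrite /Ex EFin_Rintegral//; exact: bounded_fn_integrable. Qed.

Lemma eq_Ex f g : (forall c, f c = g c) -> Ex f = Ex g.
Proof. by move=> fg; congr Ex; apply/funext. Qed.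

Lemma Ex_cst (k : R) : Ex (fun=> k) = k.
Proof. exact: Rintegral_prob_cst. Qed.

Lemma ExD f g : bounded_fn f -> bounded_fn g -> Ex (fun c => f c + g c) = Ex f + Ex g.
Proof. by move=> bf bg; rewrite /Ex RintegralD//; exact: bounded_fn_integrable. Qed.

Lemma ExB f g : bounded_fn f -> bounded_fn g -> Ex (fun c => f c - g c) = Ex f - Ex g.
Proof. by move=> bf bg; rewrite /Ex RintegralB//; exact: bounded_fn_integrable. Qed.

Lemma ExZ (k : R) f : bounded_fn f -> Ex (fun c => k * f c) = k * Ex f.
Proof. by move=> bf; rewrite /Ex RintegralZl//; exact: bounded_fn_integrable. Qed.

Lemma Ex_sum (I : finType) (P : pred I) (F : I -> buffer N -> R) :
  (forall i, bounded_fn (F i)) ->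
  Ex (fun c => \sum_(i | P i) F i c) = \sum_(i | P i) Ex (F i).
Proof.
move=> bF; elim: (index_enum I) => [|i s IH].
  by rewrite big_nil (eq_Ex (g := fun=> 0)) ?Ex_cst// => c; rewrite big_nil.
rewrite big_cons; case: ifPn => Pi; last first.
  by rewrite -IH; apply: eq_Ex => c; rewrite big_cons (negbTE Pi).
rewrite -IH -ExD//; first by apply: eq_Ex => c; rewrite big_cons Pi.
elim: s {IH} => [|j s [M IH]].
  by exists 0 => c; rewrite big_nil normr0.
have [K jK] := bF j.
exists (K + M) => c; rewrite big_cons; case: ifP => _; last first.
  by rewrite (le_trans (IH c))// lerDr (le_trans _ (jK c)).
by rewrite (le_trans (ler_normD _ _))// lerD.
Qed.

Lemma le_Ex f g : bounded_fn f -> bounded_fn g -> (forall c, f c <= g c) -> Ex f <= Ex g.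
Proof. by move=> bf bg fg; apply: le_Rintegral => //; exact: bounded_fn_integrable. Qed.

Lemma Ex_ge0 f : (forall c, 0 <= f c) -> 0 <= Ex f.
Proof. by move=> f0; apply: Rintegral_ge0. Qed.

Lemma Ex_eq_mass (w : buffer N -> R) y : (forall c, 0 <= w c) ->
  Ex (fun c => w c * (c == y)%:R) = w y * mass pi y.
Proof. by move=> w0; rewrite /Ex /Rintegral integral_eq_mass. Qed.

Lemma Ex_functional_le (K1 K2 : finType) (w1 : K1 -> buffer N -> R)
    (h1 : K1 -> buffer N -> buffer N) (w2 : K2 -> buffer N -> R)
    (h2 : K2 -> buffer N -> buffer N) f :
  (forall k, bounded_fn (w1 k)) -> (forall k, bounded_fn (w2 k)) -> bounded_fn f ->
  (forall k c, 0 <= w1 k c) -> (forall k c, 0 <= w2 k c) -> (forall c, 0 <= f c) ->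
  (forall y, \sum_k Ex (fun c => w1 k c * (h1 k c == y)%:R) <=
             \sum_k Ex (fun c => w2 k c * (h2 k c == y)%:R)) ->
  \sum_k Ex (fun c => w1 k c * f (h1 k c)) <= \sum_k Ex (fun c => w2 k c * f (h2 k c)).
Proof.
move=> b1 b2 bf w10 w20 f0 H; rewrite -lee_fin -!sumEFin.
have E (K : finType) (w : K -> buffer N -> R) (h : K -> buffer N -> buffer N) g :
    (forall k, bounded_fn (w k)) -> bounded_fn g ->
    (\sum_k (Ex (fun c => (w k c * g (h k c))%R))%:E =
     \sum_k \int[pi]_c (w k c * g (h k c))%:E)%E.
  move=> bw bg; apply: eq_bigr => k _; rewrite EFin_Ex//.
  by apply: bounded_M => //; exact: bounded_comp.
rewrite !E//; apply: functional_le => // y.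
have by_ : bounded_fn (fun c => (c == y)%:R) by exact: bounded_nat_bool.
by rewrite -(E _ w1 h1 _ b1 by_) -(E _ w2 h2 _ b2 by_) !sumEFin lee_fin.
Qed.

Lemma Ex_functional_eq (K1 K2 : finType) (w1 : K1 -> buffer N -> R)
    (h1 : K1 -> buffer N -> buffer N) (w2 : K2 -> buffer N -> R)
    (h2 : K2 -> buffer N -> buffer N) f :
  (forall k, bounded_fn (w1 k)) -> (forall k, bounded_fn (w2 k)) -> bounded_fn f ->
  (forall k c, 0 <= w1 k c) -> (forall k c, 0 <= w2 k c) -> (forall c, 0 <= f c) ->
  (forall y, \sum_k Ex (fun c => w1 k c * (h1 k c == y)%:R) =
             \sum_k Ex (fun c => w2 k c * (h2 k c == y)%:R)) ->
  \sum_k Ex (fun c => w1 k c * f (h1 k c)) = \sum_k Ex (fun c => w2 k c * f (h2 k c)).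
Proof.
by move=> b1 b2 bf w10 w20 f0 H; apply/le_anti; rewrite !Ex_functional_le// => y; rewrite H.
Qed.

End BoundedFunctions.

Ltac bounded := repeat (first [ done | exact: bounded_cst | exact: bounded_nat_bool
  | apply: bounded_M | apply: bounded_B ]).

Section StationaryDistribution.
Context {R : realType} {N : nat} (e : rel 'I_N) (a : 'I_N -> R).
Hypotheses (e_sym : symmetric e) (e_irr : irreflexive e).
Hypothesis no_isolated : forall i, exists j, e i j.
Hypothesis a_gt0 : forall i, 0 < a i.
Hypothesis a_sum1 : \sum_i a i = 1.
Context (pi : probability (buffer N) R).
Hypothesis pi_stat : stationary_distribution e a pi.
Implicit Types (c x y : buffer N) (i j k m : 'I_N).

Notation adj := (compatible e id).
Notation arrive := (fcfm e id).
Notation mass := (mass pi).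
Notation Ex := (Ex pi).

Let a_ge0 i : 0 <= a i. Proof. exact: ltW. Qed.

Lemma mass_inadmissible c : ~~ admissible e c -> mass c = 0.
Proof.
move=> nc; apply/le_anti; rewrite mass_ge0 andbT -lee_fin massE.
have [piD _] := pi_stat.
have := probability_setC pi (measurable_buffer (state_space e)).
rewrite piD subee// => D0; rewrite -[leRHS]D0; apply: le_measure; rewrite ?inE//.
by move=> x /= ->; rewrite /state_space/= indep0_classes; exact/negP.
Qed.

Lemma trans_rateE c y : trans_rate e a c y = \sum_i a i * (arrive c i == y)%:R.
Proof.
rewrite /trans_rate big_mkcond; apply: eq_bigr => i _.
by case: ifP => _; rewrite ?mulr1// mulr0.
Qed.

(** Global balance. Every arrival changes the state, so the rate out of a state is
    the total arrival rate, 1, and the balance equations say that the measure is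
    invariant under a single arrival. *)
Lemma stationary_mass y : \sum_i Ex (fun c => a i * (arrive c i == y)%:R) = mass y.
Proof.
have bq i : bounded_fn (fun c => a i * (arrive c i == y)%:R).
  by apply: bounded_M; [exact: bounded_cst|exact: bounded_nat_bool].
rewrite -(Ex_sum pi predT bq); apply/EFin_inj.
rewrite EFin_Ex; last exact: bounded_sum.
rewrite integral_mass; last first.
  by move=> c; apply: sumr_ge0 => i _; rewrite mulr_ge0.
have [ay|nay] := boolP (admissible e y); last first.
  rewrite mass_inadmissible//; apply: esum1 => c _.
  have [ac|nac] := boolP (admissible e c); last by rewrite mass_inadmissible// mulr0.
  rewrite big1 ?mul0r// => i _; case: eqP => [E|_]; last by rewrite mulr0.
  by move: nay; rewrite -E arrive_admissible.
have Dy : state_space e y by rewrite /state_space/= indep0_classes.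
have [_ /(_ y Dy)] := pi_stat.
have -> : (\esum_(x in state_space e `\ y) (trans_rate e a y x)%:E = 1)%E.
  transitivity (\esum_(x in state_space e `\ y)
      \sum_(i <- index_enum 'I_N | predT i) (a i * (arrive y i == x)%:R)%:E)%E.
    by apply: eq_esum => x _; rewrite trans_rateE sumEFin.
  rewrite esum_sum; last by move=> x i _ _; rewrite lee_fin mulr_ge0.
  transitivity (\sum_i (a i)%:E)%E; last by rewrite sumEFin a_sum1.
  apply: eq_bigr => i _.
  transitivity (\esum_(x in [set arrive y i]) (a i)%:E)%E; last by rewrite esum_set1// lee_fin.
  rewrite esum_mkcond [RHS]esum_mkcond; apply: eq_esum => x _.
  case: eqP => [<-|nx].
    rewrite mulr1 (mem_set (A := [set arrive y i]))// mem_set//; split.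
      by rewrite /state_space/= indep0_classes; exact: arrive_admissible.
    by apply/eqP; exact: arrive_neq.
  by rewrite mulr0 (memNset (A := [set arrive y i])) ?if_same// => /= E; exact: nx.
rewrite mule1 massE => <-.
rewrite [RHS]esum_mkcond; apply: eq_esum => c _.
case: ifPn => [_|nD]; first by rewrite -trans_rateE -massE -EFinM mulrC.
have [ac|nac] := boolP (admissible e c); last by rewrite mass_inadmissible// mulr0.
have -> : c = y.
  apply: contrapT => cy; move/negP: nD; apply; apply: mem_set; split => //.
  by rewrite /state_space/= indep0_classes.
by rewrite big1 ?mul0r// => i _; rewrite (negbTE (arrive_neq _ _ _)) mulr0.
Qed.

Theorem stationary_invariance (f : buffer N -> R) : bounded_fn f -> (forall c, 0 <= f c) ->
  \sum_i a i * Ex (fun c => f (arrive c i)) = Ex f.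
Proof.
move=> bf f0.
have -> : Ex f = \sum_(k : unit) Ex (fun c => 1 * f (id c)).
  by rewrite (big_pred1 tt) => [|[]//]; apply: eq_Ex => c; rewrite mul1r.
have -> : \sum_i a i * Ex (fun c => f (arrive c i)) =
    \sum_i Ex (fun c => a i * f (arrive c i)).
  apply: eq_bigr => i _; rewrite ExZ//.
  by exact: (bounded_comp (fun c => arrive c i) bf).
apply: (Ex_functional_eq (w1 := fun i c => a i) (h1 := fun i c => arrive c i)
  (w2 := fun=> cst 1) (h2 := fun=> id)) => //; try by move=> k; exact: bounded_cst.
move=> y; rewrite stationary_mass (big_pred1 tt) => [|[]//].
by rewrite (@Ex_eq_mass _ _ _ (fun=> 1))// mul1r.
Qed.

Section Comparison.
Variable kappa : R.
Hypothesis kappa_ge0 : 0 <= kappa.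

Notation weight := (weight e a).

(** The minimum of the stationary measure and of [kappa * weight], written as a
    density with respect to the former so that it can be integrated. *)
Let phi c : R := if admissible e c then
  if mass c <= kappa * weight c then 1 else kappa * weight c / mass c else 0.

Let w_ge0 c : 0 <= kappa * weight c.
Proof. by rewrite mulr_ge0// ltW//; exact: weight_gt0. Qed.

Let phi01 c : 0 <= phi c <= 1.
Proof.
rewrite /phi; case: ifP => _; last by rewrite lexx ler01.
case: ifPn => [_|]; first by rewrite ler01 lexx.
rewrite -ltNge => lt_m.
have m0 : 0 < mass c by exact: le_lt_trans lt_m.
apply/andP; split; first by rewrite divr_ge0// ltW.
by rewrite ler_pdivrMr// mul1r ltW.
Qed.

Let bphi : bounded_fn phi.
Proof. by exists 1 => c; rewrite ger0_norm; case/andP: (phi01 c). Qed.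

Let phi_mass c : admissible e c -> phi c * mass c = Num.min (mass c) (kappa * weight c).
Proof.
rewrite /phi => ->; case: leP => [le|lt]; first by rewrite mul1r.
by rewrite divfK// gt_eqF// (le_lt_trans _ lt).
Qed.

Let phi_mass_le c : phi c * mass c <= kappa * weight c.
Proof.
have [ac|nac] := boolP (admissible e c); first by rewrite phi_mass// ge_min lexx orbT.
by rewrite mass_inadmissible// mulr0.
Qed.

(** Both measures are invariant on the state space, hence their minimum is
    excessive. *)
Let excessive x : \sum_i Ex (fun c => (a i * phi c) * (arrive c i == x)%:R) <= phi x * mass x.
Proof.
have [ax|nax] := boolP (admissible e x); last first.
  rewrite /phi (negbTE nax) mul0r big1// => i _.
  rewrite (@eq_Ex _ _ pi _ (fun=> 0)) ?Ex_cst// => c.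
  case: eqP => [E|_]; last by rewrite mulr0.
  rewrite /phi; case: ifP => ac; last by rewrite mulr0 mul0r.
  by move: nax; rewrite -E arrive_admissible.
rewrite phi_mass// le_min; apply/andP; split.
  rewrite -[leRHS]stationary_mass; apply: ler_sum => i _; apply: le_Ex.
  - by do !apply: bounded_M => //; [exact: bounded_cst|exact: bounded_nat_bool].
  - by apply: bounded_M; [exact: bounded_cst|exact: bounded_nat_bool].
  - move=> c; apply: ler_wpM2r => //; rewrite ler_piMr//.
    by case/andP: (phi01 c).
rewrite -(weight_inflow no_isolated a_gt0 a_sum1 ax) mulr_sumr.
apply: ler_sum => i _; rewrite mulrCA.
pose W c y := phi c * (c == y)%:R.
have bW y : bounded_fn (W ^~ y) by apply: bounded_M => //; exact: bounded_nat_bool.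
have W0 c y : 0 <= W c y by rewrite mulr_ge0//; case/andP: (phi01 c).
have b1 : bounded_fn (fun c => phi c * (arrive c i == x)%:R).
  by apply: bounded_M => //; exact: bounded_nat_bool.
have b2 : bounded_fn (fun c => \sum_(p < (size x).+1)
    \sum_(k | [&& ~~ adj x k, e k i & ~~ adj (take p x) i]) W c (insert p k x)).
  by do 2 apply: bounded_sum => ?; exact: bW.
have b3 : bounded_fn (fun c => if x == rcons (take (size x).-1 x) i
    then W c (take (size x).-1 x) else 0).
  by case: (x == _); [exact: bW|exact: bounded_cst].
have -> : Ex (fun c => a i * phi c * (arrive c i == x)%:R) =
    a i * Ex (fun c => phi c * (arrive c i == x)%:R).
  by rewrite -ExZ//; apply: eq_Ex => c; rewrite mulrA.
apply: ler_wpM2l => //.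
apply: (@le_trans _ _ (Ex (fun c => inflow e (W c) x i))).
  apply: le_Ex => //; first exact: bounded_D.
  move=> c; rewrite /phi; case: ifPn => ac; last first.
    rewrite mul0r addr_ge0//; last by case: ifP.
    by apply: sumr_ge0 => p _; exact: sumr_ge0.
  have [cx|_] := eqVneq (arrive c i) x; last first.
    rewrite mulr0 addr_ge0//; last by case: ifP.
    by apply: sumr_ge0 => p _; exact: sumr_ge0.
  have := inflow_cover (W := W c) ac cx (W0 c).
  by rewrite /W eqxx /phi ac.
rewrite /inflow ExD// mulrDr lerD//.
  rewrite Ex_sum; last by move=> p; apply: bounded_sum => k; exact: bW.
  rewrite mulr_sumr; apply: ler_sum => p _; rewrite Ex_sum; last by move=> k; exact: bW.
  rewrite mulr_sumr; apply: ler_sum => k _.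
  by rewrite Ex_eq_mass// => c; case/andP: (phi01 c).
case: (x == _); last by rewrite Ex_cst mulr0.
by rewrite Ex_eq_mass// => c; case/andP: (phi01 c).
Qed.

(** Arrivals preserve the total mass, so a finite excessive measure is invariant. *)
Let invariant x : \sum_i Ex (fun c => (a i * phi c) * (arrive c i == x)%:R) = phi x * mass x.
Proof.
apply/le_anti; rewrite excessive/=.
have ba i : bounded_fn (fun c => a i * phi c) by apply: bounded_M => //; exact: bounded_cst.
have phi0 c : 0 <= phi c by case/andP: (phi01 c).
have bx : bounded_fn (fun c => (1 : R) - (c == x)%:R).
  exact: (bounded_B (bounded_cst 1) (bounded_nat_bool (fun c => c == x))).
have := @Ex_functional_le _ _ pi _ unit (fun i c => a i * phi c) (fun i c => arrive c i)
  (fun=> phi) (fun=> id) (fun c => 1 - (c == x)%:R) ba (fun=> bphi) bx.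
have -> : \sum_(k : unit) Ex (fun c => phi c * (1 - (c == x)%:R)) = Ex phi - phi x * mass x.
  rewrite (big_pred1 tt) => [|[]//].
  rewrite -Ex_eq_mass// -ExB; [|by bounded..].
  by apply: eq_Ex => c; rewrite mulrBr mulr1.
have -> : \sum_i Ex (fun c => a i * phi c * (1 - (arrive c i == x)%:R)) =
    Ex phi - \sum_i Ex (fun c => (a i * phi c) * (arrive c i == x)%:R).
  have {1}-> : Ex phi = \sum_i a i * Ex phi by rewrite -mulr_suml a_sum1 mul1r.
  rewrite -sumrB; apply: eq_bigr => i _.
  rewrite -ExZ// -ExB; [|by bounded..].
  by apply: eq_Ex => c; rewrite mulrBr mulr1.
move=> H; rewrite -lerN2 -(lerD2l (Ex phi)); apply: H.
- by move=> i c; rewrite mulr_ge0.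
- by [].
- by move=> c; case: eqP; rewrite subr_ge0.
- by move=> y; rewrite (big_pred1 tt) => [|[]//]; rewrite Ex_eq_mass.
Qed.

(** The excess of the stationary measure over the minimum is invariant too; if it
    vanishes at a state, it vanishes at the predecessors of this state. *)
Let no_excess_back c i : admissible e c ->
  mass (arrive c i) <= kappa * weight (arrive c i) -> mass c <= kappa * weight c.
Proof.
set x := arrive c i => ac mx.
have ax : admissible e x by exact: arrive_admissible.
have phix : phi x = 1 by rewrite /phi ax mx.
have inv := invariant x; rewrite phix mul1r -stationary_mass in inv.
have phi1 y : 0 <= 1 - phi y by rewrite subr_ge0; case/andP: (phi01 y).
have b1 j : bounded_fn (fun y => a j * (arrive y j == x)%:R).
  by apply: bounded_M; [exact: bounded_cst|exact: bounded_nat_bool].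
have b2 j : bounded_fn (fun y => a j * phi y * (arrive y j == x)%:R).
  by do !apply: bounded_M => //; [exact: bounded_cst|exact: bounded_nat_bool].
have zero : \sum_j Ex (fun y => a j * (arrive y j == x)%:R -
    a j * phi y * (arrive y j == x)%:R) = 0.
  by under eq_bigr do rewrite ExB//; rewrite sumrB inv subrr.
have t0 j y : 0 <= a j * (arrive y j == x)%:R - a j * phi y * (arrive y j == x)%:R.
  by rewrite -mulrBl mulr_ge0// -[X in X - _]mulr1 -mulrBr mulr_ge0.
have /psumr_eq0P : \sum_j Ex (fun y => a j * (arrive y j == x)%:R -
    a j * phi y * (arrive y j == x)%:R) = 0 by [].
move=> /(_ (fun j _ => Ex_ge0 pi (t0 j)) i isT) zi.
have : (a i * (1 - phi c)) * mass c <= 0.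
  have bw : bounded_fn (fun y => a i * (1 - phi y)).
    by apply: bounded_M; [exact: bounded_cst|exact: (bounded_B (bounded_cst 1) bphi)].
  rewrite -(@Ex_eq_mass _ _ pi (fun y => a i * (1 - phi y))); last first.
    by move=> y; rewrite mulr_ge0.
  rewrite -zi; apply: le_Ex.
  - by apply: bounded_M => //; exact: bounded_nat_bool.
  - exact: bounded_B.
  - move=> y; case: eqP => [->|_]; last by rewrite mulr0.
    by rewrite -/x eqxx !mulr1 mulrBr mulr1.
move=> le0; rewrite leNgt; apply/negP => lt.
have m0 : 0 < mass c by exact: le_lt_trans lt.
move: le0; rewrite leNgt => /negP; apply; rewrite !mulr_gt0// subr_gt0.
by rewrite /phi ac leNgt lt/= ltr_pdivrMr// mul1r.
Qed.

(** From the empty buffer, the items of [x] themselves lead to [x]. *)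
Lemma no_excess_empty x : admissible e x ->
  mass x <= kappa * weight x -> mass [::] <= kappa * weight [::].
Proof.
elim/last_ind: x => [//|x j IH]; rewrite (admissible_rcons e_sym e_irr) => /andP[ax xj].
rewrite -(fcfm_append xj) => mx; apply: IH => //; exact: no_excess_back mx.
Qed.

(** Newcomers that match the oldest item, again and again, empty the buffer. *)
Lemma empty_no_excess c : admissible e c ->
  mass [::] <= kappa * weight [::] -> mass c <= kappa * weight c.
Proof.
have [n] := ubnP (size c); elim: n c => // n IH [//|j c] /ltnSE sc ac m0.
have [m jm] := no_isolated j.
apply: (@no_excess_back _ m) => //; rewrite fcfm_hit//; apply: IH => //.
by apply: sub_admissible ac => i ic; rewrite inE ic orbT.
Qed.

End Comparison.

(** The comparison with [kappa = mass [::]] gives one inequality; a larger mass at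
    [c] is excluded by the comparison with [kappa = mass c / weight e a c]. This
    replaces the uniqueness of the stationary measure, for which the total weight
    would have to be known to be finite. *)
Theorem stationary_product_form c : admissible e c ->
  mass c = mass [::] * weight e a c.
Proof.
move=> ac; have w0 := weight_gt0 no_isolated a_gt0 c.
apply/le_anti; rewrite empty_no_excess ?mass_ge0//=; last by rewrite weight_nil mulr1.
rewrite leNgt; apply/negP => lt.
have k0 : 0 <= mass c / weight e a c by rewrite divr_ge0 ?mass_ge0// ltW.
have := no_excess_empty k0 ac; rewrite divfK ?gt_eqF// weight_nil mulr1 => /(_ (lexx _)).
by rewrite ler_pdivlMr// leNgt lt.
Qed.

(** Partial balance: the flow out of a state caused by matchings equals the
    flow into it caused by the arrival of its newest item. *)
Corollary partial_balance c j : admissible e (rcons c j) ->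
  mass (rcons c j) * match_rate e a (rcons c j) = mass c * a j.
Proof.
move=> acj; have ac : admissible e c.
  by move: acj; rewrite (admissible_rcons e_sym e_irr) => /andP[].
rewrite (stationary_product_form acj) (stationary_product_form ac).
by rewrite -!mulrA weight_rcons_rate.
Qed.

(** The partial balance equations, integrated against a test function. *)
Theorem newest_item_balance (f : buffer N -> R) : bounded_fn f -> (forall c, 0 <= f c) ->
  Ex (fun c => match_rate e a c * f c) =
  \sum_j a j * Ex (fun c => (~~ adj c j)%:R * f (rcons c j)).
Proof.
move=> bf f0.
have mr0 c : 0 <= match_rate e a c by exact: match_rate_ge0.
have bmr : bounded_fn (match_rate e a).
  exists 1 => c; rewrite ger0_norm//.
  by rewrite -a_sum1 [leRHS](bigID (fun m => adj c m))/= lerDl sumr_ge0.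
have -> : Ex (fun c => match_rate e a c * f c) =
    \sum_(k : unit) Ex (fun c => match_rate e a c * f (id c)).
  by rewrite (big_pred1 tt) => [|[]//].
have ba j : bounded_fn (fun c => a j * (~~ adj c j)%:R).
  by apply: bounded_M; [exact: bounded_cst|exact: bounded_nat_bool].
have -> : \sum_j a j * Ex (fun c => (~~ adj c j)%:R * f (rcons c j)) =
    \sum_j Ex (fun c => (a j * (~~ adj c j)%:R) * f (rcons c j)).
  apply: eq_bigr => j _; rewrite -ExZ.
    by apply: eq_Ex => c; rewrite mulrA.
  by apply: bounded_M; [exact: bounded_nat_bool|exact: (bounded_comp (fun c => rcons c j) bf)].
apply: (Ex_functional_eq (w1 := fun=> match_rate e a) (h1 := fun=> id)
  (w2 := fun j c => a j * (~~ adj c j)%:R) (h2 := fun j c => rcons c j)) => //.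
  by move=> k c; rewrite mulr_ge0.
move=> y; rewrite (big_pred1 tt) => [|[]//]; rewrite Ex_eq_mass//.
case/lastP: y => [|c j].
  rewrite /match_rate big1// mul0r big1// => j _.
  by rewrite (@eq_Ex _ _ pi _ (fun=> 0)) ?Ex_cst// => c; rewrite -size_eq0 size_rcons mulr0.
rewrite (bigD1 j)//= [X in _ + X]big1 ?addr0; last first.
  move=> k kj; rewrite (@eq_Ex _ _ pi _ (fun=> 0)) ?Ex_cst// => x.
  by rewrite eqseq_rcons (negbTE kj) andbF mulr0.
under eq_Ex do rewrite eqseq_rcons eqxx andbT.
rewrite (@Ex_eq_mass _ _ _ (fun x => a j * (~~ adj x j)%:R)); last first.
  by move=> x; rewrite mulr_ge0.
have [acj|nacj] := boolP (admissible e (rcons c j)).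
  rewrite mulrC partial_balance//.
  by move: acj; rewrite (admissible_rcons e_sym e_irr) => /andP[_ ->]; rewrite mulr1 mulrC.
rewrite (mass_inadmissible nacj) mulr0.
move: nacj; rewrite (admissible_rcons e_sym e_irr) negb_and negbK => /orP[nac|->].
  by rewrite (mass_inadmissible nac) mulr0.
by rewrite mulr0 mul0r.
Qed.

End StationaryDistribution.

(** * Recursions over the set of unmatched classes *)

Section SetRecursions.
Context {R : realType} {N : nat} (e : rel 'I_N) (a : 'I_N -> R).
Hypotheses (e_sym : symmetric e) (e_irr : irreflexive e).
Hypothesis no_isolated : forall i, exists j, e i j.
Hypothesis a_gt0 : forall i, 0 < a i.
Hypothesis a_sum1 : \sum_i a i = 1.
Context (pi : probability (buffer N) R).
Hypothesis pi_stat : stationary_distribution e a pi.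
Implicit Types (c : buffer N) (J : {set 'I_N}) (F : buffer N -> R) (i j : 'I_N).

Notation Ex := (Ex pi).

Definition part J F : R := Ex (fun c => F c * (classes c == J)%:R).
Definition prob_set J : R := part J (fun=> 1).
(** Spare matching rate when [J] is the set of unmatched classes; stability makes it
    positive. *)
Definition slack J : R := load a (nbrs e J) - load a J.

Let bpart J F : bounded_fn F -> bounded_fn (fun c => F c * (classes c == J)%:R).
Proof. by move=> bF; apply: bounded_M => //; exact: bounded_nat_bool. Qed.

Lemma prob_setE J : (prob_set J)%:E = pi (buffers_of J).
Proof.
rewrite /prob_set /part EFin_Ex; last by apply: bpart; exact: bounded_cst.
rewrite -[RHS]mul1e -[X in (_ * pi X)%E](setIT (buffers_of J)).
rewrite -integral_indic// mul1e; apply: eq_integral => c _.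
rewrite mul1r indicE; congr ((_ : bool)%:R%:E).
by apply/eqP/idP => [cJ|/set_mem//]; exact: mem_set.
Qed.

Lemma part_ge0 J F : (forall c, 0 <= F c) -> 0 <= part J F.
Proof. by move=> F0; apply: Ex_ge0 => c; rewrite mulr_ge0. Qed.

Lemma le_part J F G : bounded_fn F -> bounded_fn G -> (forall c, F c <= G c) ->
  part J F <= part J G.
Proof.
by move=> bF bG FG; apply: le_Ex => [||c]; [exact: bpart|exact: bpart|rewrite ler_wpM2r].
Qed.

Lemma part_D J F G : bounded_fn F -> bounded_fn G ->
  part J (fun c => F c + G c) = part J F + part J G.
Proof.
move=> bF bG; rewrite /part -ExD; [|exact: bpart..].
by apply: eq_Ex => c; rewrite mulrDl.
Qed.

Lemma part_Z J F (k : R) : bounded_fn F -> part J (fun c => k * F c) = k * part J F.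
Proof.
by move=> bF; rewrite /part -ExZ; [apply: eq_Ex => c; rewrite mulrA|exact: bpart].
Qed.

Lemma eq_part J F G : (forall c, F c = G c) -> part J F = part J G.
Proof. by move=> FG; apply: eq_Ex => c; rewrite FG. Qed.

Lemma Ex_inadmissible F : bounded_fn F -> (forall c, 0 <= F c) ->
  (forall c, admissible e c -> F c = 0) -> Ex F = 0.
Proof.
move=> bF F0 Fad; apply/EFin_inj; rewrite EFin_Ex// integral_mass//.
apply: esum1 => c _; have [ac|nac] := boolP (admissible e c).
  by rewrite Fad// mul0r.
by rewrite (mass_inadmissible pi_stat)// mulr0.
Qed.

Lemma part_dependent J F : bounded_fn F -> (forall c, 0 <= F c) ->
  ~~ indep0 e J -> part J F = 0.
Proof.
move=> bF F0 nJ; apply: Ex_inadmissible; first exact: bpart.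
  by move=> c; rewrite mulr_ge0.
move=> c; rewrite -indep0_classes; case: eqP => [->|_ _]; last by rewrite mulr0.
by rewrite (negbTE nJ).
Qed.

Lemma sum_part F : bounded_fn F -> \sum_J part J F = Ex F.
Proof.
move=> bF; rewrite -Ex_sum; last by move=> J; exact: bpart.
apply: eq_Ex => c; rewrite (bigD1 (classes c))//= eqxx mulr1.
by rewrite big1 ?addr0// => J /negbTE cJ; rewrite eq_sym cJ mulr0.
Qed.

Lemma match_rateE c : match_rate e a c = load a (nbrs e (classes c)).
Proof. by rewrite /match_rate /load; apply: eq_bigl => m; rewrite mem_nbrs_classes. Qed.

(** Grouping the partial balance equations by the set of unmatched classes:
    when the newest item has class [j], the older ones have classes [J] or
    [J :\ j]. *)
Lemma set_recursion J F : indep0 e J -> bounded_fn F -> (forall c, 0 <= F c) ->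
  load a (nbrs e J) * part J F =
  \sum_(j in J) a j * (part J (fun c => F (rcons c j)) + part (J :\ j)%SET (fun c => F (rcons c j))).
Proof.
move=> iJ bF F0.
rewrite /part -ExZ; last exact: bpart.
rewrite (@eq_Ex _ _ pi _ (fun c => match_rate e a c * (F c * (classes c == J)%:R))); last first.
  by move=> c; rewrite match_rateE; case: eqP => [->//|_]; rewrite !mulr0.
rewrite (newest_item_balance e_sym e_irr no_isolated a_gt0 a_sum1 pi_stat); last 2 first.
- exact: bpart.
- by move=> c; rewrite mulr_ge0.
rewrite [RHS]big_mkcond; apply: eq_bigr => j _.
have bFj : bounded_fn (fun c => F (rcons c j)).
  exact: (bounded_comp (fun c => rcons c j) bF).
rewrite -ExD; [|exact: bpart..].
case: ifPn => jJ; last first.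
  rewrite (@eq_Ex _ _ pi _ (fun=> 0)) ?Ex_cst ?mulr0// => c.
  case: eqP => [E|_]; last by rewrite !mulr0.
  by move: jJ; rewrite -E mem_classes mem_rcons inE eqxx.
congr (_ * _); apply: eq_Ex => c; rewrite -mulrDr mulrCA; congr (_ * _).
rewrite classes_rcons -natrM -natrD; congr (_%:R).
have adjJ : classes c \subset J -> ~~ compatible e id c j.
  move=> cJ; rewrite -mem_nbrs_classes mem_nbrs negb_exists; apply/forallP => i.
  rewrite negb_and; have [ic|//] := boolP (i \in classes c).
  by have /indep0P H := iJ; rewrite H//; exact: (fintype.subsetP cJ _ ic).
have [cJ|cnJ] := eqVneq (classes c) J.
  rewrite adjJ ?cJ// (finset.setUidPr _) ?finset.sub1set// eqxx.
  suff /negbTE -> : J != (J :\ j)%SET by [].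
  by apply/eqP => E; move: jJ; rewrite E finset.setD11.
have [cJj|cnJj] := eqVneq (classes c) (J :\ j)%SET.
  by rewrite adjJ ?cJj ?finset.subD1set// finset.setD1K// eqxx.
case: eqP => [E|_]; last by rewrite muln0.
have [jc|jc] := boolP (j \in classes c).
  by move: cnJ; rewrite -E (finset.setUidPr _) ?finset.sub1set// eqxx.
by move: cnJj; rewrite -E finset.setU1K// eqxx.
Qed.

Lemma prob_set_recursion J : indep0 e J ->
  slack J * prob_set J = \sum_(j in J) a j * prob_set (J :\ j)%SET.
Proof.
move=> iJ; have := @set_recursion J (fun=> 1) iJ (bounded_cst 1) (fun=> ler01).
rewrite -/(prob_set _) /slack mulrBl => ->.
under eq_bigr do rewrite mulrDr.
by rewrite big_split/= -/(prob_set J) -mulr_suml -/(load a J) addrAC subrr add0r.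
Qed.

Lemma prob_set_ge0 J : 0 <= prob_set J.
Proof. exact: part_ge0. Qed.

Lemma sum_prob_set : \sum_J prob_set J = 1.
Proof. by rewrite (sum_part (bounded_cst 1)) Ex_cst. Qed.

Lemma prob_set_le1 J : prob_set J <= 1.
Proof.
rewrite -sum_prob_set (bigD1 J)//= lerDl sumr_ge0// => K _; exact: prob_set_ge0.
Qed.

Lemma prob_set_dependent J : ~~ indep0 e J -> prob_set J = 0.
Proof. by apply: part_dependent => //; exact: bounded_cst. Qed.

Definition power_weight (z : 'I_N -> R) c : R := \prod_(x <- c) z x.

Section GeneratingFunction.
Variable z : 'I_N -> R.
Hypothesis z01 : forall i, 0 <= z i <= 1.

Lemma power_weight01 c : 0 <= power_weight z c <= 1.
Proof.
rewrite /power_weight; elim: c => [|j c /andP[w0 w1]]; first by rewrite big_nil ler01 lexx.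
rewrite big_cons; have /andP[z0 z1] := z01 j.
by rewrite mulr_ge0//= mulr_ile1.
Qed.

Lemma bounded_power_weight : bounded_fn (power_weight z).
Proof. by exists 1 => c; have /andP[w0 w1] := power_weight01 c; rewrite ger0_norm. Qed.

Definition gen_fun J : R := part J (power_weight z).

Lemma gen_fun_ge0 J : 0 <= gen_fun J.
Proof. by apply: part_ge0 => c; case/andP: (power_weight01 c). Qed.

Lemma gen_fun_le J : gen_fun J <= prob_set J.
Proof.
apply: le_part; [exact: bounded_power_weight|exact: bounded_cst|].
by move=> c; case/andP: (power_weight01 c).
Qed.

Lemma sum_gen_fun : \sum_J gen_fun J = Ex (power_weight z).
Proof. by rewrite (sum_part bounded_power_weight). Qed.

Lemma gen_fun0 : gen_fun finset.set0 = prob_set finset.set0.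
Proof.
apply: eq_Ex => c; case: eqP => [c0|_]; last by rewrite !mulr0.
suff -> : c = [::] by rewrite /power_weight big_nil.
case: c c0 => // j c /setP/(_ j); rewrite mem_classes inE eqxx finset.inE//.
Qed.

Lemma gen_fun_recursion J : indep0 e J ->
  (load a (nbrs e J) - \sum_(j in J) a j * z j) * gen_fun J =
  \sum_(j in J) a j * z j * gen_fun (J :\ j)%SET.
Proof.
move=> iJ; have bw := bounded_power_weight.
have w0 c : 0 <= power_weight z c by case/andP: (power_weight01 c).
rewrite mulrBl (set_recursion iJ bw w0).
have E K j : part K (fun c => power_weight z (rcons c j)) = z j * gen_fun K.
  rewrite /gen_fun -part_Z//; apply: eq_part => c.
  by rewrite /power_weight -cats1 big_cat big_seq1 mulrC.
under eq_bigr do rewrite !E mulrDr.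
by rewrite big_split/= mulr_suml; under eq_bigr do rewrite mulrA;
  rewrite addrAC subrr add0r; apply: eq_bigr => j _; rewrite mulrA.
Qed.

(** The loss [prob_set J - gen_fun J] obeys the recursion of the probabilities, up
    to a source of the order of [1 - z]. *)
Lemma gen_fun_defect J : indep0 e J ->
  slack J * (prob_set J - gen_fun J) <=
  \sum_(j in J) a j * (prob_set (J :\ j)%SET - gen_fun (J :\ j)%SET) +
  \sum_(j in J) a j * (1 - z j) * (prob_set J + prob_set (J :\ j)%SET).
Proof.
move=> iJ; have R1 := prob_set_recursion iJ; have R2 := gen_fun_recursion iJ.
have S : slack J * gen_fun J = \sum_(j in J) a j * z j * gen_fun (J :\ j)%SET
    - \sum_(j in J) a j * (1 - z j) * gen_fun J.
  rewrite -R2 /slack -mulr_suml -mulrBl; congr (_ * _).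
  under [X in _ = _ - X]eq_bigr do rewrite mulrBr mulr1.
  by rewrite sumrB /load; ring.
rewrite mulrBr R1 S opprB addrCA -!big_split/= -sumrB -big_split/=.
apply: ler_sum => j jJ; have /andP[z0 z1] := z01 j.
have h1 := gen_fun_le J; have h2 := gen_fun_le (J :\ j)%SET.
have az : 0 <= a j * (1 - z j) by rewrite mulr_ge0 ?subr_ge0// ltW.
have := ler_wpM2l az h1; have := ler_wpM2l az h2; clear h1 h2 S R1 R2.
move: (gen_fun J) (prob_set J) (gen_fun (J :\ j)%SET) (prob_set (J :\ j)%SET).
by move: (a j) (z j) => u v g p g' p'; lra.
Qed.

End GeneratingFunction.

Section Means.
Variable i : 'I_N.
Hypothesis stable : stability_condition e a.

(** Truncation makes the counts bounded, as the recursion requires; the means are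
    then limits of truncated means. *)
Definition trunc_count n c : R := (minn (count_mem i c) n)%:R.
Definition trunc_mean n J : R := part J (trunc_count n).

Lemma bounded_trunc_count n : bounded_fn (trunc_count n).
Proof. by exists n%:R => c; rewrite ger0_norm ?ler0n// ler_nat geq_minr. Qed.

Lemma trunc_mean_ge0 n J : 0 <= trunc_mean n J.
Proof. by apply: part_ge0 => c; exact: ler0n. Qed.

Lemma trunc_mean_notin n J : i \notin J -> trunc_mean n J = 0.
Proof.
move=> iJ; rewrite /trunc_mean /part (@eq_Ex _ _ pi _ (fun=> 0)) ?Ex_cst// => c.
case: eqP => [cJ|_]; last by rewrite mulr0.
rewrite /trunc_count (_ : count_mem i c = 0)%N ?min0n ?mul0r//.
by apply/count_memPn; rewrite -mem_classes cJ.
Qed.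

Lemma trunc_mean_nd J : nondecreasing_seq (trunc_mean ^~ J).
Proof.
move=> m n mn; apply: le_part; [exact: bounded_trunc_count..|] => c.
by rewrite ler_nat leq_min geq_minl/= (leq_trans (geq_minr _ _)).
Qed.

(** One more item of class [i] turns the truncation at level [n.+1] into a
    truncation at level [n]. *)
Lemma trunc_mean_recursion n J : indep0 e J ->
  load a (nbrs e J) * trunc_mean n.+1 J = \sum_(j in J) a j *
    (if j == i then (trunc_mean n J + prob_set J) +
                    (trunc_mean n (J :\ j)%SET + prob_set (J :\ j)%SET)
     else trunc_mean n.+1 J + trunc_mean n.+1 (J :\ j)%SET).
Proof.
move=> iJ; rewrite /trunc_mean (set_recursion iJ (bounded_trunc_count _)); last first.
  by move=> c; exact: ler0n.
apply: eq_bigr => j _; congr (_ * _).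
case: eqP => [->|ji].
  have E K : part K (fun c => trunc_count n.+1 (rcons c i)) = part K (trunc_count n) + prob_set K.
    rewrite /prob_set -part_D; [|exact: bounded_trunc_count|exact: bounded_cst].
    apply: eq_part => c; rewrite /trunc_count -cats1 count_cat/= eqxx addn0 addn1 minnSS.
    by rewrite -natr1.
  by rewrite !E.
by congr (_ + _); apply: eq_part => c;
  rewrite /trunc_count -cats1 count_cat/= (introF eqP ji) !addn0.
Qed.

(** The recursion bounds [slack J * trunc_mean n J] by quantities for the smaller
    sets [J :\ j], uniformly in [n]. *)
Lemma trunc_mean_bound J : indep0 e J -> exists B : R, forall n, trunc_mean n J <= B.
Proof.
have [k] := ubnP #|J|; elim: k J => // k IH J Jk iJ.
have [J0|J_neq0] := eqVneq J finset.set0.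
  by exists 0 => n; rewrite trunc_mean_notin// J0 finset.inE.
have bJ j : exists B : R, j \in J -> forall n, trunc_mean n (J :\ j)%SET <= B.
  have [jJ|_] := boolP (j \in J); last by exists 0.
  have [||B hB] := IH (J :\ j)%SET; [|by apply/indep0P => x y /finset.setD1P[_ xJ] /finset.setD1P[_ yJ];
    have /indep0P := iJ; apply|by exists B].
  by move: Jk; rewrite (cardsD1 j) jJ add1n ltnS.
have [B hB] := choice bJ.
have sl : 0 < slack J.
  rewrite subr_gt0; apply: stable; move: iJ; rewrite /indep0 (negbTE J_neq0)//.
pose T := \sum_(j in J) a j * (B j + 2).
exists (T / slack J) => n; rewrite ler_pdivlMr//.
have h : load a (nbrs e J) * trunc_mean n.+1 J <= load a J * trunc_mean n.+1 J + T.
  rewrite trunc_mean_recursion// /load mulr_suml -big_split/=.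
  apply: ler_sum => j jJ; rewrite -mulrDr ler_pM2l//.
  have q1 := trunc_mean_nd J (leqnSn n).
  have q2 := trunc_mean_nd (J :\ j)%SET (leqnSn n).
  have q3 := hB j jJ n; have q4 := hB j jJ n.+1.
  have q5 := prob_set_le1 J; have q6 := prob_set_le1 (J :\ j)%SET.
  move: (trunc_mean n J) (trunc_mean n.+1 J) (trunc_mean n (J :\ j)%SET)
    (trunc_mean n.+1 (J :\ j)%SET) (prob_set J) (prob_set (J :\ j)%SET) (B j)
    q1 q2 q3 q4 q5 q6 => m m1 m' m1' p p' b ? ? ? ? ? ?.
  by case: ifP => _; lra.
have q1 := trunc_mean_nd J (leqnSn n).
apply: (@le_trans _ _ (trunc_mean n.+1 J * slack J)).
  by rewrite ler_wpM2r// ltW.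
by rewrite mulrC /slack mulrBl lerBlDl.
Qed.

Definition mean_part J : R := limn (trunc_mean ^~ J).

Lemma cvg_trunc_mean J : trunc_mean n J @[n --> \oo] --> mean_part J.
Proof.
have [B hB] : exists B : R, forall n, trunc_mean n J <= B.
  have [iJ|nJ] := boolP (indep0 e J); first exact: trunc_mean_bound.
  by exists 0 => n; rewrite /trunc_mean part_dependent//; exact: bounded_trunc_count.
apply: nondecreasing_is_cvgn; first exact: trunc_mean_nd.
by exists B => _ [n _ <-].
Qed.

Lemma mean_part_ge0 J : 0 <= mean_part J.
Proof.
apply: limr_ge; first exact: (cvgP _ (@cvg_trunc_mean J)).
by apply: nearW => n; exact: trunc_mean_ge0.
Qed.

Lemma mean_part_recursion J : indep0 e J ->
  slack J * mean_part J = \sum_(j in J) a j * mean_part (J :\ j)%SET +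
    (if i \in J then a i * (prob_set J + prob_set (J :\ i)%SET) else 0).
Proof.
move=> iJ.
have c0 K := cvg_trunc_mean K.
have c1 K : trunc_mean n.+1 K @[n --> \oo] --> mean_part K.
  by rewrite (cvg_shiftS (fun n => trunc_mean n K)); exact: c0.
have lhs : load a (nbrs e J) * trunc_mean n.+1 J @[n --> \oo] --> load a (nbrs e J) * mean_part J.
  by apply: cvgM; [exact: cvg_cst|exact: c1].
have rhs : (\sum_(j in J) a j *
    (if j == i then (trunc_mean n J + prob_set J) +
                    (trunc_mean n (J :\ j)%SET + prob_set (J :\ j)%SET)
     else trunc_mean n.+1 J + trunc_mean n.+1 (J :\ j)%SET)) @[n --> \oo] -->
  \sum_(j in J) a j * (if j == i then (mean_part J + prob_set J) +
                    (mean_part (J :\ j)%SET + prob_set (J :\ j)%SET)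
     else mean_part J + mean_part (J :\ j)%SET).
  apply: cvg_sumr => j _; apply: cvgM; first exact: cvg_cst.
  case: (j == i); last by apply: cvgD; exact: c1.
  by apply: cvgD; (apply: cvgD; [exact: c0|exact: cvg_cst]).
have E : load a (nbrs e J) * mean_part J = \sum_(j in J) a j *
    (if j == i then (mean_part J + prob_set J) +
                    (mean_part (J :\ j)%SET + prob_set (J :\ j)%SET)
     else mean_part J + mean_part (J :\ j)%SET).
  apply: (cvg_unique _ lhs); first exact: norm_hausdorff.
  by rewrite (funext (fun n => trunc_mean_recursion n iJ)); exact: rhs.
rewrite /slack mulrBl E.
have -> : \sum_(j in J) a j * (if j == i then (mean_part J + prob_set J) +
                    (mean_part (J :\ j)%SET + prob_set (J :\ j)%SET)
     else mean_part J + mean_part (J :\ j)%SET) =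
   load a J * mean_part J + (\sum_(j in J) a j * mean_part (J :\ j)%SET +
   \sum_(j in J) (if j == i then a j * (prob_set J + prob_set (J :\ j)%SET) else 0)).
  transitivity (\sum_(j in J) (a j * mean_part J + (a j * mean_part (J :\ j)%SET +
      (if j == i then a j * (prob_set J + prob_set (J :\ j)%SET) else 0)))).
    apply: eq_bigr => j _.
    move: (mean_part J) (mean_part (J :\ j)%SET) (prob_set J) (prob_set (J :\ j)%SET).
    by move=> m m' p p'; case: ifP => _; ring.
  rewrite big_split/= /load mulr_suml; congr (_ + _); exact: big_split.
rewrite addrAC subrr add0r; congr (_ + _).
rewrite -big_mkcondr; case: ifPn => iiJ.
  rewrite (big_pred1 i)// => j.
  by rewrite /=; have [->|_] := eqVneq j i; rewrite ?iiJ ?andbF.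
rewrite big_pred0// => j.
by have [->|_] := eqVneq j i; rewrite ?(negbTE iiJ) ?andbF.
Qed.

Lemma mean_part_notin J : i \notin J -> mean_part J = 0.
Proof.
move=> iJ; rewrite /mean_part (_ : trunc_mean ^~ J = cst 0) ?lim_cst//.
by apply/funext => n; exact: trunc_mean_notin.
Qed.

Lemma mean_unmatchedE : mean_unmatched pi i = (\sum_(J | indep0 e J) mean_part J)%:E.
Proof.
rewrite /mean_unmatched unlock.
pose g n c : \bar R := (trunc_count n c)%:E.
have -> : (\int[pi]_c (unmatched R i c)%:E = \int[pi]_c limn (g ^~ c))%E.
  apply: eq_integral => c _; apply/esym/cvg_lim => //; rewrite /g.
  apply: cvg_EFin; first exact: nearW.
  apply: cvg_near_cst.
  exists (count_mem i c) => // n /= cn.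
  by rewrite /trunc_count (minn_idPl _).
rewrite monotone_convergence//; last 2 first.
- by move=> n c _; rewrite lee_fin ler0n.
- by move=> c _ m n mn; rewrite lee_fin ler_nat leq_min geq_minl/= (leq_trans (geq_minr _ _)).
apply/cvg_lim => //.
have -> : (fun n => \int[pi]_c g n c)%E = (fun n => (\sum_(J | indep0 e J) trunc_mean n J)%:E).
  apply/funext => n; rewrite -EFin_Ex; last exact: bounded_trunc_count.
  rewrite -(sum_part (bounded_trunc_count n)); congr EFin.
  rewrite [RHS]big_mkcond; apply: eq_bigr => J _; case: ifPn => // nJ.
  by rewrite part_dependent//; exact: bounded_trunc_count.
apply: cvg_EFin; first exact: nearW.
by apply: cvg_sumr => J _; exact: cvg_trunc_mean.
Qed.

End Means.

End SetRecursions.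

(** * Limits along a filter *)

Section CvgTools.
Context {R : realType} {T : Type} (F : set_system T) {FF : Filter F}.
Implicit Types f g : T -> R.

Lemma cvg_eq_near (f g : T -> R) (l : R) :
  (\forall r \near F, f r = g r) -> g r @[r --> F] --> l -> f r @[r --> F] --> l.
Proof.
move=> fg; apply: cvg_trans; apply: near_eq_cvg; apply: filterS fg => r ->//.
Qed.

Lemma cvg_eqe_near (f g : T -> \bar R) (l : \bar R) :
  (\forall r \near F, f r = g r) -> g r @[r --> F] --> l -> f r @[r --> F] --> l.
Proof.
move=> fg; apply: cvg_trans; apply: near_eq_cvg; apply: filterS fg => r ->//.
Qed.

Lemma cvg_EFin_real (f : T -> R) (l : R) :
  f r @[r --> F] --> l -> (f r)%:E @[r --> F] --> l%:E.
Proof. by move=> fl; apply: cvg_EFin; first exact: nearW. Qed.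

Lemma cvg0_le (f g : T -> R) :
  (\forall r \near F, 0 <= f r <= g r) -> g r @[r --> F] --> (0 : R) ->
  f r @[r --> F] --> (0 : R).
Proof. by move=> fg g0; apply: (@squeeze_cvgr _ _ _ _ (cst 0) g) => //; exact: cvg_cst. Qed.

Lemma cvg_sumr0 (I : Type) (s : seq I) (Q : pred I) (f : I -> T -> R) :
  (forall i, Q i -> f i t @[t --> F] --> (0 : R)) ->
  (\sum_(i <- s | Q i) f i t) @[t --> F] --> (0 : R).
Proof. by move=> f0; have := @cvg_sumr _ _ _ F FF s Q f (fun=> 0) f0; rewrite big1. Qed.

End CvgTools.

(** * The fate of a tagged item *)

Section TaggedItem.
Context {N : nat} (e : rel 'I_N) (i : 'I_N).
Implicit Types (c : buffer N) (w : seq 'I_N) (u v s : seq ('I_N * bool)).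

Notation adj := (compatible e id).
Notation tag := (i, true).

(** Only the items ahead of the tagged item, of classes [c], matter for its
    fate: a newcomer serves the oldest compatible one of them, or the tagged
    item itself, or else acts behind the tagged item. *)
Fixpoint survives c w : bool :=
  if w is m :: w' then
    if adj c m then survives (fcfm e id c m) w'
    else ~~ e i m && survives c w'
  else true.

Definition present c w : bool := ~~ adj c i && survives c w.

Lemma present_cons c j w : present c (j :: w) =
  ~~ adj c i && (if adj c j then present (fcfm e id c j) w else ~~ e i j && present c w).
Proof.
rewrite /present; have [//|ci] /= := boolP (adj c i).
have [cj|//] := boolP (adj c j); suff -> : adj (fcfm e id c j) i = false by [].
apply: contraNF ci => /adjP[k kc ki]; apply/adjP; exists k => //.
exact: arrive_hit_sub kc.
Qed.

Let step s m := fcfm e fst s (m, false).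

Lemma compatible_fst s m : compatible e fst s (m, false) = adj (map fst s) m.
Proof. by rewrite /compatible has_map. Qed.

Lemma step_untagged s m : tag \notin s -> tag \notin step s m.
Proof.
move=> ts; rewrite /step; have [cm|cm] := boolP (compatible e fst s (m, false)).
  apply: contra ts => tf.
  by have := @mem_fcfm_hit _ e _ fst _ id s (m, false) tag cm; rewrite !map_id; apply.
by rewrite fcfm_append// mem_rcons inE negb_or ts andbT; apply/eqP => -[].
Qed.

Lemma foldl_untagged s w : tag \notin s -> tag \notin foldl step s w.
Proof. by elim: w s => //= m w IH s ts; apply: IH; exact: step_untagged. Qed.

(** The items [v] behind the tagged one never influence its fate. *)
Lemma foldl_tagged u v w : tag \notin u -> tag \notin v ->
  (tag \in foldl step (u ++ tag :: v) w) = survives (map fst u) w.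
Proof.
elim: w u v => [|m w IH] u v tu tv /=; first by rewrite mem_cat inE eqxx orbT.
rewrite -compatible_fst; have [cm|cm] := boolP (compatible e fst u (m, false)).
  have -> : step (u ++ tag :: v) m = step u m ++ tag :: v by rewrite /step fcfm_catl.
  rewrite IH//; last exact: step_untagged.
  by rewrite (@fcfm_map N e _ _ id fst u (m, false)).
have [im|im] /= := boolP (e i m).
  have -> : step (u ++ tag :: v) m = u ++ v.
    by rewrite /step fcfm_catr ?fcfm_hit// /compatible/= im.
  by apply/negbTE/foldl_untagged; rewrite mem_cat negb_or tu.
have -> : step (u ++ tag :: v) m = u ++ tag :: step v m.
  rewrite /step; have [vm|vm] := boolP (compatible e fst v (m, false)).
    rewrite fcfm_catr//; last by rewrite /compatible/= in vm *; rewrite vm orbT.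
    congr (_ ++ _); rewrite -[tag :: v]/([:: tag] ++ v) fcfm_catr//.
    by rewrite /compatible/= (negbTE im).
  rewrite !fcfm_append//; first by rewrite -!cats1 -catA.
  by rewrite compatible_cat negb_or cm/= negb_or im.
by rewrite IH//; exact: step_untagged.
Qed.

Lemma tagged_bufferE c (k : nat -> 'I_N) n :
  tagged_buffer e i c k n =
  foldl step (fcfm e fst [seq (j, false) | j <- c] tag) (mkseq k n).
Proof.
by elim: n => [//|n IH]; rewrite mkseqS foldl_rcons -IH.
Qed.

Lemma tagged_present c (k : nat -> 'I_N) n :
  (tag \in tagged_buffer e i c k n) = present c (mkseq k n).
Proof.
rewrite tagged_bufferE /present; set s := [seq _ | _ <- c].
have ts : tag \notin s by apply/mapP => -[j _ []].
have fsts : map fst s = c by rewrite -map_comp map_id.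
have cE : compatible e fst s tag = adj c i by rewrite -[in RHS]fsts /compatible has_map.
have [ci|ci] /= := boolP (adj c i).
  apply/negbTE/foldl_untagged; apply: contra ts => tf.
  by have := @mem_fcfm_hit _ e _ fst _ id s tag tag; rewrite cE !map_id; apply.
by rewrite fcfm_append ?cE// -cats1 foldl_tagged// fsts.
Qed.

Lemma present_decr c (k : nat -> 'I_N) m n : (m <= n)%N ->
  present c (mkseq k n) -> present c (mkseq k m).
Proof.
move=> mn; rewrite -!tagged_present; apply: contraLR.
rewrite !tagged_bufferE -(subnKC mn) /mkseq iotaD map_cat foldl_cat.
exact: foldl_untagged.
Qed.

(** The tagged item can only leave at an arrival epoch, so it is late at time [t] if
    it survives the [n] arrivals up to [t]. *)
Lemma matching_time_gt {R : realType} c (S : nat -> R) (k : nat -> 'I_N) (t : R) n :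
  0 <= t -> (forall l, S l < S l.+1) -> (forall l, (S l <= t) = (l < n)%N) ->
  (t%:E < matching_time e i c S k)%E = present c (mkseq k n).
Proof.
move=> t0 Sincr Sn; rewrite -tagged_present; apply/idP/idP.
  apply: contraLR => gone; rewrite -leNgt.
  apply: (@le_trans _ _ ((if n is m.+1 then S m else 0)%:E)).
    by apply: ereal_inf_lbound; exists n.
  rewrite lee_fin; case: n Sn {gone} => // m Sn; by rewrite Sn.
rewrite tagged_present => pr.
have tS : t < S n by rewrite ltNge Sn ltnn.
apply: (@lt_le_trans _ _ (S n)%:E); first by rewrite lte_fin.
apply: le_ereal_inf_tmp => _ [l /= gone <-].
have nl : (n < l)%N.
  rewrite ltnNge; apply: contra gone => ln; rewrite tagged_present.
  exact: present_decr pr.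
case: l nl {gone} => // l nl; rewrite lee_fin.
have mono : {homo S : x y / (x <= y)%N >-> x <= y}.
  by apply: homo_leq => [x|y x z|l']; [exact: lexx|exact: le_trans|exact: ltW].
exact: mono.
Qed.

Lemma matching_time_ge0 {R : realType} c (S : nat -> R) (k : nat -> 'I_N) :
  (forall l, 0 < S l) -> (0 <= matching_time e i c S k)%E.
Proof.
move=> S0; apply: le_ereal_inf_tmp => _ [l _ <-]; rewrite lee_fin.
by case: l => // l; exact: ltW.
Qed.

End TaggedItem.

(** * Random words and time slots *)

Section WordSums.
Context {R : realType} {N : nat} (a : 'I_N -> R).
Hypothesis a_ge0 : forall j, 0 <= a j.
Hypothesis a_sum1 : \sum_j a j = 1.
Implicit Types (f : seq 'I_N -> R).

(** Expectation of [f] over a word of [n] independent letters of law [a]. *)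
Fixpoint word_mean n f : R :=
  if n is m.+1 then \sum_j a j * word_mean m (fun w => f (j :: w)) else f [::].

Lemma eq_word_mean n f g : (forall w, f w = g w) -> word_mean n f = word_mean n g.
Proof. by move=> fg; congr word_mean; apply/funext. Qed.

Lemma word_mean_cst n (k : R) : word_mean n (fun=> k) = k.
Proof.
elim: n => //= n IH; under eq_bigr do rewrite IH.
by rewrite -mulr_suml a_sum1 mul1r.
Qed.

Lemma word_meanB n f g : word_mean n (fun w => f w - g w) = word_mean n f - word_mean n g.
Proof.
elim: n f g => //= n IH f g; rewrite -sumrB; apply: eq_bigr => j _.
by rewrite IH mulrBr.
Qed.

Lemma word_meanZ n (k : R) f : word_mean n (fun w => k * f w) = k * word_mean n f.
Proof.
elim: n f => //= n IH f; rewrite mulr_sumr; apply: eq_bigr => j _.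
by rewrite IH mulrCA.
Qed.

Lemma word_mean_ge0 n f : (forall w, 0 <= f w) -> 0 <= word_mean n f.
Proof.
elim: n f => //= n IH f f0; apply: sumr_ge0 => j _.
by rewrite mulr_ge0//; exact: IH.
Qed.

Lemma word_mean_le1 n f : (forall w, f w <= 1) -> word_mean n f <= 1.
Proof.
move=> f1; rewrite -subr_ge0 -{1}(word_mean_cst n 1) -word_meanB.
by apply: word_mean_ge0 => w; rewrite subr_ge0.
Qed.

(** Each of [m] time slots of length [h] is empty or contains one arrival. *)
Fixpoint slot_mean (h : R) m f : R :=
  if m is m'.+1 then
    slot_mean h m' f + h * \sum_j a j * slot_mean h m' (fun w => f (j :: w))
  else f [::].

Lemma eq_slot_mean h m f g : (forall w, f w = g w) -> slot_mean h m f = slot_mean h m g.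
Proof. by move=> fg; congr slot_mean; apply/funext. Qed.

(** Only the number [n] of occupied slots matters, and there are ['C(m, n)] ways to
    choose them. *)
Lemma slot_meanE h m f :
  slot_mean h m f = \sum_(n < m.+1) ('C(m, n))%:R * h ^+ n * word_mean n f.
Proof.
elim: m f => [|m IH] f; first by rewrite big_ord1 /= expr0 !mul1r.
rewrite /= IH; under eq_bigr do rewrite IH.
have -> : h * \sum_j a j * (\sum_(n < m.+1) ('C(m, n))%:R * h ^+ n *
    word_mean n (fun w => f (j :: w))) =
    \sum_(n < m.+1) ('C(m, n))%:R * h ^+ n.+1 * word_mean n.+1 f.
  under eq_bigr do rewrite mulr_sumr.
  rewrite exchange_big/= mulr_sumr; apply: eq_bigr => n _.
  rewrite !mulr_sumr; apply: eq_bigr => j _; rewrite exprS.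
  by move: (word_mean _ _) => x; ring.
rewrite [RHS]big_ord_recl [in LHS]big_ord_recl !bin0 -addrA; congr (_ + _).
under [in RHS]eq_bigr => n _ do rewrite /bump/= binS natrD !mulrDl.
rewrite big_split/= [in RHS]big_ord_recr/= bin_small// !mul0r addr0.
by [].
Qed.

Lemma cvg_binomial_pow n (t : R) :
  ('C(m, n))%:R * (t / m%:R) ^+ n @[m --> \oo] --> t ^+ n / n`!%:R.
Proof.
have ratio : (m ^_ n)%:R / m%:R ^+ n @[m --> \oo] --> (1 : R).
  elim: n => [|n IH].
    under eq_fun do rewrite ffactn0 expr0 divr1; exact: cvg_cst.
  have step : 1 - n%:R / m%:R @[m --> \oo] --> (1 : R).
    rewrite [X in _ --> X](_ : (1 : R) = 1 - n%:R * 0); last by rewrite mulr0 subr0.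
    apply: cvgB; first exact: cvg_cst.
    apply: cvgM; first exact: cvg_cst.
    by rewrite -cvg_shiftS; exact: cvg_harmonic.
  rewrite [X in _ --> X](_ : (1 : R) = 1 * 1); last by rewrite mulr1.
  apply: (cvg_eq_near (g := fun m => ((m ^_ n)%:R / m%:R ^+ n) * (1 - n%:R / m%:R)));
    last exact: cvgM.
  exists n.+1 => // m /= nm.
  have m0 : m%:R != 0 :> R by rewrite pnatr_eq0 -lt0n (leq_trans _ nm).
  rewrite ffactnSr natrM natrB; last by rewrite ltnW.
  rewrite exprS; have mn0 : m%:R ^+ n != 0 :> R by rewrite expf_neq0.
  move: (m ^_ n)%:R (m%:R ^+ n) (n%:R : R) mn0 => x y z y0.
  by field; rewrite m0 y0.
apply: (cvg_eq_near (g := fun m => (m ^_ n)%:R / m%:R ^+ n * (t ^+ n / n`!%:R))).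
  exists 1%N => // m /= m0.
  have m_neq0 : m%:R != 0 :> R by rewrite pnatr_eq0 -lt0n.
  have f_neq0 : n`!%:R != 0 :> R by rewrite pnatr_eq0 -lt0n fact_gt0.
  rewrite -bin_ffact natrM expr_div_n.
  have mn_neq0 : m%:R ^+ n != 0 :> R by rewrite expf_neq0.
  move: ('C(m, n)%:R : R) (n`!%:R : R) (t ^+ n) (m%:R ^+ n) f_neq0 mn_neq0 => x y z u y0 u0.
  by field; rewrite y0 u0.
rewrite [X in _ --> X](_ : t ^+ n / n`!%:R = 1 * (t ^+ n / n`!%:R)); last by rewrite mul1r.
by apply: cvgM => //; exact: cvg_cst.
Qed.

End WordSums.

Section SlotWords.
Context {R : realType} {N : nat} (a : 'I_N -> R) (h : R).
Implicit Types (f : seq (option 'I_N)) (F : seq 'I_N -> bool).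

(** Contents of [m] time slots, each of them empty or with a single arrival. Several
    arrivals in a slot are left out: this becomes rare as the slots shrink. *)
Fixpoint slot_words m : seq (seq (option 'I_N)) :=
  if m is m'.+1 then
    [seq o :: f | o <- None :: map Some (enum 'I_N), f <- slot_words m']
  else [:: [::]].

Definition letters f : seq 'I_N := pmap id f.

(** Probability of the content of a slot of length [h], up to the factor [expR (- h)]
    that all contents share. *)
Definition slot_weight (o : option 'I_N) : R := if o is Some j then h * a j else 1.

Lemma uniq_slot_words m : uniq (slot_words m).
Proof.
elim: m => // m IH; apply: allpairs_uniq => //.
  rewrite /= map_inj_uniq ?enum_uniq ?andbT; last by move=> x y [].
  by apply/mapP => -[].
by move=> [x f] [x' f'] _ _ [-> ->].
Qed.

Lemma size_slot_words m f : f \in slot_words m -> size f = m.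
Proof.
elim: m f => [|m IH] f; first by rewrite inE => /eqP->.
by move/allpairsP => [[x f'] [_ /= /IH <- ->]].
Qed.

Lemma sum_slot_words m F :
  \sum_(f <- slot_words m | F (letters f)) \prod_(o <- f) slot_weight o =
  slot_mean a h m (fun w => (F w)%:R).
Proof.
elim: m F => [|m IH] F.
  by rewrite big_mkcond big_seq1 /= big_nil; case: (F _).
rewrite big_mkcond big_allpairs_dep/= big_cons big_map big_enum/=; congr (_ + _).
  rewrite -IH [RHS]big_mkcond; apply: eq_bigr => f _.
  by rewrite /letters/= big_cons/= mul1r.
rewrite mulr_sumr; apply: eq_bigr => j _; rewrite -IH [in RHS]big_mkcond !mulr_sumr.
apply: eq_bigr => f _; rewrite /letters/= big_cons/=.
by case: ifP => _; rewrite ?mulr0// mulrA.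
Qed.

End SlotWords.

Lemma card_eq1P {T : Type} (A : set T) : A #= `I_1 <-> exists x, A = [set x].
Proof.
split=> [|[x ->]]; last exact: card_set1.
move=> A1; have [f [fA f_inj Af]] := card_set_bijP A1.
have [x Ax fx] : exists2 x, A x & f x = 0%N by have [//|x] := Af 0%N; exists x.
exists x; apply/seteqP; split => [y Ay|_ ->//].
apply: f_inj; rewrite ?inE// fx; have := fA _ Ay.
by rewrite /= ltnS leqn0 => /eqP.
Qed.

Section SlotEvents.
Context {R : realType} {N : nat}.
Implicit Types (f : seq (option 'I_N)) (S t : nat -> R) (k : nat -> 'I_N).

(** Arrivals are counted class by class, the form in which the law of the input is
    given. *)
Definition slots_filled S k t f := forall j l, (l < size f)%N ->
  class_arrivals S k j (t l) (t l.+1) #= `I_(nth None f l == Some j).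

Lemma slots_filled_inj S k t f f' : size f = size f' ->
  slots_filled S k t f -> slots_filled S k t f' -> f = f'.
Proof.
move=> sz Hf Hf'; apply: (@eq_from_nth _ None) => // l lf.
have E j : (nth None f l == Some j) = (nth None f' l == Some j).
  have := card_eq_trans (card_esym (Hf j l lf)) (Hf' j l _); rewrite -sz => /(_ lf).
  by by move/card_eq_II; case: (_ == _); case: (_ == _).
case fl: (nth None f l) => [j|]; first by have := E j; rewrite fl eqxx => /esym/eqP.
by case f'l: (nth None f' l) => [j|//]; have := E j; rewrite fl f'l eqxx.
Qed.

(** The epochs increase, so the arrival of an occupied slot is the first one that has
    not yet occurred. *)
Lemma slots_filledP S k t f :
  {homo S : n n' / (n < n')%N >-> n < n'} -> (forall l, t l < t l.+1) -> t 0%N < S 0%N ->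
  slots_filled S k t f ->
  let w := letters f in
  (forall n, (S n <= t (size f)) = (n < size w)%N) /\ mkseq k (size w) = w.
Proof.
move=> Sincr tincr S0; elim/last_ind: f => [|f o IH] Hf /=.
  split=> // n; apply/negbTE; rewrite -ltNge (lt_le_trans S0)//.
  by case: n => // n; rewrite ltW// Sincr.
have [] := IH.
  move=> j l lf; have := Hf j l; rewrite size_rcons nth_rcons lf; apply.
  by rewrite ltnS ltnW.
set w := letters f => Sw kw.
have lw : letters (rcons f o) = if o is Some j then rcons w j else w.
  by rewrite /letters -cats1 pmap_cat/=; case: o {Hf} => [j|]; rewrite ?cats0// cats1.
have Ho j : class_arrivals S k j (t (size f)) (t (size f).+1) #= `I_(o == Some j).
  by have := Hf j (size f); rewrite size_rcons nth_rcons ltnn eqxx; apply.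
rewrite size_rcons lw; case: o Ho {Hf lw} => [j|] Ho; last first.
  split=> // n; rewrite -Sw; apply/idP/idP => [Sn|/le_trans]; last by apply; exact: ltW.
  rewrite leNgt; apply/negP => tn.
  have /= := Ho (k n); rewrite II0 card_eq0 => /eqP E.
  suff : (set0 : set nat) n by [].
  by rewrite -E /class_arrivals/= tn Sn.
have [n0 E0] : exists n, class_arrivals S k j (t (size f)) (t (size f).+1) = [set n].
  by apply/card_eq1P; have := Ho j; rewrite eqxx.
have only n : t (size f) < S n <= t (size f).+1 -> n = n0.
  move=> Sn; have [kj|kj] := eqVneq (k n) j.
    by have : [set n0] n by rewrite -E0.
  have := Ho (k n); rewrite (_ : (_ == _) = false) ?II0; last first.
    by apply/negbTE; apply: contra kj => /eqP[->].
  rewrite card_eq0 => /eqP E; suff : (set0 : set nat) n by [].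
  by rewrite -E /class_arrivals/= Sn.
have [kn0 /andP[tn0 n0t]] : class_arrivals S k j (t (size f)) (t (size f).+1) n0.
  by rewrite E0.
have wn0 : (size w <= n0)%N by rewrite leqNgt -Sw -ltNge.
have {}wn0 : size w = n0.
  apply: only; rewrite ltNge Sw ltnn/=; apply: le_trans n0t.
  by move: wn0; rewrite leq_eqVlt => /predU1P[->//|/Sincr/ltW].
rewrite size_rcons; split; last by rewrite mkseqS kw wn0 kn0.
move=> n; rewrite ltnS; apply/idP/idP => [Sn|].
  have [tn|nt] := ltP (t (size f)) (S n); first by rewrite (only n) ?wn0// tn.
  by rewrite ltnW// -Sw.
rewrite wn0 leq_eqVlt => /predU1P[->//|/Sincr/ltW/le_trans]; exact.
Qed.

End SlotEvents.

Section PoissonMixture.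
Context {R : realType} {N : nat} (a : 'I_N -> R).
Hypothesis a_ge0 : forall j, 0 <= a j.
Hypothesis a_sum1 : \sum_j a j = 1.
Implicit Types (F : seq 'I_N -> R) (k t p : R).

Let mixture t F M := \sum_(n < M) t ^+ n / n`!%:R * word_mean a n F.

(** With shorter and shorter slots, the binomial weights of the slots become the
    Poisson weights. *)
Lemma slot_limit_le k t p F M : 0 <= k -> 0 <= t -> (forall w, 0 <= F w) ->
  (forall m, (0 < m)%N -> k * slot_mean a (t / m%:R) m F <= p) ->
  k * mixture t F M <= p.
Proof.
move=> k0 t0 F0 H.
have cl : k * (\sum_(n < M) 'C(m, n)%:R * (t / m%:R) ^+ n * word_mean a n F)
    @[m --> \oo] --> k * mixture t F M.
  apply: cvgM; first exact: cvg_cst.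
  apply: (cvg_sumr (f := fun (n : 'I_M) m =>
    'C(m, n)%:R * (t / m%:R) ^+ n * word_mean a n F)) => n _.
  by apply: cvgM; [exact: cvg_binomial_pow|exact: cvg_cst].
apply: (cvgr_to_le cl); exists M.+1 => // m /= Mm.
apply: le_trans (H m _); last exact: leq_trans Mm.
rewrite ler_wpM2l// slot_meanE -(big_mkord xpredT (fun n => 'C(m, n)%:R * (t / m%:R) ^+ n *
  word_mean a n F)) -[leRHS](big_mkord xpredT (fun n => 'C(m, n)%:R * (t / m%:R) ^+ n *
  word_mean a n F)).
rewrite [leRHS](@big_cat_nat _ _ _ M)//=; last by rewrite (leq_trans (ltnW Mm)).
rewrite lerDl sumr_ge0// => n _.
by rewrite !mulr_ge0 ?exprn_ge0 ?divr_ge0// word_mean_ge0.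
Qed.

(** Slotting misses some probability and thus only gives lower bounds; but the bounds
    for an event and for its complement have the same total as the two
    probabilities in the limit. *)
Lemma cvg_mixture k t p1 p0 F : 0 <= k -> 0 <= t -> (forall w, 0 <= F w <= 1) ->
  (forall m, (0 < m)%N -> k * slot_mean a (t / m%:R) m F <= p1) ->
  (forall m, (0 < m)%N -> k * slot_mean a (t / m%:R) m (fun w => 1 - F w) <= p0) ->
  p1 + p0 = k * expR t ->
  k * mixture t F M @[M --> \oo] --> p1.
Proof.
move=> k0 t0 F01 H1 H0 p10.
have ce : k * (\sum_(n < M) t ^+ n / n`!%:R) @[M --> \oo] --> k * expR t.
  apply: cvgM; first exact: cvg_cst.
  under eq_fun do rewrite -(big_mkord xpredT (fun n => t ^+ n / n`!%:R)).
  exact: is_cvg_series_exp_coeff.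
have lo : k * (\sum_(n < M) t ^+ n / n`!%:R) - p0 @[M --> \oo] --> p1.
  have -> : p1 = k * expR t - p0 by rewrite -p10 addrK.
  by apply: cvgB => //; exact: cvg_cst.
apply: (squeeze_cvgr _ lo (cvg_cst p1)); near=> M; apply/andP; split; last first.
  by apply: slot_limit_le => // w; case/andP: (F01 w).
rewrite lerBlDl -lerBlDr -mulrBr -sumrB.
rewrite [X in k * X](_ : _ = mixture t (fun w => 1 - F w) M); last first.
  apply: eq_bigr => n _; rewrite word_meanB word_mean_cst//.
  by rewrite mulrBr mulr1.
by apply: slot_limit_le => // w; case/andP: (F01 w); rewrite subr_ge0.
Unshelve. all: by end_near. Qed.

End PoissonMixture.

(** * The law of the matching time *)

Section MatchingTimeLaw.
Context {R : realType} {N : nat} (e : rel 'I_N) (a : 'I_N -> R).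
Hypothesis a_gt0 : forall j, 0 < a j.
Hypothesis a_sum1 : \sum_j a j = 1.
Context (pi : probability (buffer N) R).
Context {d : measure_display} {Om : measurableType d} (P : probability Om R).
Context (C : Om -> buffer N) (S : nat -> Om -> R) (K : nat -> Om -> 'I_N).
Hypothesis input : stationary_input a pi P C S K.
Context (i : 'I_N).

Let a_ge0 j : 0 <= a j. Proof. exact: ltW. Qed.
Let T w := matching_time e i (C w) (S ^~ w) (K ^~ w).

Let S_mono w : {homo (S ^~ w) : n n' / (n < n')%N >-> n < n'}.
Proof.
refine (homo_ltn _ _); first by move=> y x z; exact: lt_trans.
by move=> n; exact: (input_time_increasing input).
Qed.

Let S_gt0 n w : 0 < S n w.
Proof.
have S0 := input_time_gt0 input w; case: n => // n; apply: lt_trans S0 _.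
exact: S_mono.
Qed.

Lemma measurable_arrival j (t u : R) n :
  measurable [set w | class_arrivals (S ^~ w) (K ^~ w) j t u n].
Proof.
have -> : [set w | class_arrivals (S ^~ w) (K ^~ w) j t u n] =
    [set w | K n w = j] `&` (setT `&` S n @^-1` `]t, u]%classic).
  by rewrite setTI; apply/seteqP; split=> w /=; rewrite /class_arrivals/= in_itv.
apply: measurableI; first exact: (input_measurable_class input).
exact: (input_measurable_time input).
Qed.

Lemma measurable_arrivals_card j (t u : R) (b : bool) :
  measurable [set w | class_arrivals (S ^~ w) (K ^~ w) j t u #= `I_b].
Proof.
pose D n := [set w | class_arrivals (S ^~ w) (K ^~ w) j t u n].
have mD n : measurable (D n) by exact: measurable_arrival.
case: b.
  have -> : [set w | class_arrivals (S ^~ w) (K ^~ w) j t u #= `I_1] =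
      \bigcup_n (D n `&` ~` \bigcup_(m in [set m | m <> n]) D m).
    apply/seteqP; split => w /=.
      move/card_eq1P => [n E]; exists n => //; split; first by rewrite /D/= E.
      by move=> [m /= mn]; rewrite /D/= E.
    move=> [n _ [Dn nD]]; apply/card_eq1P; exists n; apply/seteqP; split=> [m Dm|_ ->//].
    by apply: contrapT => mn; apply: nD; exists m.
  apply: bigcupT_measurable => n; apply: measurableI => //.
  by apply: measurableC; exact: bigcup_measurable.
have -> : [set w | class_arrivals (S ^~ w) (K ^~ w) j t u #= `I_0] = ~` \bigcup_n D n.
  apply/seteqP; split => w /=; rewrite II0 card_eq0.
    by move=> /eqP E [n _]; rewrite /D/= E.
  move=> nD; by apply/eqP; apply/seteqP; split => // n Dn; apply: nD; exists n.
by apply: measurableC; exact: bigcupT_measurable.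
Qed.

Definition slot_event c (h : R) f :=
  [set w | C w = c /\ slots_filled (S ^~ w) (K ^~ w) (fun l => l%:R * h) f].

Lemma measurable_state c : measurable [set w | C w = c].
Proof.
have := input_measurable_state input measurableT (measurable_buffer [set c]).
by rewrite setTI.
Qed.

Lemma measurable_slot_event c h f : measurable (slot_event c h f).
Proof.
have -> : slot_event c h f = [set w | C w = c] `&`
    \bigcap_(l in `I_(size f)) \bigcap_(j in [set: 'I_N])
    [set w | class_arrivals (S ^~ w) (K ^~ w) j (l%:R * h) (l.+1%:R * h) #=
      `I_(nth None f l == Some j)].
  apply/seteqP; split=> w [Cw H]; split=> //; first by move=> l lf j _; exact: H.
  by move=> j l lf; exact: H.
apply: measurableI; first exact: measurable_state.
apply: bigcap_measurableType => l _; apply: fin_bigcap_measurable => // j _.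
exact: measurable_arrivals_card.
Qed.

Lemma prob_slot_event c h f : 0 < h ->
  P (slot_event c h f) =
  (mass pi c * (expR (- ((size f)%:R * h)) * \prod_(o <- f) slot_weight a h o))%:E.
Proof.
move=> h0.
have := @input_law _ _ _ _ _ _ _ _ _ _ input c (size f) (fun l => l%:R * h)
  (fun j l => (nth None f l == Some j) : nat).
rewrite mul0r => /(_ (lexx _)); rewrite -/(slot_event c h f) => -> //; last first.
  by move=> l _; rewrite ltr_pM2r// ltr_nat.
rewrite EFinM massE; congr (_ * _%:E)%E.
have hE l : l.+1%:R * h - l%:R * h = h by rewrite -mulrBl -natrB// subSnn mul1r.
under eq_bigr do under eq_bigr do rewrite hE.
rewrite exchange_big/=.
rewrite [X in _ = _ * X](big_nth None) big_mkord.
have -> : expR (- ((size f)%:R * h)) = \prod_(l < size f) expR (- h).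
  by rewrite prodr_const card_ord -expRM_natl mulrN.
rewrite -big_split/=; apply: eq_bigr => l _.
transitivity (\prod_(j < N) (expR (- (a j * h)) *
    (if nth None f l == Some j then h * a j else 1))).
  apply: eq_bigr => j _; rewrite /poisson_pmf mulr_gt0// mulrC; congr (_ * _).
  by case: (_ == _); rewrite ?expr0 ?expr1 ?divr1// mulrC.
rewrite big_split/= -expR_sum sumrN -mulr_suml a_sum1 mul1r; congr (_ * _).
case: (nth None f l) => [j|] /=; last by rewrite big1.
rewrite (bigD1 j)//= eqxx big1 ?mulr1// => k kj.
by case: eqP => // -[jk]; rewrite jk eqxx in kj.
Qed.

(** Slot words with the same number of slots describe disjoint events. *)
Lemma slots_prob_le (A : set Om) c (h : R) m (F : seq 'I_N -> bool) :
  measurable A -> 0 < h ->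
  (forall f w, size f = m -> F (letters f) -> slot_event c h f w -> A w) ->
  ((mass pi c * expR (- (m%:R * h)) * slot_mean a h m (fun w => (F w)%:R))%:E <= P A)%E.
Proof.
move=> mA h0 FA; pose s := [seq f <- @slot_words N m | F (letters f)].
have us : uniq s by rewrite filter_uniq// uniq_slot_words.
have sP f : f \in s -> F (letters f) /\ size f = m.
  by rewrite mem_filter => /andP[-> /size_slot_words].
have : (P (\bigcup_(f in [set` s]) slot_event c h f) <= P A)%E.
  apply: le_measure; rewrite ?inE//.
    by apply: fin_bigcup_measurable => // f _; exact: measurable_slot_event.
  by move=> w [f /sP[Ff szf]]; exact: FA.
apply: le_trans; rewrite measure_fin_bigcup//; last 3 first.
- exact: finite_seq.
- move=> f f' /sP[_ szf] /sP[_ szf'] [w [[_ Hf] [_ Hf']]].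
  by apply: slots_filled_inj Hf Hf'; rewrite szf.
- by move=> f _; exact: measurable_slot_event.
rewrite -fsbig_seq// -sum_slot_words big_filter -mulrA !mulr_sumr -sumEFin.
rewrite big_seq_cond [leRHS]big_seq_cond; apply: lee_sum => f /andP[/size_slot_words szf _].
by rewrite -szf -(prob_slot_event c f h0).
Qed.

Lemma measurable_history (Q : buffer N -> seq 'I_N -> Prop) n :
  measurable [set w | Q (C w) (mkseq (K ^~ w) n)].
Proof.
elim: n Q => [|n IH] Q.
  have := input_measurable_state input measurableT (measurable_buffer [set c | Q c [::]]).
  by rewrite setTI.
have -> : [set w | Q (C w) (mkseq (K ^~ w) n.+1)] =
    \bigcup_(j in [set: 'I_N]) ([set w | K n w = j] `&`
      [set w | Q (C w) (rcons (mkseq (K ^~ w) n) j)]).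
  apply/seteqP; split => w; rewrite [X in X w -> _]/mkset ?[X in _ -> X w]/mkset.
    by rewrite mkseqS => Qw; exists (K n w).
  by move=> [j _ [/= <- Qw]]; rewrite mkseqS.
apply: fin_bigcup_measurable => // j _; apply: measurableI.
  exact: (input_measurable_class input).
exact: (IH (fun c s => Q c (rcons s j))).
Qed.

Lemma measurable_matching_time : measurable_fun setT T.
Proof.
pose u n w : \bar R := if ~~ present e i (C w) (mkseq (K ^~ w) n)
  then (if n is m.+1 then S m w else 0)%:E else +oo%E.
have -> : T = fun w => einfs (u ^~ w) 0%N.
  apply/funext => w; apply/le_anti/andP; split.
    apply: le_ereal_inf_tmp => _ [n _ <-]; rewrite /u -tagged_present.
    case: ifPn => [gone|_]; last exact: leey.
    by apply: ereal_inf_lbound; exists n.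
  apply: le_ereal_inf_tmp => _ [n /= gone <-]; apply: ereal_inf_lbound.
  by exists n => //; rewrite /u -tagged_present gone.
apply: measurable_fun_einfs => n; apply: measurable_fun_ifT.
- apply: (measurable_fun_bool true); rewrite setTI.
  exact: (measurable_history (fun c s => ~~ present e i c s)).
- apply/measurable_EFinP; case: n => [|n]; first exact: measurable_cst.
  exact: (input_measurable_time input).
- exact: measurable_cst.
Qed.

Lemma measurable_late t : measurable [set w | (t < T w)%E].
Proof.
have -> : [set w | (t < T w)%E] = setT `&` T @^-1` `]t, +oo[%classic.
  by rewrite setTI; apply/seteqP; split=> w /=; rewrite in_itv/= andbT.
by apply: measurable_matching_time => //; exact: emeasurable_itv.
Qed.

Lemma slot_event_late c h f w : 0 < h -> slot_event c h f w ->
  (((size f)%:R * h)%:E < T w)%E = present e i c (letters f).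
Proof.
move=> h0 [Cw]; set t := fun l => l%:R * h => /slots_filledP[].
- exact: S_mono.
- by move=> l; rewrite ltr_pM2r// ltr_nat.
- by rewrite /t mul0r.
move=> Sn Kw; rewrite /T Cw -[in RHS]Kw; apply: matching_time_gt => //.
- by rewrite mulr_ge0// ltW.
- by move=> l; exact: (input_time_increasing input).
Qed.

(** The number of arrivals up to time [t] is Poisson and their classes are
    independent, so only the survival of random words is left to describe. *)
Lemma prob_late c (t : R) : 0 < t ->
  P [set w | C w = c /\ (t%:E < T w)%E] =
  (\sum_(n <oo) (mass pi c * (expR (- t) * (t ^+ n / n`!%:R) *
     word_mean a n (fun v => (present e i c v)%:R)))%:E)%E.
Proof.
move=> t0; set A1 := [set w | _ /\ _].
pose A0 := [set w | C w = c] `\` [set w | (t%:E < T w)%E].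
have mA1 : measurable A1 by apply: measurableI; [exact: measurable_state|exact: measurable_late].
have mA0 : measurable A0 by apply: measurableD; [exact: measurable_state|exact: measurable_late].
have A10 : (P A1 + P A0 = (mass pi c)%:E)%E.
  rewrite -measureU//; last by apply/seteqP; split => // w [[_ tT] [_]].
  have -> : A1 `|` A0 = [set w | C w = c].
    apply/seteqP; split => [w [[]//|[]//]|w Cw].
    by have [tT|tT] := pselect (t%:E < T w)%E; [left|right].
  have := @prob_slot_event c 1 [::] ltr01.
  rewrite big_nil mul0r oppr0 expR0 !mulr1 => <-; congr (P _).
  by apply/seteqP; split => w [].
have tm m : (0 < m)%N -> 0 < t / m%:R by move=> m0; rewrite divr_gt0// ltr0n.
have mtm m : (0 < m)%N -> m%:R * (t / m%:R) = t.
  by move=> m0; rewrite mulrC divfK// pnatr_eq0 -lt0n.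
have fin1 : P A1 \is a fin_num by exact: fin_num_measure.
have fin0 : P A0 \is a fin_num by exact: fin_num_measure.
pose k := mass pi c * expR (- t).
have c1 : k * (\sum_(n < M) t ^+ n / n`!%:R *
    word_mean a n (fun v => (present e i c v)%:R)) @[M --> \oo] --> fine (P A1).
  apply: (@cvg_mixture _ _ a a_ge0 a_sum1 k t _ (fine (P A0))).
  - by rewrite mulr_ge0 ?mass_ge0// expR_ge0.
  - exact: ltW.
  - by move=> v; case: (present _ _ _ _); rewrite ?lexx ler01.
  - move=> m m0; rewrite -lee_fin fineK//.
    have := @slots_prob_le A1 c (t / m%:R) m (present e i c) mA1 (tm m m0).
    rewrite mtm//; apply => f w szf pf Hf; split; first by case: Hf.
    by have := slot_event_late (tm m m0) Hf; rewrite szf mtm//= => ->.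
  - move=> m m0; rewrite -lee_fin fineK//.
    rewrite (_ : slot_mean _ _ _ _ =
      slot_mean a (t / m%:R) m (fun v => (~~ present e i c v)%:R)); last first.
      by apply: eq_slot_mean => v; case: present; rewrite ?subrr ?subr0.
    have := @slots_prob_le A0 c (t / m%:R) m (fun v => ~~ present e i c v) mA0 (tm m m0).
    rewrite mtm//; apply => f w szf pf Hf; split; first by case: Hf.
    by have := slot_event_late (tm m m0) Hf; rewrite szf mtm//= => ->; exact/negP.
  - apply: EFin_inj; rewrite EFinD !fineK// A10 /k -mulrA -expRD addNr expR0 mulr1//.
rewrite -(fineK fin1); apply/esym/cvg_lim => //.
rewrite (_ : (fun M => _) = fun M => (k * (\sum_(n < M) t ^+ n / n`!%:R *
    word_mean a n (fun v => (present e i c v)%:R)))%:E).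
  by apply: cvg_EFin_real.
apply/funext => M; rewrite big_mkord sumEFin mulr_sumr; congr (_%:E).
by apply: eq_bigr => n _; rewrite /k !mulrA.
Qed.

Let alive n c : R := word_mean a n (fun v => (present e i c v)%:R).

Let alive_ge0 n c : 0 <= alive n c.
Proof. exact: word_mean_ge0. Qed.

Let alive_le1 n c : alive n c <= 1.
Proof. by apply: word_mean_le1 => // v; case: present; rewrite ?lexx ?ler01. Qed.

Let alive_recS n c : alive n.+1 c = (~~ compatible e id c i)%:R *
  \sum_j a j * (if compatible e id c j then alive n (fcfm e id c j)
                else (~~ e i j)%:R * alive n c).
Proof.
rewrite /alive/= mulr_sumr; apply: eq_bigr => j _; rewrite mulrCA; congr (_ * _).
rewrite (@eq_word_mean _ _ a n _ (fun v => (~~ compatible e id c i)%:R *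
  (if compatible e id c j then (present e i (fcfm e id c j) v)%:R
   else (~~ e i j)%:R * (present e i c v)%:R))); last first.
  by move=> v; rewrite present_cons -mulnb natrM; case: ifP => // _; rewrite -mulnb natrM.
by rewrite word_meanZ; congr (_ * _); case: ifP => // _; rewrite word_meanZ.
Qed.

Hypotheses (e_sym : symmetric e) (e_irr : irreflexive e).
Hypothesis pi_stat : stationary_distribution e a pi.

Notation adj := (compatible e id).
Notation arrive := (fcfm e id).
Notation mu := (@lebesgue_measure R).

Section WaitTransform.
Variable s : R.
Hypothesis s_gt0 : 0 < s.

Let b := (1 + s)^-1.

(** Laplace transform, at [s], of the probability that the tagged item is still
    there: the Poisson weight [expR (- t) * t ^+ n / n`!] of exactly [n] arrivals
    has transform [(1 + s)^-1 ^+ n.+1]. *)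
Definition wait_transform c : R := limn (series (fun n => alive n c * b ^+ n.+1)).

Let b_gt0 : 0 < b. Proof. by rewrite invr_gt0 addr_gt0. Qed.
Let b_lt1 : b < 1. Proof. by rewrite invf_lt1 ?addr_gt0// ltrDl. Qed.

Let term_ge0 c n : 0 <= alive n c * b ^+ n.+1.
Proof. by rewrite mulr_ge0// exprn_ge0// ltW. Qed.

Let cvg_geo : series (fun n => b ^+ n.+1) @ \oo --> s^-1.
Proof.
have -> : s^-1 = b / (1 - b).
  have -> : 1 - b = s * b by rewrite /b; field; rewrite gt_eqF ?addr_gt0.
  by rewrite invfM mulrCA divff ?mulr1// gt_eqF.
have := @cvg_geometric_series R b b; rewrite ger0_norm ?ltW// => /(_ b_lt1).
rewrite (_ : geometric b b = fun n => b ^+ n.+1)//.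
by apply/funext => n; rewrite /= exprS.
Qed.

Lemma cvg_wait_transform c :
  series (fun n => alive n c * b ^+ n.+1) @ \oo --> wait_transform c.
Proof.
apply: (@series_le_cvg _ _ (fun n => b ^+ n.+1)).
- exact: term_ge0.
- by move=> n; rewrite exprn_ge0// ltW.
- by move=> n; rewrite ler_piMl ?exprn_ge0// ltW.
- exact: cvgP cvg_geo.
Qed.

Lemma wait_transform_ge0 c : 0 <= wait_transform c.
Proof.
apply: (cvgr_to_ge (@cvg_wait_transform c)); apply: nearW => n.
by apply: sumr_ge0 => k _; exact: term_ge0.
Qed.

Lemma wait_transform_le c : wait_transform c <= s^-1.
Proof.
apply: (ler_cvg_to (@cvg_wait_transform c) cvg_geo); apply: nearW => n.
by apply: ler_sum => k _; rewrite ler_piMl ?exprn_ge0// ltW.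
Qed.

Lemma bounded_wait_transform : bounded_fn wait_transform.
Proof.
by exists s^-1 => c; rewrite ger0_norm ?wait_transform_ge0// wait_transform_le.
Qed.

(** First-step analysis, on the class of the next arrival. *)
Lemma wait_transform_step c : (1 + s) * wait_transform c =
  (~~ compatible e id c i)%:R * (1 + \sum_j a j *
    (if compatible e id c j then wait_transform (fcfm e id c j)
     else (~~ e i j)%:R * wait_transform c)).
Proof.
set ci := (_ %:R); set g := wait_transform.
have cS : series (fun n => alive n c * b ^+ n.+1) n.+1 @[n --> \oo] --> g c.
  by rewrite cvg_shiftS; exact: cvg_wait_transform.
pose nxt M j := if compatible e id c j
  then series (fun n => alive n (fcfm e id c j) * b ^+ n.+1) M
  else (~~ e i j)%:R * series (fun n => alive n c * b ^+ n.+1) M.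
have cR : b * (ci * (1 + \sum_j a j * nxt M j)) @[M --> \oo] -->
    b * (ci * (1 + \sum_j a j * (if compatible e id c j then g (fcfm e id c j)
     else (~~ e i j)%:R * g c))).
  apply: cvgM; first exact: cvg_cst.
  apply: cvgM; first exact: cvg_cst.
  apply: cvgD; first exact: cvg_cst.
  apply: (cvg_sumr (f := fun j M => a j * nxt M j)) => j _.
  apply: cvgM; first exact: cvg_cst.
  rewrite /nxt; case: ifP => _; first exact: cvg_wait_transform.
  by apply: cvgM; [exact: cvg_cst|exact: cvg_wait_transform].
suff gE : g c = b * (ci * (1 + \sum_j a j * (if compatible e id c j
    then g (fcfm e id c j) else (~~ e i j)%:R * g c))).
  by rewrite {1}gE /b mulrA divff ?mul1r// gt_eqF// addr_gt0.
apply: (cvg_unique _ cS); rewrite //=.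
rewrite (_ : (fun n => _) = fun M => b * (ci * (1 + \sum_j a j * nxt M j)))//.
apply/funext => M; rewrite /series/= big_nat_recl//.
rewrite expr1 mulrDr mulrDr mulr1; congr (_ + _).
  by rewrite /alive/= /present andbT mulrC.
under eq_bigr do rewrite alive_recS exprS.
rewrite !mulr_sumr.
under eq_bigr do rewrite !mulr_sumr mulr_suml.
rewrite exchange_big/=; apply: eq_bigr => j _; rewrite /nxt.
case: ifP => _; rewrite /series/= !mulr_sumr; apply: eq_bigr => n _; ring.
Qed.

Let tail w := (\int[mu]_(t in [set t | (0 <= t)%R /\ t%:E < T w]) (expR (- s * t))%:E)%E.

Let tail_ge0 w : (0 <= tail w)%E.
Proof. by apply: integral_ge0 => t _; rewrite lee_fin expR_ge0. Qed.

Let mexp : measurable_fun setT (fun t : R => expR (- s * t)).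
Proof. by apply: continuous_measurable_fun; exact: continuous_expRN. Qed.

Let measurable_tail : measurable_fun setT tail.
Proof.
by apply: measurable_tail_integral => //; exact: measurable_matching_time.
Qed.

Let prob_late0 c (t : R) : 0 <= t ->
  P [set w | C w = c /\ (t%:E < T w)%E] =
  (\sum_(n <oo) (mass pi c * (expR (- t) * (t ^+ n / n`!%:R) * alive n c))%:E)%E.
Proof.
rewrite le_eqVlt => /predU1P[<-|]; last exact: prob_late.
rewrite nneseries_recl; last 2 first.
- by move=> n _; rewrite lee_fin !mulr_ge0 ?mass_ge0 ?expR_ge0 ?exprn_ge0// invr_ge0.
- by [].
rewrite eseries0 ?adde0; last first.
  by move=> n n0 _; rewrite expr0n gtn_eqF//= mul0r mulr0 mul0r mulr0.
rewrite oppr0 expR0 expr0 divr1 !mul1r /alive/=.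
have late0 w : C w = c -> (0%:E < T w)%E = present e i c [::].
  move=> Cw; rewrite /T Cw -[RHS]/(present e i c (mkseq (K ^~ w) 0)).
  apply: matching_time_gt => //; first by move=> l; exact: (input_time_increasing input).
  by move=> l; rewrite ltn0 leNgt S_gt0.
case pc: (present e i c [::]).
  rewrite mulr1 massE; have := @prob_slot_event c 1 [::] ltr01.
  rewrite big_nil mul0r oppr0 expR0 !mulr1 massE => <-; congr (P _).
  by apply/seteqP; split => w [Cw]; split => //; rewrite late0.
rewrite mulr0; transitivity (P set0); last exact: measure0.
congr (P _); by apply/seteqP; split => w [] // Cw; rewrite late0// pc.
Qed.

Let series_transform c :
  (\sum_(n <oo) (mass pi c * (alive n c * b ^+ n.+1))%:E)%E =
  (mass pi c * wait_transform c)%:E.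
Proof.
apply/cvg_lim => //.
rewrite (_ : (fun M => _) = fun M =>
  (mass pi c * series (fun n => alive n c * b ^+ n.+1) M)%:E); last first.
  by apply/funext => M; rewrite sumEFin mulr_sumr.
by apply: cvg_EFin_real; apply: cvgM; [exact: cvg_cst|exact: cvg_wait_transform].
Qed.

Let integral_tail_state c :
  (\int[P]_(w in [set w | C w = c]) tail w = (mass pi c * wait_transform c)%:E)%E.
Proof.
pose X w := if C w == c then T w else 0%E.
have mX : measurable_fun setT X.
  apply: measurable_fun_ifT => //; last exact: measurable_matching_time.
  apply: (measurable_fun_bool true); rewrite setTI.
  rewrite (_ : _ @^-1` _ = [set w | C w = c]); first exact: measurable_state.
  by apply/seteqP; split => w /= /eqP.
transitivity (\int[P]_w \int[mu]_(t in [set t | (0 <= t)%R /\ t%:E < X w])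
    (expR (- s * t))%:E)%E.
  rewrite integral_mkcond; apply: eq_integral => w _; rewrite patchE /X.
  have [Cw|Cw] := eqVneq (C w) c; first by rewrite mem_set.
  rewrite memNset/=; last exact/eqP.
  rewrite (_ : [set t | _ /\ _] = set0) ?integral_set0//.
  apply/seteqP; split => // t [t0]; rewrite lte_fin => /(le_lt_trans t0).
  by rewrite ltxx.
rewrite integral_tail//.
transitivity (\int[mu]_(t in `[0%R, +oo[) (\sum_(n <oo)
    (mass pi c * alive n c * (expR (- (1 + s) * t) * (t ^+ n / n`!%:R)))%:E))%E.
  apply: eq_integral => t; rewrite mem_setE in_itv/= andbT => t0.
  rewrite (_ : [set w | _] = [set w | C w = c /\ (t%:E < T w)%E]); last first.
    apply/seteqP; split => w; rewrite /X/=; last by case=> -> ; rewrite eqxx.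
    case: eqP => // _; rewrite lte_fin => /(le_lt_trans t0).
    by rewrite ltxx.
  rewrite prob_late0// -nneseriesZl; last first.
    by move=> n _; rewrite lee_fin !mulr_ge0 ?mass_ge0 ?expR_ge0 ?exprn_ge0// invr_ge0.
  apply: eq_eseriesr => n _; rewrite -EFinM; congr (_%:E).
  have -> : - (1 + s) * t = - s * t + - t by ring.
  rewrite expRD; move: (mass _ _) (alive _ _) (expR _) (expR _) (_ / _) => x y z u v.
  ring.
rewrite integral_nneseries//; last 2 first.
- move=> n; apply/measurable_EFinP; apply: measurable_funTS.
  apply: measurable_funM => //; apply: measurable_funM.
    by apply: continuous_measurable_fun; exact: continuous_expRN.
  by apply: measurable_funM => //; exact: exprn_measurable.
- move=> n t; rewrite /= in_itv/= andbT => t0.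
  by rewrite lee_fin !mulr_ge0 ?mass_ge0 ?expR_ge0 ?exprn_ge0// invr_ge0.
rewrite -series_transform; apply: eq_eseriesr => n _.
under eq_integral do rewrite EFinM.
rewrite ge0_integralZl//; last 3 first.
- apply/measurable_EFinP; apply: measurable_funTS; apply: measurable_funM.
    by apply: continuous_measurable_fun; exact: continuous_expRN.
  by apply: measurable_funM => //; exact: exprn_measurable.
- move=> t; rewrite /= in_itv/= andbT => t0.
  by rewrite lee_fin !mulr_ge0 ?expR_ge0 ?exprn_ge0// invr_ge0.
- by rewrite lee_fin mulr_ge0 ?mass_ge0.
by rewrite integral_gamma ?addr_gt0// -EFinM mulrA.
Qed.

Lemma integral_tail_time :
  (\int[P]_w \int[mu]_(t in [set t | (0 <= t)%R /\ t%:E < T w]) (expR (- s * t))%:E =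
   (Ex pi wait_transform)%:E)%E.
Proof.
rewrite EFin_Ex; last exact: bounded_wait_transform.
pose B n := [set w | pickle (C w : seq 'I_N) = n].
have BE n : B n = [set w | pickle (decode n : seq 'I_N) = n /\ C w = decode n].
  apply/seteqP; split => w; rewrite /B/=; first by move=> <-; rewrite decodeK.
  by case=> nE ->.
have mB n : measurable (B n).
  rewrite BE; have [nE|nE] := pselect (pickle (decode n : seq 'I_N) = n).
    rewrite (_ : [set w | _] = [set w | C w = decode n]); first exact: measurable_state.
    by apply/seteqP; split => w /=; [case|].
  rewrite (_ : [set w | _] = set0)//.
  by apply/seteqP; split => w // [].
have BT : \bigcup_n B n = setT.
  by apply/seteqP; split => // w _; exists (pickle (C w : seq 'I_N)).
rewrite -[in LHS]BT ge0_integral_bigcup//; last 3 first.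
- by rewrite BT; exact: measurable_tail.
- by move=> w _; exact: tail_ge0.
- by move=> m n _ _ [w [/= <- <-]].
have := @integral_fibres _ _ pi (fun=> 1) id wait_transform (fun=> ler01)
  wait_transform_ge0.
under eq_integral do rewrite mul1r.
move=> ->; apply: eq_eseriesr => n _; rewrite (@integral_eq_mass _ _ _ (fun=> 1))// mul1r.
rewrite BE; case: eqP => [nE|nE]; last first.
  rewrite (_ : [set w | _] = set0) ?integral_set0 ?mul0e//.
  by apply/seteqP; split => w // [].
rewrite (_ : [set w | _] = [set w | C w = decode n]); last first.
  by apply/seteqP; split => w /=; [case|].
by rewrite integral_tail_state EFinM muleC.
Qed.

(** ** Stationary mean of the transform *)

Hypothesis s_le : s <= a i.

Notation g := wait_transform.

Let z := 1 - s / a i.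

Let z_ge0 : 0 <= z.
Proof. by rewrite subr_ge0 ler_pdivrMr ?mul1r. Qed.

Let z_lt1 : z < 1.
Proof. by rewrite ltrBlDr ltrDl divr_gt0. Qed.

Let rate_z : a i * (1 - z) = s.
Proof. by rewrite /z opprB addrC subrK mulrCA divff ?mulr1// gt_eqF. Qed.

Fixpoint rev_potential (r : seq 'I_N) : R :=
  if r is j :: r' then
    if j == i then z * rev_potential r' + g (rev r') else rev_potential r'
  else 0.

(** Test function for the balance equations: each class-[i] item contributes the
    transform of its own residual wait, which depends on the items ahead of it,
    discounted by [z] for every younger class-[i] item. *)
Definition potential (c : buffer N) := rev_potential (rev c).

(** This is the sum of [z ^+ l] for [l] below the number of class-[i] items. *)
Definition discounted (c : buffer N) : R := (1 - z ^+ count_mem i c) / (1 - z).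

Let z1 : 1 - z != 0. Proof. by rewrite subr_eq0 gt_eqF. Qed.

Lemma potential_rcons c j : potential (rcons c j) =
  if j == i then z * potential c + g c else potential c.
Proof. by rewrite /potential rev_rcons /= revK. Qed.

Lemma discounted_rcons c j : discounted (rcons c j) =
  if j == i then 1 + z * discounted c else discounted c.
Proof.
rewrite /discounted -cats1 count_cat/= addn0; case: eqP => _; last by rewrite addn0.
by rewrite addn1 exprS; move: (z ^+ _) => x; field.
Qed.

Lemma potential_notin c : i \notin c -> potential c = 0.
Proof.
elim/last_ind: c => // c j IH; rewrite mem_rcons inE negb_or => /andP[ij ic].
by rewrite potential_rcons eq_sym (negbTE ij) IH.
Qed.

Lemma potential_ge0 c : 0 <= potential c.
Proof.
elim/last_ind: c => // c j IH; rewrite potential_rcons; case: ifP => // _.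
by rewrite addr_ge0 ?mulr_ge0// wait_transform_ge0.
Qed.

Lemma potential_le c : potential c <= s^-1 / (1 - z).
Proof.
elim/last_ind: c => [|c j IH].
  by rewrite /potential /= divr_ge0// ?invr_ge0 ?subr_ge0 ltW.
rewrite potential_rcons; case: ifP => // _.
apply: (le_trans (lerD (ler_wpM2l z_ge0 IH) (wait_transform_le c))).
by move: (s^-1) => x; rewrite le_eqVlt; apply/orP; left; apply/eqP; field.
Qed.

Lemma bounded_potential : bounded_fn potential.
Proof.
by exists (s^-1 / (1 - z)) => c; rewrite ger0_norm ?potential_ge0// potential_le.
Qed.

Lemma bounded_discounted : bounded_fn discounted.
Proof.
apply: bounded_M; last exact: bounded_cst.
exists 1 => c; have z0 : 0 <= z ^+ count_mem i c by rewrite exprn_ge0.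
have z1' : z ^+ count_mem i c <= 1 by rewrite exprn_ile1// ltW.
by rewrite ger0_norm ?subr_ge0// lerBlDr lerDl.
Qed.

Lemma wait_transform_adj c : adj c i -> g c = 0.
Proof.
move=> ci; have := wait_transform_step c; rewrite ci mul0r => /eqP.
by rewrite mulf_eq0 gt_eqF ?addr_gt0//= => /eqP.
Qed.

Let drift c := \sum_(m | adj c m) a m * (potential (arrive c m) - potential c).

Let served c := \sum_(m | ~~ adj c m && e i m) a m.

Let wait_transform_balance c : ~~ adj c i ->
  \sum_(m | adj c m) a m * (g (arrive c m) - g c) = (s + served c) * g c - 1.
Proof.
move=> ci; have := wait_transform_step c; rewrite ci mul1r.
have -> : \sum_j a j * (if adj c j then g (arrive c j) else (~~ e i j)%:R * g c) =
    \sum_(m | adj c m) a m * (g (arrive c m) - g c) + (\sum_j a j) * g c - served c * g c.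
  rewrite /served [in RHS]big_mkcond [X in _ = _ - X * _]big_mkcond !mulr_suml -sumrN.
  rewrite -!big_split/=; apply: eq_bigr => j _.
  case: (adj c j); case: (e i j) => /=; ring.
rewrite a_sum1 mul1r; set x := (X in _ -> X = _) => E.
have {E} : (1 + s) * g c = 1 + (x + g c - served c * g c) by [].
move: x (served c) (g c) => x y u E.
have -> : (s + y) * u - 1 = (1 + s) * u - 1 - u + y * u by ring.
by rewrite E; ring.
Qed.

Let drift_rcons c j : drift (rcons c j) =
  (if j == i then z * drift c + \sum_(m | adj c m) a m * (g (arrive c m) - g c)
   else drift c) +
  \sum_(m | ~~ adj c m && e j m) a m * (potential c - potential (rcons c j)).
Proof.
rewrite {1}/drift (bigID (fun m => adj c m))/=; congr (_ + _); last first.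
  apply: eq_big => m; first by rewrite compatible_rcons andbC; case: (adj c m); rewrite ?orbF.
  rewrite compatible_rcons => /andP[jm cm]; rewrite arrive_rcons_newest//.
  by move: jm; rewrite (negbTE cm) orbF.
transitivity (\sum_(m | adj c m)
    a m * (potential (rcons (arrive c m) j) - potential (rcons c j))).
  apply: eq_big => m; first by rewrite compatible_rcons; case: (adj c m); rewrite ?orbT ?andbF.
  by case/andP => _ cm; rewrite arrive_rcons_older.
case: ifPn => [ji|ji]; last first.
  by apply: eq_bigr => m _; rewrite !potential_rcons (negbTE ji).
rewrite /drift mulr_sumr -big_split/=; apply: eq_bigr => m _.
rewrite !potential_rcons ji.
by move: (potential _) (potential _) (g _) (g _) => x y u v; ring.
Qed.

(** By induction on the newest item. When it is of class [i], its transform changes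
    as described by [wait_transform_balance]; a newcomer that it alone can serve
    leaves a buffer without class [i], where the potential is 0. *)
Lemma driftE c : admissible e c -> drift c = s * potential c - discounted c.
Proof.
elim/last_ind: c => [_|c j IH].
  rewrite /drift big1 ?mul0r// /potential /discounted/= expr0 subrr mul0r mulr0.
  by rewrite subr0.
rewrite admissible_rcons// => /andP[/IH {}IH cj].
rewrite drift_rcons discounted_rcons potential_rcons.
have [ji|ji] := eqVneq j i; last by rewrite subrr big1 ?addr0// => m _; rewrite mulr0.
rewrite ji in cj *; rewrite wait_transform_balance// IH -mulr_suml -/(served c).
have served0 : served c * potential c = 0.
  have [ic|ic] := boolP (i \in c); last by rewrite potential_notin ?mulr0.
  rewrite /served big_pred0 ?mul0r// => m; apply/negbTE.
  by rewrite negb_and negbK orbC -implybE; apply/implyP => im; apply/adjP; exists i.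
move: served0; move: (served c) (potential c) (discounted c) (g c) => l x y u lx.
have -> : l * (x - (z * x + u)) = (1 - z) * (l * x) - l * u by ring.
by rewrite lx; ring.
Qed.

Lemma eq_Ex_admissible F G : bounded_fn F -> bounded_fn G ->
  (forall c, admissible e c -> F c = G c) -> Ex pi F = Ex pi G.
Proof.
move=> bF bG FG; apply/eqP; rewrite -subr_eq0 -ExB// -normr_le0.
have bH : bounded_fn (fun c => `|F c - G c|).
  by have [M HM] := bounded_B bF bG; exists M => c; rewrite normr_id.
have H0 : Ex pi (fun c => `|F c - G c|) = 0.
  apply: (Ex_inadmissible pi_stat) => // c /FG ->; by rewrite subrr normr0.
rewrite -H0 ler_norml; apply/andP; split; last first.
  by apply: le_Ex => //; [exact: bounded_B|move=> c; exact: ler_norm].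
rewrite lerNl -mulN1r -ExZ; last exact: bounded_B.
apply: le_Ex => //; last by move=> c; rewrite mulN1r -normrN; exact: ler_norm.
by apply: bounded_M; [exact: bounded_cst|exact: bounded_B].
Qed.

(** The potential has mean drift zero in the stationary regime. The newcomers with a
    match contribute [driftE]; among the others, only class [i] changes the
    potential, by [g c - (1 - z) * potential c]. *)
Lemma Ex_wait_transform : a i * Ex pi g = Ex pi discounted.
Proof.
have bP := bounded_potential.
have bA m : bounded_fn (fun c => a m * (potential (arrive c m) - potential c)).
  apply: bounded_M; first exact: bounded_cst.
  by apply: bounded_B => //; exact: bounded_comp bP.
have : Ex pi (fun c => \sum_m a m * (potential (arrive c m) - potential c)) = 0.
  rewrite Ex_sum//.
  have ExP m : Ex pi (fun c => a m * (potential (arrive c m) - potential c)) =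
      a m * Ex pi (fun c => potential (arrive c m)) - a m * Ex pi potential.
    have bPm : bounded_fn (fun c => potential (arrive c m)) by exact: bounded_comp bP.
    by rewrite ExZ; [rewrite ExB// mulrBr|exact: bounded_B].
  under eq_bigr do rewrite ExP.
  rewrite sumrB (stationary_invariance e_sym e_irr a_gt0 a_sum1 pi_stat bP potential_ge0).
  by rewrite -mulr_suml a_sum1 mul1r subrr.
have bg := bounded_wait_transform; have bd := bounded_discounted.
have bag : bounded_fn (fun c => a i * g c) by apply: bounded_M => //; exact: bounded_cst.
rewrite (@eq_Ex_admissible _ (fun c => a i * g c - discounted c)); last 3 first.
- exact: bounded_sum.
- exact: bounded_B.
- move=> c ac; rewrite (bigID (fun m => adj c m))/= -/(drift c) driftE//.
  have -> : \sum_(m | ~~ adj c m) a m * (potential (arrive c m) - potential c) =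
      (~~ adj c i)%:R * (a i * g c - s * potential c).
    rewrite (bigID (xpred1 i))/= [X in _ + X]big1 ?addr0; last first.
      move=> m /andP[cm mi]; rewrite fcfm_append// potential_rcons (negbTE mi).
      by rewrite subrr mulr0.
    have [ci|ci] := boolP (adj c i); last first.
      rewrite (big_pred1 i) => [|m]; last by rewrite /= andbC; case: eqP => // ->.
      rewrite fcfm_append// potential_rcons eqxx -rate_z mul1r.
      by move: (potential c) (g c) => x y; ring.
    by rewrite big_pred0 ?mul0r// => m; rewrite /= andbC; case: eqP => // ->; rewrite ci.
  have [ci|ci] := boolP (adj c i); last by rewrite mul1r; ring.
  rewrite wait_transform_adj// potential_notin; first by rewrite !mulr0; ring.
  apply/negP => ic; have /adjP[k kc ki] := ci.
  by have /admissibleP/(_ k i kc ic) := ac; rewrite ki.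
by rewrite ExB// ExZ// => /eqP; rewrite subr_eq0 => /eqP.
Qed.

Lemma integral_tail_discounted :
  (\int[P]_w \int[mu]_(t in [set t | (0 <= t)%R /\ t%:E < T w]) (expR (- s * t))%:E =
   ((a i)^-1 * Ex pi discounted)%:E)%E.
Proof. by rewrite integral_tail_time -Ex_wait_transform mulrA mulVf ?mul1r// gt_eqF. Qed.

End WaitTransform.

(** ** Little's law, in mean and in distribution *)

Let mT := measurable_matching_time.

Let T_ge0 w : (0 <= T w)%E.
Proof. by apply: matching_time_ge0 => l; exact: S_gt0. Qed.

Let measurable_before (x : \bar R) : measurable [set t : R | 0 <= t /\ (t%:E < x)%E].
Proof.
have -> : [set t : R | 0 <= t /\ (t%:E < x)%E] =
    `[0, +oo[%classic `&` [set t : R | (t%:E < x)%E].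
  by apply/seteqP; split => t /=; rewrite in_itv/= andbT.
apply: measurableI => //; rewrite -[X in measurable X]setTI; exact: measurable_lte.
Qed.

Let sk (k : nat) : R := a i / k.+1%:R.

Let sk_gt0 k : 0 < sk k. Proof. exact: divr_gt0. Qed.

Let sk_le k : sk k <= a i.
Proof. by rewrite ler_pdivrMr// ler_peMr ?ler1n// ltW. Qed.

Let sk_decr k l : (k <= l)%N -> sk l <= sk k.
Proof. by move=> kl; rewrite ler_pM2l// lef_pV2 ?posrE// ler_nat. Qed.

Let cvg_sk : sk k @[k --> \oo] --> (0 : R).
Proof.
rewrite -(mulr0 (a i)); apply: cvgM; first exact: cvg_cst.
exact: cvg_harmonic.
Qed.

Let discountedE s c : 0 < s ->
  discounted s c = \sum_(l < count_mem i c) (1 - s / a i) ^+ l.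
Proof.
move=> s0; rewrite /discounted -[X in X / _]opprB subrX1 -mulNr opprB mulrC mulKf//.
by rewrite opprB addrC subrK gt_eqF// divr_gt0.
Qed.

(** Little's law, as the limit of the Laplace transforms at [0+]. *)
Lemma mean_matching_time :
  (\int[P]_w T w = ((a i)^-1)%:E * mean_unmatched pi i)%E.
Proof.
pose tail s w := (\int[mu]_(t in [set t | (0 <= t)%R /\ t%:E < T w]) (expR (- s * t))%:E)%E.
have tailT w : T w = limn (fun k => tail (sk k) w).
  rewrite -(integral_lt_cst1 (T_ge0 w)) /tail.
  rewrite -(@monotone_convergence _ _ _ mu _ (measurable_before (T w))
    (fun k t => (expR (- sk k * t))%:E)).
  - apply: eq_integral => t _; apply/esym/cvg_lim => //.
    apply: cvg_EFin_real; rewrite -[X in _ --> X](expR0 R) -(mul0r t) -oppr0.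
    apply: (continuous_cvg _ (@continuous_expR R _)).
    by apply: cvgM; [apply: cvgN; exact: cvg_sk|exact: cvg_cst].
  - move=> k; apply/measurable_EFinP/measurable_funTS.
    by apply: continuous_measurable_fun; exact: continuous_expRN.
  - by move=> k t _; rewrite lee_fin expR_ge0.
  - move=> t [t0 _] k l kl; rewrite lee_fin ler_expR !mulNr lerN2.
    by rewrite ler_wpM2r// sk_decr.
under eq_integral do rewrite tailT.
rewrite monotone_convergence//; last 3 first.
- move=> k; apply: measurable_tail_integral => //.
  by apply: continuous_measurable_fun; exact: continuous_expRN.
- by move=> k w _; rewrite /tail; apply: integral_ge0 => t _; rewrite /= lee_fin expR_ge0.
- move=> w _ k l kl; apply: ge0_le_integral => //.
  + exact: measurable_before.
  + apply/measurable_EFinP/measurable_funTS.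
    by apply: continuous_measurable_fun; exact: continuous_expRN.
  + apply/measurable_EFinP/measurable_funTS.
    by apply: continuous_measurable_fun; exact: continuous_expRN.
  + move=> t [t0 _]; rewrite lee_fin ler_expR !mulNr lerN2.
    by rewrite ler_wpM2r// sk_decr.
have disc_ge0 k c : 0 <= discounted (sk k) c.
  rewrite discountedE//; apply: sumr_ge0 => l _; rewrite exprn_ge0//.
  by rewrite subr_ge0 ler_pdivrMr ?mul1r.
rewrite /mean_unmatched unlock.
transitivity (limn (fun k => ((a i)^-1)%:E * \int[pi]_c (discounted (sk k) c)%:E)%E).
  congr (limn _); apply/funext => k.
  by rewrite (integral_tail_discounted (sk_gt0 k) (sk_le k)) EFinM EFin_Ex//;
    exact: bounded_discounted.
rewrite (_ : (\int[pi]_c (unmatched R i c)%:E)%E =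
    (\int[pi]_c limn (fun k => (discounted (sk k) c)%:E))%E); last first.
  apply: eq_integral => c _; apply/esym/cvg_lim => //; apply: cvg_EFin_real.
  under eq_fun do rewrite discountedE//.
  have -> : unmatched R i c = \sum_(l < count_mem i c) 1.
    by rewrite sumr_const card_ord.
  apply: (cvg_sumr (f := fun (l : 'I_(count_mem i c)) k => (1 - sk k / a i) ^+ l)) => l _.
  rewrite -[X in _ --> X](expr1n _ l).
  suff c1 : 1 - sk k / a i @[k --> \oo] --> (1 : R).
    exact: (cvg_comp _ (fun x : R => x ^+ l) c1 (@exprn_continuous R l 1)).
  rewrite -[X in _ --> X]subr0 -(mul0r (a i)^-1); apply: cvgB; first exact: cvg_cst.
  by apply: cvgM; [exact: cvg_sk|exact: cvg_cst].
have nd c : {homo (fun k => (discounted (sk k) c)%:E) : k l / (k <= l)%N >-> (k <= l)%E}.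
  move=> k l kl; rewrite lee_fin !discountedE//; apply: ler_sum => j _.
  have z0 n : 0 <= 1 - sk n / a i by rewrite subr_ge0 ler_pdivrMr ?mul1r.
  by rewrite lerXn2r ?nnegrE// lerD2l lerN2 ler_pM2r ?invr_gt0// sk_decr.
rewrite monotone_convergence//; last by move=> k c _; rewrite lee_fin.
rewrite limeMl//; apply: ereal_nondecreasing_is_cvgn => k l kl.
apply: ge0_le_integral => //.
- by move=> c _; rewrite lee_fin.
- by move=> c _; exact: nd.
Qed.

Lemma matching_time_integrable : (mean_unmatched pi i < +oo)%E ->
  P.-integrable setT T.
Proof.
move=> mfin; apply/integrableP; split => //.
under eq_integral do rewrite gee0_abs//.
rewrite mean_matching_time lte_mul_pinfty// lee_fin invr_ge0.
exact: ltW.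
Qed.

(** Distributional form of Little's law: the wait of an item escapes killing at rate
    [s] with the same probability as all the unmatched class-[i] items escape
    independent marks of probability [s / a i]. *)
Lemma laplace_matching_time s : 0 < s -> s <= a i -> (mean_unmatched pi i < +oo)%E ->
  \int[P]_w expR (- s * fine (T w)) = Ex pi (fun c => (1 - s / a i) ^+ count_mem i c).
Proof.
move=> s0 sa mfin.
have me : measurable_fun setT (fun w => expR (- s * fine (T w))).
  apply: (measurableT_comp (f := fun t : R => expR (- s * t))).
    by apply: continuous_measurable_fun; exact: continuous_expRN.
  by apply: measurableT_comp => //.
have e01 w : 0 <= expR (- s * fine (T w)) <= 1.
  by rewrite expR_ge0 -expR0 ler_expR mulNr oppr_le0 mulr_ge0 ?fine_ge0// ltW.
have z01 : 0 <= 1 - s / a i <= 1.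
  by rewrite subr_ge0 ler_pdivrMr// mul1r sa gerBl divr_ge0// ltW.
have bz : bounded_fn (fun c => (1 - s / a i) ^+ count_mem i c).
  exists 1 => c; case/andP: z01 => z0 z1.
  by rewrite ger0_norm ?exprn_ge0// exprn_ile1.
have ie : P.-integrable setT (EFin \o (fun w => expR (- s * fine (T w)))).
  apply: (@bounded_integrable _ _ _ _ _ 1) => // w.
  by case/andP: (e01 w) => h0 h1; rewrite ger0_norm.
have /(congr1 fine) := integral_tail_discounted s0 sa.
rewrite (ge0_ae_eq_integral (g := fun w => ((1 - expR (- s * fine (T w))) / s)%:E))//;
  last 5 first.
- apply: measurable_tail_integral => //.
  by apply: continuous_measurable_fun; exact: continuous_expRN.
- apply/measurable_EFinP; apply: measurable_funM => //.
  by apply: measurable_funB => //.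
- by move=> w _; apply: integral_ge0 => t _; rewrite lee_fin expR_ge0.
- move=> w _; rewrite lee_fin; case/andP: (e01 w) => _ h1.
  by rewrite divr_ge0 ?subr_ge0// ltW.
- have := integrable_ae measurableT (matching_time_integrable mfin).
  apply: filterS => w /(_ Logic.I) Tfin _.
  by rewrite -(fineK Tfin) integral_lt_expR// fine_ge0.
rewrite /= -[LHS]/(\int[P]_w ((1 - expR (- s * fine (T w))) / s)).
have i1 : P.-integrable setT (EFin \o (fun _ : Om => 1 : R)).
  by apply: (@bounded_integrable _ _ _ _ _ 1) => // w; rewrite normr1.
under eq_Rintegral do rewrite mulrC.
rewrite RintegralZl//; last first.
  by apply: (integrableB measurableT i1 ie).
rewrite RintegralB// Rintegral_prob_cst /discounted.
rewrite (@eq_Ex _ _ _ _ (fun c => (1 - (1 - s / a i))^-1 * (1 - (1 - s / a i) ^+ count_mem i c)));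
  last by move=> c; rewrite mulrC.
rewrite ExZ ?ExB ?Ex_cst//; try by (apply: bounded_B => //; exact: bounded_cst).
  move: (Rintegral _ _ _) (Ex _ _) => x y H.
  have : s^-1 * (1 - x) = s^-1 * (1 - y).
    rewrite H; field; rewrite ?gt_eqF//.
  by move/(mulfI (invr_neq0 (lt0r_neq0 s0))) => E; rewrite -[x](subKr 1) E subKr.
exact: bounded_cst.
Qed.

End MatchingTimeLaw.

(** * Heavy traffic: probabilities and means *)

Section HeavyTraffic.
Context {R : realType} {N : nat} (e : rel 'I_N) (I : {set 'I_N}) (p q : 'I_N -> R).
Variable rhostar : R.
Context (pi : R -> probability (buffer N) R).
Let a := arrival_rate I p q.
Hypothesis e_simple : simple_graph e.
Hypothesis e_connected : connected_graph e.
Hypothesis I_max : maxset (indep e) I.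
Hypothesis p_gt0 : forall i, i \in I -> 0 < p i.
Hypothesis q_gt0 : forall i, i \notin I -> 0 < q i.
Hypothesis p_sum1 : \sum_(i in I) p i = 1.
Hypothesis q_sum1 : \sum_(i | i \notin I) q i = 1.
Hypothesis rhostar01 : 0 <= rhostar < 1.
Hypothesis stable : forall rho, rhostar < rho < 1 -> stability_condition e (a rho).
Hypothesis stable_lim : forall J : {set 'I_N}, indep e J -> J != I ->
    lim (load (a rho) J @[rho --> 1^'-]) <
    lim (load (a rho) (nbrs e J) @[rho --> 1^'-]).
Hypothesis pi_stat : forall rho, rhostar < rho < 1 ->
    stationary_distribution e (a rho) (pi rho).
Implicit Types (J K : {set 'I_N}) (i j : 'I_N) (rho : R).

Notation F := ((1 : R)^'-).

Lemma graph_sym : symmetric e. Proof. by case: e_simple. Qed.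
Lemma graph_irr : irreflexive e. Proof. by case: e_simple. Qed.

Lemma I_indep : indep e I. Proof. by case/maxsetP: I_max. Qed.

Lemma I_indep0 : indep0 e I. Proof. by rewrite /indep0 I_indep orbT. Qed.

Lemma I_neq0 : I != finset.set0. Proof. by case/andP: I_indep. Qed.

Lemma sup_I J : indep0 e J -> I \subset J -> J = I.
Proof.
move=> iJ IJ; case/maxsetP: I_max => _; apply => //; move: iJ; rewrite /indep0.
by case: eqP => // J0; move: IJ; rewrite J0 finset.subset0 (negbTE I_neq0).
Qed.

Lemma indep0_sub J K : K \subset J -> indep0 e J -> indep0 e K.
Proof.
move=> /fintype.subsetP KJ /indep0P H; apply/indep0P => i j iK jK.
by apply: H; exact: KJ.
Qed.

Lemma indep0_D1 J j : indep0 e J -> indep0 e (J :\ j)%SET.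
Proof. by apply: indep0_sub; exact: finset.subD1set. Qed.

Lemma D1_neq_I J j : indep0 e J -> j \in J -> (J :\ j)%SET != I.
Proof.
move=> iJ jJ; apply/eqP => JI; have IJ : I \subset J by rewrite -JI finset.subD1set.
by move: jJ; rewrite (sup_I iJ IJ) -JI finset.setD11.
Qed.

Lemma outside_I : exists j, j \notin I.
Proof.
apply: contrapT => H; move: q_sum1; rewrite big1 => [/eqP|i iI].
  by rewrite eq_sym oner_eq0.
by case: H; exists i.
Qed.

Lemma no_isolated_vertex i : exists j, e i j.
Proof.
have [k ki] : exists k, k != i.
  have [iI|iI] := boolP (i \in I).
    by have [k kI] := outside_I; exists k; apply: contraNneq kI => ->.
  have /set0Pn[k kI] := I_neq0.
  by exists k; apply: contraNneq iI => <-.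
have /connectP[[|j s] /=] := e_connected i k; first by move=> _ E; rewrite E eqxx in ki.
by case/andP => ij _ _; exists j.
Qed.

Lemma nbrs_I : nbrs e I = (~: I)%SET.
Proof.
apply/setP => m; rewrite mem_nbrs finset.inE; apply/existsP/idP => [[i /andP[iI im]]|mI].
  by apply/negP => mI; have /indep0P/(_ i m iI mI) := I_indep0; rewrite im.
apply: contrapT => H.
have iK : indep0 e (m |: I)%SET.
  have nI i : i \in I -> ~~ e i m.
    by move=> iI; apply/negP => im; apply: H; exists i; rewrite iI.
  apply/indep0P => i j; rewrite !finset.inE => /predU1P[->|iI] /predU1P[->|jI].
  - by rewrite graph_irr.
  - by rewrite graph_sym nI.
  - exact: nI.
  - by have /indep0P := I_indep0; apply.
have := sup_I iK (finset.subsetUr _ _) => /setP/(_ m).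
by rewrite !finset.inE eqxx (negbTE mI).
Qed.

Lemma rho_gt0 rho : rhostar < rho < 1 -> 0 < rho.
Proof. by case/andP: rhostar01 => r0 _ /andP[r1 _]; exact: le_lt_trans r1. Qed.

Lemma rate_gt0 rho i : 0 < rho -> 0 < a rho i.
Proof.
move=> r0; rewrite /a /arrival_rate; case: ifPn => iI.
  by rewrite mulr_gt0 ?p_gt0// divr_gt0// addr_gt0.
by rewrite mulr_gt0 ?q_gt0// divr_gt0// addr_gt0.
Qed.

Lemma load_I rho : load (a rho) I = rho / (1 + rho).
Proof.
transitivity (\sum_(i in I) p i * (rho / (1 + rho))).
  by apply: eq_bigr => i iI; rewrite /a /arrival_rate iI.
by rewrite -mulr_suml p_sum1 mul1r.
Qed.

Lemma load_nbrs_I rho : load (a rho) (nbrs e I) = 1 / (1 + rho).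
Proof.
rewrite nbrs_I; transitivity (\sum_(i | i \notin I) q i * (1 / (1 + rho))).
  rewrite /load (eq_bigl (fun i => i \notin I)) => [|i]; last by rewrite finset.inE.
  by apply: eq_bigr => i iI; rewrite /a /arrival_rate (negbTE iI).
by rewrite -mulr_suml q_sum1 mul1r.
Qed.

Lemma rate_sum1 rho : 0 < rho -> \sum_i a rho i = 1.
Proof.
move=> r0; rewrite (bigID (fun i => i \in I))/= -/(load (a rho) I) load_I.
have -> : \sum_(i | i \notin I) a rho i = load (a rho) (nbrs e I).
  by rewrite nbrs_I /load; apply: eq_bigl => i; rewrite finset.inE.
by rewrite load_nbrs_I; field; rewrite gt_eqF// addr_gt0.
Qed.

Lemma slack_I rho : slack e (a rho) I = (1 - rho) / (1 + rho).
Proof. by rewrite /slack load_I load_nbrs_I -mulrBl. Qed.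

Lemma near_rho : \forall rho \near F, rhostar < rho < 1.
Proof.
case/andP: rhostar01 => _ r1; near=> r; apply/andP; split.
  by near: r; exact: nbhs_left_gt.
by near: r; exact: nbhs_left_lt.
Unshelve. all: end_near. Qed.

Lemma cvg_rho : rho @[rho --> F] --> (1 : R).
Proof. by apply: cvg_at_left_filter; exact: cvg_id. Qed.

Lemma cvg_1rho : (1 + rho) @[rho --> F] --> (2 : R).
Proof.
rewrite [X in _ --> X](_ : (2 : R) = 1 + 1)//.
by apply: cvgD; [exact: cvg_cst|exact: cvg_rho].
Qed.

Lemma cvg_rate i : a rho i @[rho --> F] --> a 1 i.
Proof.
have inv2 : (1 + rho)^-1 @[rho --> F] --> ((1 + 1)^-1 : R).
  by apply: cvgV; [rewrite gt_eqF// addr_gt0|exact: cvg_1rho].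
rewrite /a /arrival_rate; case: (i \in I); apply: cvgM; try exact: cvg_cst.
  by apply: cvgM => //; exact: cvg_rho.
by apply: cvgM => //; exact: cvg_cst.
Qed.

Lemma cvg_load J : load (a rho) J @[rho --> F] --> load (a 1) J.
Proof. by apply: cvg_sumr => i _; exact: cvg_rate. Qed.

Lemma cvg_slack J : slack e (a rho) J @[rho --> F] --> slack e (a 1) J.
Proof. by apply: cvgB; exact: cvg_load. Qed.

Lemma slack1_gt0 J : indep0 e J -> J != finset.set0 -> J != I -> 0 < slack e (a 1) J.
Proof.
move=> iJ J0 JI; rewrite subr_gt0.
have := stable_lim _ JI; rewrite (cvg_lim (@Rhausdorff R) (@cvg_load J)).
rewrite (cvg_lim (@Rhausdorff R) (@cvg_load (nbrs e J))); apply.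
by move: iJ; rewrite /indep0 (negbTE J0).
Qed.

(** Away from [I] the slacks stay bounded away from 0 as [rho] tends to 1, so a
    quantity that obeys a recursion on the unmatched set vanishes with its
    boundary value and its source term. *)
Lemma vanishing_recursion (V r : R -> {set 'I_N} -> R) :
  (forall J, \forall rho \near F, 0 <= V rho J) ->
  V rho finset.set0 @[rho --> F] --> (0 : R) ->
  (forall J, indep0 e J -> J != finset.set0 -> J != I ->
     (\forall rho \near F, slack e (a rho) J * V rho J <=
        \sum_(j in J) a rho j * V rho (J :\ j)%SET + r rho J) /\
     r rho J @[rho --> F] --> (0 : R)) ->
  forall J, indep0 e J -> J != I -> V rho J @[rho --> F] --> (0 : R).
Proof.
move=> V0 Vset0 H J; have [n] := ubnP #|J|; elim: n J => // n IH J Jn iJ JI.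
have [->//|J0] := eqVneq J finset.set0.
have [rec r0] := H _ iJ J0 JI; have s0 := slack1_gt0 iJ J0 JI.
apply: (cvg0_le (g := fun rho =>
  (\sum_(j in J) a rho j * V rho (J :\ j)%SET + r rho J) / slack e (a rho) J)).
  have spos : \forall rho \near F, 0 < slack e (a rho) J.
    exact: (cvgr_gt _ (@cvg_slack J)).
  apply: filterS3 (V0 J) rec spos => rho v0 le_rec sp.
  by rewrite v0 ler_pdivlMr// mulrC.
rewrite [X in _ --> X](_ : (0 : R) = (0 + 0) / slack e (a 1) J); last by rewrite addr0 mul0r.
apply: cvgM; last by apply: cvgV; [rewrite gt_eqF|exact: cvg_slack].
apply: cvgD => //; apply: cvg_sumr0 => j jJ.
rewrite [X in _ --> X](_ : (0 : R) = a 1 j * 0); last by rewrite mulr0.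
apply: cvgM; first exact: cvg_rate.
apply: IH; [|exact: indep0_D1|exact: D1_neq_I].
by move: Jn; rewrite (cardsD1 j) jJ add1n ltnS.
Qed.

Notation PS rho J := (prob_set (pi rho) J).

Lemma prob_set_rec rho J : rhostar < rho < 1 -> indep0 e J ->
  slack e (a rho) J * PS rho J = \sum_(j in J) a rho j * PS rho (J :\ j)%SET.
Proof.
move=> hr iJ; apply: prob_set_recursion => //.
- exact: graph_sym.
- exact: graph_irr.
- exact: no_isolated_vertex.
- by move=> i; apply: rate_gt0; exact: rho_gt0 hr.
- by apply: rate_sum1; exact: rho_gt0 hr.
- exact: pi_stat.
Qed.

Lemma cvg_slack_I : slack e (a rho) I @[rho --> F] --> (0 : R).
Proof.
have := @cvg_slack I; rewrite slack_I subrr mul0r; exact.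
Qed.

(** By removing classes from [I] one at a time: for [K = j |: J], the recursion
    gives [a j * PS J <= slack K * PS K], and at [K = I] the slack itself vanishes. *)
Lemma cvg_prob_subset J : J \subset I -> J != I -> PS rho J @[rho --> F] --> (0 : R).
Proof.
have [n] := ubnP (#|I| - #|J|); elim: n J => // n IH J Jn JsI JI.
have [j jI jJ] : exists2 j, j \in I & j \notin J.
  have /fintype.properP[_ [j jI jJ]] : J \proper I by rewrite finset.properEneq JI.
  by exists j.
pose K := (j |: J)%SET.
have KI : K \subset I by rewrite finset.subUset finset.sub1set jI.
have iK : indep0 e K by exact: indep0_sub I_indep0.
have jK : j \in K by exact: finset.setU11.
have KJ : (K :\ j)%SET = J by rewrite finset.setU1K.
have sK : slack e (a rho) K * PS rho K @[rho --> F] --> (0 : R).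
  have [KeqI|KnI] := eqVneq K I.
    rewrite KeqI; apply: (cvg0_le (g := fun rho => slack e (a rho) I)); last exact: cvg_slack_I.
    apply: filterS near_rho => rho hr; have [_ r1] := andP hr.
    have s0 : 0 <= slack e (a rho) I.
      rewrite slack_I divr_ge0 ?subr_ge0 ?ltW//.
      by rewrite addr_gt0//; exact: rho_gt0 hr.
    by rewrite mulr_ge0 ?prob_set_ge0//= ler_piMr// prob_set_le1.
  rewrite [X in _ --> X](_ : (0 : R) = slack e (a 1) K * 0); last by rewrite mulr0.
  apply: cvgM; first exact: cvg_slack.
  apply: IH => //; move: Jn; rewrite cardsU1 jJ /=.
  have : (#|K| <= #|I|)%N by exact: subset_leq_card.
  by rewrite cardsU1 jJ /=; lia.
apply: (cvg0_le (g := fun rho => (slack e (a rho) K * PS rho K) / a rho j)).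
  apply: filterS near_rho => rho hr; rewrite prob_set_ge0/=.
  have aj := rate_gt0 j (rho_gt0 hr).
  rewrite ler_pdivlMr// mulrC prob_set_rec// (bigD1 j)//= KJ lerDl sumr_ge0// => k _.
  by rewrite mulr_ge0 ?prob_set_ge0// ltW//; apply: rate_gt0; exact: rho_gt0 hr.
rewrite [X in _ --> X](_ : (0 : R) = 0 / a 1 j); last by rewrite mul0r.
apply: cvgM => //; apply: cvgV; last exact: cvg_rate.
by rewrite gt_eqF// rate_gt0.
Qed.

Lemma cvg_prob_set0 J : indep0 e J -> J != I -> PS rho J @[rho --> F] --> (0 : R).
Proof.
apply: (@vanishing_recursion (fun rho J => PS rho J) (fun _ _ => 0)).
- by move=> K; apply: nearW => rho; exact: prob_set_ge0.
- by apply: cvg_prob_subset; [exact: finset.sub0set|rewrite eq_sym I_neq0].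
- move=> K iK K0 KI; split; last exact: cvg_cst.
  by apply: filterS near_rho => rho hr; rewrite addr0 prob_set_rec.
Qed.

Lemma near_dependent J : ~~ indep0 e J -> \forall rho \near F, PS rho J = 0.
Proof.
move=> nJ; apply: filterS near_rho => rho hr.
by apply: (prob_set_dependent (pi_stat hr)).
Qed.

Lemma cvg_prob_neq_I J : J != I -> PS rho J @[rho --> F] --> (0 : R).
Proof.
move=> JI; have [iJ|nJ] := boolP (indep0 e J); first exact: cvg_prob_set0.
by apply: cvg_eq_near (near_dependent nJ) _; exact: cvg_cst.
Qed.

Lemma cvg_prob_I : PS rho I @[rho --> F] --> (1 : R).
Proof.
apply: (cvg_eq_near (g := fun rho => 1 - \sum_(J | J != I) PS rho J)).
  by apply: nearW => rho; rewrite -[X in X - _](sum_prob_set (pi rho)) (bigD1 I)//= addrK.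
rewrite [X in _ --> X](_ : (1 : R) = 1 - 0); last by rewrite subr0.
apply: cvgB; first exact: cvg_cst.
by apply: cvg_sumr0 => J; exact: cvg_prob_neq_I.
Qed.

Lemma cvg_prob J : PS rho J @[rho --> F] --> ((J == I)%:R : R).
Proof.
by have [->|JI] := eqVneq J I; [exact: cvg_prob_I|exact: cvg_prob_neq_I].
Qed.

Lemma cvg_prob_buffers J :
  pi rho (buffers_of J) @[rho --> F] --> (((J == I)%:R : R)%:E).
Proof. by under eq_fun do rewrite -prob_setE; apply: cvg_EFin_real; exact: cvg_prob. Qed.

Lemma cvg_waiting_prob i :
  waiting_prob e (pi rho) i @[rho --> F] --> (((i \in I)%:R : R)%:E).
Proof.
apply: (cvg_eqe_near (g := fun rho =>
    (\sum_(J | indep0 e J && (i \notin nbrs e J)) PS rho J)%:E)).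
  apply: nearW => rho; rewrite /waiting_prob -sumEFin.
  by apply: eq_bigr => J _; rewrite prob_setE.
apply: cvg_EFin_real.
rewrite [X in _ --> X](_ : (i \in I)%:R =
    \sum_(J | indep0 e J && (i \notin nbrs e J)) ((J == I)%:R : R)).
  by apply: cvg_sumr => J _; exact: cvg_prob.
rewrite big_mkcond (bigD1 I)//= big1 ?addr0; last first.
  by move=> J /negbTE ->; rewrite if_same.
by rewrite I_indep0 nbrs_I finset.inE negbK/= eqxx; case: (i \in I).
Qed.

Section MeanNumbers.
Variable i : 'I_N.

Notation M rho J := (mean_part (pi rho) i J).

Lemma mean_rec rho J : rhostar < rho < 1 -> indep0 e J ->
  slack e (a rho) J * M rho J = \sum_(j in J) a rho j * M rho (J :\ j)%SET +
    (if i \in J then a rho i * (PS rho J + PS rho (J :\ i)%SET) else 0).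
Proof.
move=> hr iJ; apply: mean_part_recursion => //.
- exact: graph_sym.
- exact: graph_irr.
- exact: no_isolated_vertex.
- by move=> j; apply: rate_gt0; exact: rho_gt0 hr.
- by apply: rate_sum1; exact: rho_gt0 hr.
- exact: pi_stat.
- exact: stable.
Qed.

Lemma mean_ge0 rho J : rhostar < rho < 1 -> 0 <= M rho J.
Proof.
move=> hr; apply: (mean_part_ge0 graph_sym graph_irr no_isolated_vertex _ _ (pi_stat hr)).
- by move=> j; apply: rate_gt0; exact: rho_gt0 hr.
- by apply: rate_sum1; exact: rho_gt0 hr.
- exact: stable.
Qed.

Lemma meanE rho : rhostar < rho < 1 ->
  mean_unmatched (pi rho) i = (\sum_(J | indep0 e J) M rho J)%:E.
Proof.
move=> hr; apply: (mean_unmatchedE graph_sym graph_irr no_isolated_vertex _ _ (pi_stat hr)).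
- by move=> j; apply: rate_gt0; exact: rho_gt0 hr.
- by apply: rate_sum1; exact: rho_gt0 hr.
- exact: stable.
Qed.

Lemma cvg_mean_neq_I J : indep0 e J -> J != I -> M rho J @[rho --> F] --> (0 : R).
Proof.
apply: (@vanishing_recursion (fun rho J => M rho J)
  (fun rho J => if i \in J then a rho i * (PS rho J + PS rho (J :\ i)%SET) else 0)).
- by move=> K; apply: filterS near_rho => rho hr; exact: mean_ge0.
- by under eq_fun do rewrite mean_part_notin ?finset.inE//; exact: cvg_cst.
- move=> K iK K0 KI; split.
    by apply: filterS near_rho => rho hr; rewrite mean_rec.
  have [iiK|_] := boolP (i \in K); last exact: cvg_cst.
  rewrite [X in _ --> X](_ : (0 : R) = a 1 i * (0 + 0)); last by rewrite addr0 mulr0.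
  apply: cvgM; first exact: cvg_rate.
  apply: cvgD; first exact: cvg_prob_neq_I.
  by apply: cvg_prob_neq_I; exact: D1_neq_I.
Qed.

(** Dividing the recursion at [I] by its slack, which is equivalent to
    [(1 - rho) / 2], leaves only the source term [a i * PS I] in the limit. *)
Lemma cvg_mean_I : i \in I -> (1 - rho) * M rho I @[rho --> F] --> p i.
Proof.
move=> iI; apply: (cvg_eq_near (g := fun rho => (1 + rho) *
    (\sum_(j in I) a rho j * M rho (I :\ j)%SET + a rho i * (PS rho I + PS rho (I :\ i)%SET)))).
  apply: filterS near_rho => rho hr; have r0 := rho_gt0 hr.
  have := mean_rec hr I_indep0; rewrite iI => <-; rewrite slack_I.
  by move: (M rho I) => m; field; rewrite gt_eqF// addr_gt0.
rewrite [X in _ --> X](_ : p i = 2 * (0 + a 1 i * (1 + 0))); last first.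
  by rewrite /a /arrival_rate iI; field.
apply: cvgM; first exact: cvg_1rho.
apply: cvgD.
  apply: cvg_sumr0 => j jI.
  rewrite [X in _ --> X](_ : (0 : R) = a 1 j * 0); last by rewrite mulr0.
  apply: cvgM; first exact: cvg_rate.
  apply: cvg_mean_neq_I; first by apply: indep0_D1; exact: I_indep0.
  by apply: D1_neq_I => //; exact: I_indep0.
apply: cvgM; first exact: cvg_rate.
apply: cvgD; first exact: cvg_prob_I.
by apply: cvg_prob_neq_I; apply: D1_neq_I => //; exact: I_indep0.
Qed.

Lemma cvg_mean_sum_outside : i \notin I ->
  (\sum_(J | indep0 e J) M rho J) @[rho --> F] --> (0 : R).
Proof.
move=> iI; apply: cvg_sumr0 => J iJ.
have [->|JI] := eqVneq J I; last exact: cvg_mean_neq_I.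
by under eq_fun do rewrite mean_part_notin//; exact: cvg_cst.
Qed.

Lemma cvg_mean_outside : i \notin I -> mean_unmatched (pi rho) i @[rho --> F] --> 0%E.
Proof.
move=> iI; apply: (cvg_eqe_near (g := fun rho => (\sum_(J | indep0 e J) M rho J)%:E)).
  by apply: filterS near_rho => rho; exact: meanE.
by apply: cvg_EFin_real; exact: cvg_mean_sum_outside.
Qed.

Lemma cvg_scaled_mean : i \in I ->
  (1 - rho) * (\sum_(J | indep0 e J) M rho J) @[rho --> F] --> p i.
Proof.
move=> iI.
apply: (cvg_eq_near (g := fun rho => \sum_(J | indep0 e J) (1 - rho) * M rho J)).
  by apply: nearW => rho; rewrite mulr_sumr.
rewrite [X in _ --> X](_ : p i = \sum_(J | indep0 e J) (if J == I then p i else 0)).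
  apply: cvg_sumr => J iJ; case: eqP => [->|/eqP JI]; first exact: cvg_mean_I.
  rewrite [X in _ --> X](_ : (0 : R) = (1 - 1) * 0); last by rewrite mulr0.
  apply: cvgM; last exact: cvg_mean_neq_I.
  by apply: cvgB; [exact: cvg_cst|exact: cvg_rho].
rewrite (bigD1 I) ?I_indep0//= eqxx big1 ?addr0// => J /andP[_ /negbTE ->]//.
Qed.

End MeanNumbers.

Lemma asymp_mean i : i \in I ->
  asymp_equiv F (fun rho => mean_unmatched (pi rho) i)
    (fun rho => p i * (rho / (1 - rho))).
Proof.
move=> iI; rewrite /asymp_equiv.
apply: (cvg_eqe_near (g := fun rho =>
  (((1 - rho) * \sum_(J | indep0 e J) mean_part (pi rho) i J) / (p i * rho))%:E)).
  apply: filterS near_rho => rho hr; have r0 := rho_gt0 hr; have [_ r1] := andP hr.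
  rewrite meanE// -EFinM; congr EFin; move: (\sum_(J | _) _) => s.
  have h1 : p i != 0 by rewrite gt_eqF// p_gt0.
  have h2 : rho != 0 by rewrite gt_eqF.
  have h3 : 1 - rho != 0 by rewrite gt_eqF// subr_gt0.
  by field; rewrite ?h1 ?h2 ?h3.
apply: cvg_EFin_real.
rewrite [X in _ --> X](_ : (1 : R) = p i / (p i * 1)); last first.
  by rewrite mulr1 divff// gt_eqF// p_gt0.
apply: cvgM; first exact: cvg_scaled_mean.
apply: cvgV; first by rewrite mulr1 gt_eqF// p_gt0.
by apply: cvgM; [exact: cvg_cst|exact: cvg_rho].
Qed.

Lemma asymp_mean_total :
  asymp_equiv F (fun rho => (\sum_i mean_unmatched (pi rho) i)%E)
     (fun rho => rho / (1 - rho)).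
Proof.
rewrite /asymp_equiv.
apply: (cvg_eqe_near (g := fun rho =>
  ((\sum_i ((1 - rho) * \sum_(J | indep0 e J) mean_part (pi rho) i J)) / rho)%:E)).
  apply: filterS near_rho => rho hr; have r0 := rho_gt0 hr; have [_ r1] := andP hr.
  under eq_bigr do rewrite meanE//.
  rewrite sumEFin -EFinM; congr EFin; rewrite -mulr_sumr; move: (\sum_i _) => s.
  have h2 : rho != 0 by rewrite gt_eqF.
  have h3 : 1 - rho != 0 by rewrite gt_eqF// subr_gt0.
  by field; rewrite ?h2 ?h3.
apply: cvg_EFin_real.
rewrite [X in _ --> X](_ : (1 : R) = (\sum_i (if i \in I then p i else 0)) / 1); last first.
  by rewrite -big_mkcond p_sum1 divr1.
apply: cvgM; last by apply: cvgV; [rewrite oner_eq0|exact: cvg_rho].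
apply: cvg_sumr => i _; case: ifPn => iI; first exact: cvg_scaled_mean.
rewrite [X in _ --> X](_ : (0 : R) = (1 - 1) * 0); last by rewrite mulr0.
apply: cvgM; first by apply: cvgB; [exact: cvg_cst|exact: cvg_rho].
apply: cvg_sumr0 => J iJ; have [->|JI] := eqVneq J I; last exact: cvg_mean_neq_I.
by under eq_fun do rewrite mean_part_notin//; exact: cvg_cst.
Qed.

(** * Heavy traffic: generating functions *)

Lemma cvg_slack_I_ratio : slack e (a rho) I / (1 - rho) @[rho --> F] --> (2^-1 : R).
Proof.
apply: (cvg_eq_near (g := fun rho => (1 + rho)^-1)).
  apply: filterS near_rho => rho hr; have [_ r1] := andP hr.
  by rewrite slack_I mulrAC divff ?mul1r// gt_eqF// subr_gt0.
by apply: cvgV; [rewrite pnatr_eq0|exact: cvg_1rho].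
Qed.

(** The generating function is taken at points [z] that tend to 1 at the speed of
    [1 - rho], which is the scale of the Laplace transform of [(1 - rho) * X]. *)
Section GeneratingFunctionLimit.
Variables (z : R -> 'I_N -> R) (s : 'I_N -> R).
Hypothesis z01 : \forall rho \near F, forall i, 0 <= z rho i <= 1.
Hypothesis s_ge0 : forall i, 0 <= s i.
Hypothesis cvg_z : forall i, (1 - z rho i) / (1 - rho) @[rho --> F] --> s i.

Notation G rho J := (gen_fun (pi rho) (z rho) J).

Let defect rho J := (PS rho J - G rho J) / (1 - rho).

Let near_z : \forall rho \near F, rhostar < rho < 1 /\ forall i, 0 <= z rho i <= 1.
Proof. by apply: filterS2 near_rho z01. Qed.

Let cvg_defect J : indep0 e J -> J != I -> defect rho J @[rho --> F] --> (0 : R).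
Proof.
apply: (@vanishing_recursion defect (fun rho J => \sum_(j in J)
  a rho j * ((1 - z rho j) / (1 - rho)) * (PS rho J + PS rho (J :\ j)%SET))).
- move=> K; apply: filterS near_z => rho [hr zr]; have [_ r1] := andP hr.
  by rewrite divr_ge0 ?subr_ge0 ?gen_fun_le// ltW.
- by under eq_fun do rewrite /defect gen_fun0 subrr mul0r; exact: cvg_cst.
- move=> K iK K0 KI; split; last first.
    apply: cvg_sumr0 => j jK.
    rewrite [X in _ --> X](_ : (0 : R) = a 1 j * s j * (0 + 0)); last by rewrite addr0 mulr0.
    apply: cvgM; first by apply: cvgM; [exact: cvg_rate|exact: cvg_z].
    apply: cvgD; first exact: cvg_prob_neq_I.
    by apply: cvg_prob_neq_I; exact: D1_neq_I.
  apply: filterS near_z => rho [hr zr]; have [_ r1] := andP hr.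
  have r10 : 0 < 1 - rho by rewrite subr_gt0.
  rewrite [X in _ * X]/defect mulrA -(ler_pM2r r10) divfK ?gt_eqF//.
  have := gen_fun_defect graph_sym graph_irr no_isolated_vertex
    (fun i => rate_gt0 i (rho_gt0 hr)) (rate_sum1 (rho_gt0 hr)) (pi_stat hr) zr iK.
  move=> /le_trans; apply; rewrite mulrDl lerD// ?mulr_suml; apply: ler_sum => j jK.
    by rewrite /defect -mulrA divfK ?gt_eqF.
  rewrite [leRHS]mulrAC; apply: ler_wpM2r; first by rewrite addr_ge0// prob_set_ge0.
  by rewrite -mulrA divfK ?gt_eqF.
Qed.

Let cvg_G0 J : J != I -> G rho J @[rho --> F] --> (0 : R).
Proof.
move=> JI; apply: (cvg0_le (g := fun rho => PS rho J)); last exact: cvg_prob_neq_I.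
by apply: filterS near_z => rho [hr zr]; rewrite gen_fun_ge0// gen_fun_le.
Qed.

(** The recursion at [I] reads [den * gen_fun I = num] after division by [1 - rho];
    [den] and [num] converge, because [slack I / (1 - rho)] does. *)
Let cvg_G_I : G rho I @[rho --> F] --> 1 / (1 + \sum_(j in I) p j * s j).
Proof.
pose den rho := (1 + rho)^-1 + \sum_(j in I) a rho j * ((1 - z rho j) / (1 - rho)).
pose num rho := slack e (a rho) I / (1 - rho) * PS rho I -
  (\sum_(j in I) a rho j * defect rho (I :\ j)%SET +
   \sum_(j in I) a rho j * ((1 - z rho j) / (1 - rho)) * G rho (I :\ j)%SET).
have sum0 : 0 <= \sum_(j in I) p j * s j.
  by apply: sumr_ge0 => j jI; rewrite mulr_ge0// ltW// p_gt0.
have cden : den rho @[rho --> F] --> 2^-1 + \sum_(j in I) a 1 j * s j.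
  apply: cvgD; first by apply: cvgV; [rewrite pnatr_eq0|exact: cvg_1rho].
  by apply: cvg_sumr => j jI; apply: cvgM; [exact: cvg_rate|exact: cvg_z].
have den1 : 2^-1 + \sum_(j in I) a 1 j * s j = (1 + \sum_(j in I) p j * s j) / 2.
  rewrite mulrDl mul1r mulr_suml; congr (_ + _); apply: eq_bigr => j jI.
  by rewrite /a /arrival_rate jI; field.
have den_neq0 : 2^-1 + \sum_(j in I) a 1 j * s j != 0.
  by rewrite den1 gt_eqF// divr_gt0// ltr_wpDr.
have cnum : num rho @[rho --> F] --> (2^-1 : R).
  rewrite [X in _ --> X](_ : (2^-1 : R) = 2^-1 * 1 - (0 + 0)); last by rewrite addr0 subr0 mulr1.
  apply: cvgB; first by apply: cvgM; [exact: cvg_slack_I_ratio|exact: cvg_prob_I].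
  have iI j : j \in I -> indep0 e (I :\ j)%SET /\ (I :\ j)%SET != I.
    by move=> jI; split; [apply: indep0_D1|apply: D1_neq_I => //]; exact: I_indep0.
  apply: cvgD; apply: cvg_sumr0 => j /iI[iIj nIj].
    rewrite [X in _ --> X](_ : (0 : R) = a 1 j * 0); last by rewrite mulr0.
    by apply: cvgM; [exact: cvg_rate|exact: cvg_defect].
  rewrite [X in _ --> X](_ : (0 : R) = a 1 j * s j * 0); last by rewrite mulr0.
  apply: cvgM; last exact: cvg_G0.
  by apply: cvgM; [exact: cvg_rate|exact: cvg_z].
rewrite [X in _ --> X](_ : _ = 2^-1 / (2^-1 + \sum_(j in I) a 1 j * s j)); last first.
  by rewrite den1; field; rewrite gt_eqF// ltr_wpDr.
apply: (cvg_eq_near (g := fun rho => num rho / den rho)); last first.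
  by apply: cvgM => //; apply: cvgV.
have dpos : \forall rho \near F, 0 < den rho.
  apply: (cvgr_gt _ cden); rewrite den1 divr_gt0// ltr_wpDr//.
apply: filterS2 near_z dpos => rho [hr zr] d0; have [_ r1] := andP hr.
have r10 : 1 - rho != 0 by rewrite gt_eqF// subr_gt0.
have r0 := rho_gt0 hr.
apply: (mulIf (lt0r_neq0 d0)); rewrite divfK ?gt_eqF//.
apply: (mulIf r10).
have rec := gen_fun_recursion graph_sym graph_irr no_isolated_vertex
    (fun i => rate_gt0 i (rho_gt0 hr)) (rate_sum1 (rho_gt0 hr)) (pi_stat hr) zr I_indep0.
have psrec := prob_set_rec hr I_indep0.
have E1 : den rho * (1 - rho) = load (a rho) (nbrs e I) - \sum_(j in I) a rho j * z rho j.
  rewrite /den mulrDl mulr_suml.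
  have -> : \sum_(j in I) a rho j * ((1 - z rho j) / (1 - rho)) * (1 - rho) =
      load (a rho) I - \sum_(j in I) a rho j * z rho j.
    rewrite /load -sumrB; apply: eq_bigr => j jI.
    by rewrite -mulrA divfK// mulrBr mulr1.
  rewrite addrA; congr (_ - _); rewrite load_I load_nbrs_I; field.
  by rewrite gt_eqF// addr_gt0.
have E2 : num rho * (1 - rho) = \sum_(j in I) a rho j * z rho j * G rho (I :\ j)%SET.
  rewrite /num mulrBl mulrAC divfK// psrec mulrDl !mulr_suml.
  rewrite -big_split/= -sumrB; apply: eq_bigr => j jI.
  rewrite /defect; move: (PS rho _) (G rho _) => x y.
  by field; rewrite r10.
by rewrite E2 -rec -E1 [RHS]mulrC mulrA.
Qed.

Theorem cvg_power_weight :
  Ex (pi rho) (power_weight (z rho)) @[rho --> F] --> 1 / (1 + \sum_(j in I) p j * s j).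
Proof.
apply: (cvg_eq_near (g := fun rho => G rho I + \sum_(J | J != I) G rho J)).
  apply: filterS near_z => rho [hr zr].
  by rewrite -sum_gen_fun// (bigD1 I).
rewrite [X in _ --> X](_ : _ = 1 / (1 + \sum_(j in I) p j * s j) + 0); last by rewrite addr0.
apply: cvgD => //; apply: cvg_sumr0 => J; exact: cvg_G0.
Qed.

End GeneratingFunctionLimit.

Lemma cvg_expR_ratio (th : R) : 0 <= th ->
  (1 - expR (- ((1 - rho) * th))) / (1 - rho) @[rho --> F] --> th.
Proof.
move=> th0.
have c1 : th / (1 + (1 - rho) * th) @[rho --> F] --> th.
  rewrite [X in _ --> X](_ : th = th / (1 + (1 - 1) * th)); last first.
    by rewrite subrr mul0r addr0 divr1.
  apply: cvgM; first exact: cvg_cst.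
  apply: cvgV; first by rewrite subrr mul0r addr0 oner_eq0.
  apply: cvgD; first exact: cvg_cst.
  by apply: cvgM; [apply: cvgB; [exact: cvg_cst|exact: cvg_rho]|exact: cvg_cst].
apply: (squeeze_cvgr _ c1 (cvg_cst th)).
apply: filterS near_rho => rho /andP[_ r1]; set h := 1 - rho.
have h0 : 0 < h by rewrite subr_gt0.
have ht0 : 0 <= h * th by rewrite mulr_ge0// ltW.
rewrite ler_pdivlMr// ler_pdivrMr//; apply/andP; split; last first.
  by rewrite lerBlDr -lerBlDl mulrC expR_ge1Dx.
rewrite expRN lerBrDl -lerBrDr; apply: (@le_trans _ _ (1 + h * th)^-1).
  by rewrite lef_pV2 ?posrE ?expR_gt0// ?ltr_wpDr// expR_ge1Dx.
rewrite le_eqVlt; apply/orP; left; apply/eqP; field.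
by rewrite gt_eqF// ltr_wpDr.
Qed.

Lemma power_weight_expR (h : R) (th : 'I_N -> R) c :
  power_weight (fun j => expR (- (h * th j))) c =
  expR (- (h * \sum_j th j * unmatched R j c)).
Proof.
rewrite /power_weight; elim: c => [|k c IH].
  by rewrite big_nil big1 ?mulr0 ?oppr0 ?expR0// => j _; rewrite /unmatched mulr0.
rewrite big_cons IH -expRD; congr expR; rewrite -opprD -mulrDr; congr (- (_ * _)).
rewrite [RHS](bigD1 k)//= [in LHS](bigD1 k)//= addrA; congr (_ + _).
  by rewrite /unmatched/= eqxx natrD mulrDr mulr1.
by apply: eq_bigr => j jk; rewrite /unmatched/= eq_sym (negbTE jk).
Qed.

(** The limit is the Laplace transform, at [th], of [Exp(1)] times the vector [p]. *)
Lemma cvg_laplace (th : 'I_N -> R) : (forall i, 0 <= th i) ->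
  Ex (pi rho) (fun c => expR (- ((1 - rho) * \sum_j th j * unmatched R j c))) @[rho --> F]
    --> 1 / (1 + \sum_(j in I) p j * th j).
Proof.
move=> th0; apply: (cvg_eq_near (g := fun rho =>
    Ex (pi rho) (power_weight (fun j => expR (- ((1 - rho) * th j)))))).
  by apply: nearW => rho; apply: eq_Ex => c; rewrite power_weight_expR.
apply: (@cvg_power_weight (fun rho j => expR (- ((1 - rho) * th j))) th) => //.
  apply: filterS near_rho => rho /andP[_ r1] i.
  rewrite expR_ge0 -[leRHS]expR0 ler_expR oppr_le0 mulr_ge0//.
  by rewrite subr_ge0 ltW.
by move=> i; exact: cvg_expR_ratio.
Qed.

(** * Heavy traffic: numbers of unmatched items *)

Definition total_I (c : buffer N) : R := \sum_(j in I) unmatched R j c.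

Lemma unmatched_ge0 i c : 0 <= unmatched R i c :> R.
Proof. exact: ler0n. Qed.

Lemma total_I_ge0 c : 0 <= total_I c.
Proof. by apply: sumr_ge0 => j _; exact: unmatched_ge0. Qed.

Lemma sum_total_I (k : R) c : \sum_j (k * (j \in I)%:R) * unmatched R j c = k * total_I c.
Proof.
rewrite /total_I mulr_sumr [RHS]big_mkcond; apply: eq_bigr => j _.
by case: (j \in I); rewrite ?mulr1// mulr0 mul0r.
Qed.

Lemma sum_unmatched_pred1 (k : R) i c :
  \sum_j (k * (j == i)%:R) * unmatched R j c = k * unmatched R i c.
Proof.
rewrite (bigD1 i)//= eqxx mulr1 big1 ?addr0// => j /negbTE ->.
by rewrite mulr0 mul0r.
Qed.

Lemma expRN_bounded (rho : R) (f : buffer N -> R) : rho < 1 -> (forall c, 0 <= f c) ->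
  bounded_fn (fun c => expR (- ((1 - rho) * f c))).
Proof.
move=> r1 f0; exists 1 => c; rewrite ger0_norm ?expR_ge0// -[leRHS]expR0 ler_expR.
by rewrite oppr_le0 mulr_ge0// subr_ge0 ltW.
Qed.

(** The total of the classes in [I], along which all of them are proportional in
    the limit. *)
Lemma cvg_total_exponential (h : R -> R) : continuous h ->
  (exists M, forall x, `|h x| <= M) ->
  (\int[pi rho]_c (h ((1 - rho) * total_I c))%:E)%E @[rho --> F] -->
  (\int[exponential_prob 1]_x (h x)%:E)%E.
Proof.
apply: (laplace_cvg_exponential ltr01 (P := pi)
  (X := fun (rho : R) (c : buffer N) => (1 - rho) * total_I c)).
  apply: filterS near_rho => rho /andP[_ r1]; split => // c.
  by rewrite mulr_ge0 ?total_I_ge0// subr_ge0 ltW.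
move=> th th0.
have := @cvg_laplace (fun j => th * (j \in I)%:R) (fun i => mulr_ge0 th0 (ler0n _ _)).
have -> : \sum_(j in I) p j * (th * (j \in I)%:R) = th.
  rewrite -[RHS]mul1r -[X in _ = X * _]p_sum1 mulr_suml.
  by apply: eq_bigr => j ->; rewrite mulr1.
apply: cvg_eq_near; apply: nearW => rho; apply: eq_Ex => c.
by rewrite sum_total_I; congr expR; ring.
Qed.

(** The squared distance between the exponentials is a combination of three
    joint Laplace transforms whose limits cancel. *)
Lemma cvg_profile i : i \in I ->
  Ex (pi rho) (fun c => (expR (- ((1 - rho) * unmatched R i c)) -
    expR (- ((1 - rho) * (p i * total_I c)))) ^+ 2) @[rho --> F] --> (0 : R).
Proof.
move=> iI; have p0 := ltW (p_gt0 iI).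
pose L (th : 'I_N -> R) rho c := expR (- ((1 - rho) * \sum_j th j * unmatched R j c)).
pose th1 j : R := 2 * (j == i)%:R.
pose th2 j : R := 1 * (j == i)%:R + p i * (j \in I)%:R.
pose th3 j : R := (2 * p i) * (j \in I)%:R.
have t1 j : 0 <= th1 j by rewrite mulr_ge0.
have t2 j : 0 <= th2 j by rewrite addr_ge0// mulr_ge0.
have t3 j : 0 <= th3 j by rewrite mulr_ge0// mulr_ge0.
have sumI : \sum_(j in I) p j * (j \in I)%:R = 1.
  by rewrite -[RHS]p_sum1; apply: eq_bigr => j ->; rewrite mulr1.
have sumi : \sum_(j in I) p j * (j == i)%:R = p i.
  rewrite (bigD1 i)//= eqxx mulr1 big1 ?addr0// => j /andP[_ /negbTE ->].
  by rewrite mulr0.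
have l1 : \sum_(j in I) p j * th1 j = 2 * p i.
  by rewrite -sumi mulr_sumr; apply: eq_bigr => j _; rewrite mulrCA.
have l2 : \sum_(j in I) p j * th2 j = 2 * p i.
  under eq_bigr do rewrite mulrDr mul1r mulrCA.
  by rewrite big_split/= sumi -mulr_sumr sumI mulr1 mulr_natl mulr2n.
have l3 : \sum_(j in I) p j * th3 j = 2 * p i.
  under eq_bigr do rewrite mulrCA.
  by rewrite -mulr_sumr sumI mulr1.
have Lb th rho : rho < 1 -> (forall j, 0 <= th j) -> bounded_fn (L th rho).
  move=> r1 th0; apply: expRN_bounded => // c.
  by apply: sumr_ge0 => j _; rewrite mulr_ge0// unmatched_ge0.
apply: (cvg_eq_near (g := fun rho => Ex (pi rho) (L th1 rho) +
   ((-2) * Ex (pi rho) (L th2 rho) + Ex (pi rho) (L th3 rho)))).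
  apply: filterS near_rho => rho /andP[_ r1].
  have b1 := Lb th1 rho r1 t1; have b2 := Lb th2 rho r1 t2; have b3 := Lb th3 rho r1 t3.
  have b2' : bounded_fn (fun c => -2 * L th2 rho c).
    by apply: bounded_M => //; exact: bounded_cst.
  rewrite -ExZ// -ExD// -ExD//; last exact: bounded_D.
  apply: eq_Ex => c; rewrite /L sum_unmatched_pred1 sum_total_I.
  have -> : \sum_j th2 j * unmatched R j c = unmatched R i c + p i * total_I c.
    under eq_bigr do rewrite mulrDl.
    by rewrite big_split/= sum_unmatched_pred1 sum_total_I mul1r.
  set x := unmatched R i c; set y := total_I c.
  have -> : - ((1 - rho) * (2 * x)) = - ((1 - rho) * x) + - ((1 - rho) * x) by ring.
  have -> : - ((1 - rho) * (2 * p i * y)) =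
    - ((1 - rho) * (p i * y)) + - ((1 - rho) * (p i * y)) by ring.
  have -> : - ((1 - rho) * (x + p i * y)) = - ((1 - rho) * x) + - ((1 - rho) * (p i * y)) by ring.
  by rewrite !expRD; ring.
rewrite [X in _ --> X](_ : (0 : R) = 1 / (1 + 2 * p i) + ((-2) * (1 / (1 + 2 * p i)) + 1 / (1 + 2 * p i)));
  last by ring.
apply: cvgD; first by rewrite -l1; exact: cvg_laplace.
apply: cvgD; last by rewrite -l3; exact: cvg_laplace.
by apply: cvgM; [exact: cvg_cst|rewrite -l2; exact: cvg_laplace].
Qed.

(** Below [K] the slope of [expR (- x)] is at least [expR (- K)] in absolute value, so
    the quantity of [cvg_profile] controls the distance of the numbers themselves. *)
Lemma expRN_dist (x y K : R) : x <= K -> y <= K ->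
  expR (- K) * `|x - y| <= `|expR (- x) - expR (- y)|.
Proof.
wlog xy : x y / x <= y.
  move=> H xK yK; have [xy|/ltW yx] := leP x y; first exact: H.
  by rewrite distrC [leRHS]distrC; exact: H.
move=> xK yK; rewrite distrC ger0_norm ?subr_ge0//.
rewrite ger0_norm ?subr_ge0 ?ler_expR ?lerN2//.
have -> : expR (- x) - expR (- y) = expR (- y) * (expR (y - x) - 1).
  by rewrite mulrBr mulr1 -expRD; congr (expR _ - _); ring.
rewrite ler_pM ?expR_ge0 ?subr_ge0 ?ler_expR ?lerN2//.
by rewrite lerBrDl expR_ge1Dx.
Qed.

(** The scaled vector is compared with [curve], at the scaled total: this point of
    the limiting ray converges in distribution by [cvg_total_exponential]. A large
    total is penalized by [tailf]; a vector far from the ray is unlikely by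
    [cvg_profile]; near a bounded piece of the ray, [h] varies little. *)
Theorem cvg_distribution_I :
  cvg_in_distribution (T := 'rV[R]_#|I|) F pi
     (fun rho c => \row_(k < #|I|) ((1 - rho) * unmatched R (enum_val k) c))
     (exponential_prob 1) (fun x : R => \row_(k < #|I|) (x * p (enum_val k))).
Proof.
move=> h ch [M0 hM0].
pose M : R := `|M0| + 1; have M_gt0 : 0 < M by rewrite ltr_wpDl.
have hM y : `|h y| <= M.
  by rewrite (le_trans (hM0 y))// (le_trans (ler_norm _))// lerDl.
pose curve (x : R) : 'rV[R]_#|I| := \row_(k < #|I|) (x * p (enum_val k)).
pose Y rho c : 'rV[R]_#|I| := \row_(k < #|I|) ((1 - rho) * unmatched R (enum_val k) c).
have ccurve : continuous curve.
  move=> x; apply/cvg_ballP => eps eps0.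
  have entry (k : 'I_#|I|) : \forall y \near x, ball (x * p (enum_val k)) eps (y * p (enum_val k)).
    have : (y * p (enum_val k)) @[y --> x] --> x * p (enum_val k).
      by apply: cvgM; [exact: cvg_id|exact: cvg_cst].
    by move/cvg_ballP; apply.
  suff : \forall y \near x, ball (curve x) eps (curve y) by [].
  apply: filterS (@filter_forall _ _ _ (nbhs x) _ entry) => y hy.
  by split => // i k; rewrite !mxE; exact: hy.
have bdd (g : buffer N -> 'rV[R]_#|I|) : bounded_fn (fun c => h (g c)) by exists M.
pose v rho := Ex (pi rho) (fun c => h (curve ((1 - rho) * total_I c))).
pose u rho := Ex (pi rho) (fun c => h (Y rho c)).
have cv : (v rho)%:E @[rho --> F] --> (\int[exponential_prob 1]_x (h (curve x))%:E)%E.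
  have hc : continuous (h \o curve).
    by move=> x; apply: continuous_comp; [exact: ccurve|exact: ch].
  have := cvg_total_exponential hc (ex_intro _ M (fun x => hM (curve x))).
  apply: cvg_eqe_near; apply: nearW => rho; rewrite /v EFin_Ex//.
have cuv : u rho - v rho @[rho --> F] --> (0 : R).
  apply/cvgr0Pnorm_le => eps eps0.
  have e3 : 0 < eps / 3 by rewrite divr_gt0.
  (* In the limit, scaled totals above [eta^-1] cost at most
     [4 * M * eta / (1 + eta) <= eps / 3]. *)
  pose eta := eps / (12 * M); have eta0 : 0 < eta by rewrite divr_gt0// mulr_gt0.
  pose K := eta^-1; have K0 : 0 < K by rewrite invr_gt0.
  have [del del0 hdel] := near_compact_modulus 0 K ch ccurve e3.
  pose B := expR (2 * K) / del ^+ 2; have B0 : 0 < B by rewrite divr_gt0 ?expR_gt0 ?exprn_gt0.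
  pose D rho i c := (expR (- ((1 - rho) * unmatched R i c)) -
    expR (- ((1 - rho) * (p i * total_I c)))) ^+ 2.
  pose tailf rho c := expR (- ((1 - rho) * \sum_j (eta * (j \in I)%:R) * unmatched R j c)).
  pose bound rho c := eps / 3 + (4 * M * (1 - tailf rho c) +
    2 * M * B * \sum_(i in I) D rho i c).
  have pointwise rho c : rhostar < rho < 1 ->
      `|h (Y rho c) - h (curve ((1 - rho) * total_I c))| <= bound rho c.
    move=> /andP[_ r1]; have r10 : 0 <= 1 - rho by rewrite subr_ge0 ltW.
    set S := (1 - rho) * total_I c.
    have S0 : 0 <= S by rewrite mulr_ge0// total_I_ge0.
    have le2M : `|h (Y rho c) - h (curve S)| <= 2 * M.
      by rewrite (le_trans (ler_normB _ _))// mulr_natl mulr2n lerD.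
    have tE : tailf rho c = expR (- (eta * S)).
      by rewrite /tailf sum_total_I /S mulrCA.
    have t1 : 0 <= 1 - tailf rho c.
      by rewrite tE subr_ge0 -expR0 ler_expR oppr_le0 mulr_ge0// ltW.
    have D0 i : 0 <= D rho i c by exact: sqr_ge0.
    have SD0 : 0 <= \sum_(i in I) D rho i c by apply: sumr_ge0 => i _.
    have T1 : 0 <= 4 * M * (1 - tailf rho c) by rewrite mulr_ge0// mulr_ge0// ltW.
    have T2 : 0 <= 2 * M * B * \sum_(i in I) D rho i c.
      by rewrite mulr_ge0// mulr_ge0 ?(ltW B0)// mulr_ge0// ltW.
    rewrite /bound; have [SK|KS] := leP S K; last first.
      apply: (le_trans le2M); rewrite ler_wpDl ?(ltW e3)// ler_wpDr//.
      have h2 : tailf rho c <= 2^-1.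
        rewrite tE expRN lef_pV2 ?posrE ?expR_gt0//.
        apply: le_trans (expR_ge1Dx _); rewrite -[leLHS]/(1 + 1) lerD2l.
        by rewrite -(divff (lt0r_neq0 eta0)) ler_pM2l// ltW.
      have : M * 2^-1 <= M * (1 - tailf rho c) by rewrite ler_pM2l//; lra.
      by move: (1 - tailf rho c) => tt; lra.
    have [/existsP[i /andP[iI far]]|/existsPn near_all] :=
      boolP [exists i, (i \in I) && (del <= `|(1 - rho) * unmatched R i c - S * p i|)].
      apply: (le_trans le2M); rewrite ler_wpDl ?(ltW e3)// ler_wpDl//.
      rewrite -[leLHS]mulr1 -[leRHS]mulrA ler_pM2l ?mulr_gt0//.
      apply: (@le_trans _ _ (B * D rho i c)); last first.
        by rewrite ler_pM2l// (bigD1 i)//= lerDl sumr_ge0.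
      have YK : (1 - rho) * unmatched R i c <= K.
        apply: le_trans SK; rewrite ler_wpM2l// /total_I (bigD1 i)//= lerDl.
        by apply: sumr_ge0 => j _; exact: unmatched_ge0.
      have pi1 : p i <= 1.
        rewrite -[leRHS]p_sum1 (bigD1 i)//= lerDl; apply: sumr_ge0 => j /andP[jI _].
        exact/ltW/p_gt0.
      have pSE : (1 - rho) * (p i * total_I c) = S * p i by rewrite /S mulrAC mulrA.
      have pSK : S * p i <= K by apply: le_trans SK; rewrite ler_piMr.
      have := expRN_dist YK pSK; rewrite /D pSE; set w := `|expR _ - _| => low.
      have wlow : expR (- K) * del <= w by apply: le_trans low; rewrite ler_pM2l ?expR_gt0.
      rewrite -[X in B * X]real_normK ?num_real// -/w.
      apply: (@le_trans _ _ (B * (expR (- K) * del) ^+ 2)); last first.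
        rewrite ler_pM2l//; apply: lerXn2r => //; rewrite nnegrE ?normr_ge0//.
        by rewrite mulr_ge0 ?expR_ge0// ltW.
      have eK : expR (2 * K) * expR (- K) ^+ 2 = 1.
        rewrite expr2 -!expRD (_ : 2 * K + (- K + - K) = 0) ?expR0//.
        by ring.
      rewrite exprMn /B.
      have -> : expR (2 * K) / del ^+ 2 * (expR (- K) ^+ 2 * del ^+ 2) =
        expR (2 * K) * expR (- K) ^+ 2 by field; rewrite gt_eqF.
      by rewrite eK.
    rewrite ler_wpDr ?addr_ge0//; apply: ltW; apply: hdel; first by rewrite S0.
    split => // i k; rewrite !mxE.
    have := near_all (enum_val k); rewrite enum_valP/= -ltNge distrC; exact.
  have bD rho i : rho < 1 -> i \in I -> bounded_fn (D rho i).
    move=> r1 iI; rewrite /D; under eq_fun do rewrite expr2.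
    have b1 : bounded_fn (fun c => expR (- ((1 - rho) * unmatched R i c)) -
        expR (- ((1 - rho) * (p i * total_I c)))).
      apply: bounded_B; apply: expRN_bounded => // c.
      by rewrite mulr_ge0 ?total_I_ge0// ltW// p_gt0.
    exact: bounded_M.
  have bT rho : rho < 1 -> bounded_fn (tailf rho).
    move=> r1; apply: expRN_bounded => // c; rewrite sum_total_I.
    by rewrite mulr_ge0 ?total_I_ge0// ltW.
  pose mb rho := eps / 3 + (4 * M * (1 - Ex (pi rho) (tailf rho)) +
    2 * M * B * \sum_(i in I) Ex (pi rho) (D rho i)).
  have Ex_bound rho : rho < 1 -> bounded_fn (bound rho) /\ Ex (pi rho) (bound rho) = mb rho.
    move=> r1; pose D' i := if i \in I then D rho i else fun=> 0.
    have bD' i : bounded_fn (D' i).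
      by rewrite /D'; case: ifP => iI; [exact: bD|exact: bounded_cst].
    have sD c : \sum_(i in I) D rho i c = \sum_(i in I) D' i c.
      by apply: eq_bigr => i iI; rewrite /D' iI.
    have b1 : bounded_fn (fun c => 1 - tailf rho c).
      exact: (bounded_B (bounded_cst 1) (bT _ r1)).
    have b2 : bounded_fn (fun c => 4 * M * (1 - tailf rho c)).
      exact: (bounded_M (bounded_cst _) b1).
    have b3 : bounded_fn (fun c => \sum_(i in I) D rho i c).
      by rewrite (funext sD); exact: bounded_sum.
    have b4 : bounded_fn (fun c => 2 * M * B * \sum_(i in I) D rho i c).
      exact: (bounded_M (bounded_cst _) b3).
    split; first exact: (bounded_D (bounded_cst _) (bounded_D b2 b4)).
    rewrite ExD ?Ex_cst; [|exact: bounded_cst|exact: bounded_D].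
    rewrite ExD// !ExZ// ExB ?Ex_cst; [|exact: bounded_cst|exact: bT].
    rewrite /mb; congr (_ + (_ + _ * _)); rewrite (funext sD) Ex_sum//.
    by apply: eq_bigr => i iI; rewrite /D' iI.
  have cb : mb rho @[rho --> F] -->
      eps / 3 + (4 * M * (1 - 1 / (1 + eta)) + 2 * M * B * 0).
    apply: cvgD; first exact: cvg_cst.
    apply: cvgD; apply: cvgM; try exact: cvg_cst; last first.
      by apply: cvg_sumr0 => i iI; exact: cvg_profile.
    apply: cvgB; first exact: cvg_cst.
    have e0' i : 0 <= eta * (i \in I)%:R by rewrite mulr_ge0// ltW.
    have := cvg_laplace e0'.
    have -> : \sum_(j in I) p j * (eta * (j \in I)%:R) = eta.
      rewrite -[RHS]mul1r -[X in _ = X * _]p_sum1 mulr_suml.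
      by apply: eq_bigr => j ->; rewrite mulr1.
    exact.
  have small : eps / 3 + (4 * M * (1 - 1 / (1 + eta)) + 2 * M * B * 0) < eps.
    have -> : 1 - 1 / (1 + eta) = eta / (1 + eta) by field; rewrite gt_eqF// addr_gt0.
    have le_eta : eta / (1 + eta) <= eta.
      by rewrite ler_pdivrMr ?addr_gt0// ler_peMr// ?lerDl ltW.
    have Meta : M * eta = eps / 12 by rewrite /eta; field; rewrite gt_eqF.
    have : M * (eta / (1 + eta)) <= M * eta by rewrite ler_pM2l.
    by rewrite mulr0 addr0 -mulrA Meta; move: (M * _) => mm; lra.
  have nb : \forall rho \near F, mb rho < eps by exact: (cvgr_lt _ cb).
  apply: filterS2 near_rho nb => rho hr nlt; have [_ r1] := andP hr.
  have [bb EB] := Ex_bound rho r1.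
  have bh1 : bounded_fn (fun c => h (Y rho c)) by exact: bdd.
  have bh2 : bounded_fn (fun c => h (curve ((1 - rho) * total_I c))) by exact: bdd.
  rewrite /u /v -ExB//.
  have bh3 := bounded_B bh1 bh2.
  apply: (le_trans (le_normr_Rintegral measurableT (bounded_fn_integrable (pi rho) bh3))).
  apply: (@le_trans _ _ (Ex (pi rho) (bound rho))); last by rewrite EB ltW.
  apply: le_Ex => //; last by move=> c; exact: pointwise.
  by exists (2 * M) => c; rewrite normr_id (le_trans (ler_normB _ _))// mulr_natl mulr2n lerD.
apply: (cvg_eqe_near (g := fun rho => ((v rho)%:E + (u rho - v rho)%:E)%E)).
  apply: nearW => rho; by rewrite -EFinD [in RHS]addrC subrK /u EFin_Ex; [|exact: bdd].
rewrite [X in _ --> X](_ : _ =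
  (\int[exponential_prob 1]_x (h (curve x))%:E + 0%:E)%E); last by rewrite adde0.
apply: cvgeD => //; first exact: fin_num_adde_defl.
exact: cvg_EFin_real.
Qed.

(** The vector is 0 as soon as the set of unmatched classes is [I]. *)
Theorem cvg_distribution_outside :
  cvg_in_distribution (T := 'rV[R]_#|~: I|) F pi
     (fun rho c => \row_(k < #|~: I|) unmatched R (enum_val k) c)
     (dirac tt) (fun=> 0).
Proof.
move=> h ch [M hM].
rewrite integral_cst//= diracT mule1.
pose Y (c : buffer N) : 'rV[R]_#|~: I| := \row_k unmatched R (enum_val k) c.
have bY : bounded_fn (fun c => h (Y c)) by exists M.
have M0 : 0 <= M by exact: le_trans (hM 0).
apply: (cvg_eqe_near (g := fun rho => (Ex (pi rho) (fun c => h (Y c)))%:E)).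
  by apply: nearW => rho; rewrite EFin_Ex.
apply: cvg_EFin_real.
apply: (cvg_eq_near (g := fun rho => (Ex (pi rho) (fun c => h (Y c) - h 0)) + h 0)).
  apply: nearW => rho; rewrite ExB//; last exact: bounded_cst.
  by rewrite Ex_cst subrK.
rewrite [X in _ --> X](_ : h 0 = 0 + h 0); last by rewrite add0r.
apply: cvgD; last exact: cvg_cst.
apply/norm_cvg0P.
apply: (cvg0_le (g := fun rho => 2 * M * (1 - PS rho I))); last first.
  rewrite [X in _ --> X](_ : (0 : R) = 2 * M * (1 - 1)); last by rewrite subrr mulr0.
  apply: cvgM; first exact: cvg_cst.
  by apply: cvgB; [exact: cvg_cst|exact: cvg_prob_I].
apply: nearW => rho; rewrite normr_ge0/=.
have bd : bounded_fn (fun c => h (Y c) - h 0) by apply: bounded_B => //; exact: bounded_cst.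
apply: (le_trans (le_normr_Rintegral measurableT (bounded_fn_integrable (pi rho) bd))).
have bind : bounded_fn (fun c => (1 : R) * (classes c == I)%:R).
  by apply: bounded_M; [exact: bounded_cst|exact: bounded_nat_bool].
have b1 := bounded_B (bounded_cst (1 : R)) bind.
have -> : 2 * M * (1 - PS rho I) = Ex (pi rho) (fun c => 2 * M * (1 - 1 * (classes c == I)%:R)).
  by rewrite ExZ// ExB// ?Ex_cst//; exact: bounded_cst.
apply: le_Ex.
- by exists (2 * M) => c; rewrite normr_id (le_trans (ler_normB _ _))// mulr_natl mulr2n lerD.
- exact: (bounded_M (bounded_cst _) b1).
- move=> c; rewrite mul1r; case: eqP => [cI|_]; last first.
    by rewrite subr0 mulr1 (le_trans (ler_normB _ _))// mulr_natl mulr2n lerD.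
  rewrite subrr mulr0 (_ : Y c = 0) ?subrr ?normr0//.
  apply/rowP => k; rewrite !mxE; apply/eqP; rewrite pnatr_eq0 -leqn0 leqNgt -has_count.
  apply/hasPn => x xc /=; apply/eqP => xk.
  have := enum_valP k; rewrite finset.inE => /negP; apply.
  by rewrite -xk -cI mem_classes.
Qed.

(** * Heavy traffic: matching times *)

Section MatchingTimes.
Context (d : R -> measure_display) (Om : forall rho, measurableType (d rho)).
Context (P : forall rho, probability (Om rho) R).
Context (C : forall rho, Om rho -> buffer N) (tau : forall rho, nat -> Om rho -> R).
Context (kappa : forall rho, nat -> Om rho -> 'I_N).
Hypothesis input : forall rho, rhostar < rho < 1 ->
  stationary_input (a rho) (pi rho) (P rho) (@C rho) (@tau rho) (@kappa rho).

Let T i rho w := matching_time e i (C w) ((@tau rho) ^~ w) ((@kappa rho) ^~ w).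

Let rate_pos rho (hr : rhostar < rho < 1) i : 0 < a rho i.
Proof. by apply: rate_gt0; exact: rho_gt0 hr. Qed.

Let rate_sum rho (hr : rhostar < rho < 1) : \sum_i a rho i = 1.
Proof. by apply: rate_sum1; exact: rho_gt0 hr. Qed.

Let rate1_pos i : 0 < a 1 i. Proof. exact: rate_gt0. Qed.

Let T_ge0 i rho (hr : rhostar < rho < 1) w : (0 <= T i (rho := rho) w)%E.
Proof.
apply: matching_time_ge0; elim=> [|l]; first exact: (input_time_gt0 (input hr)).
by move/lt_trans; apply; exact: (input_time_increasing (input hr)).
Qed.

Let mT i rho (hr : rhostar < rho < 1) : measurable_fun setT (T i (rho := rho)).
Proof. exact: (measurable_matching_time e (input hr) i). Qed.

Let mean_timeE i rho : rhostar < rho < 1 ->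
  (\int[P rho]_w T i w)%E =
  ((a rho i)^-1 * \sum_(J | indep0 e J) mean_part (pi rho) i J)%:E.
Proof.
move=> hr; rewrite EFinM -meanE//.
exact: (mean_matching_time (rate_pos hr) (rate_sum hr) (input hr) i graph_sym
  graph_irr (pi_stat hr)).
Qed.

Lemma asymp_mean_time i : i \in I ->
  asymp_equiv F (fun rho => (\int[P rho]_w T i w)%E) (fun rho => 2 / (1 - rho)).
Proof.
move=> iI; rewrite /asymp_equiv; have pi0 := p_gt0 iI.
apply: (cvg_eqe_near (g := fun rho => ((a rho i)^-1 *
    ((1 - rho) * \sum_(J | indep0 e J) mean_part (pi rho) i J) / 2)%:E)).
  apply: filterS near_rho => rho hr; have [_ r1] := andP hr.
  rewrite mean_timeE// -EFinM; congr EFin; move: (\sum_(J | _) _) (a rho i)^-1 => s x.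
  by field; rewrite gt_eqF// subr_gt0.
apply: cvg_EFin_real.
rewrite [X in _ --> X](_ : (1 : R) = (a 1 i)^-1 * p i / 2); last first.
  by rewrite /a /arrival_rate iI; field; rewrite gt_eqF.
apply: cvgM; last exact: cvg_cst.
apply: cvgM; last exact: cvg_scaled_mean.
by apply: cvgV; [rewrite gt_eqF|exact: cvg_rate].
Qed.

Let cvg_mean_time_sum i : i \notin I ->
  (a rho i)^-1 * \sum_(J | indep0 e J) mean_part (pi rho) i J @[rho --> F] --> (0 : R).
Proof.
move=> iI; rewrite -[X in _ --> X](mulr0 (a 1 i)^-1); apply: cvgM.
  by apply: cvgV; [rewrite gt_eqF|exact: cvg_rate].
exact: cvg_mean_sum_outside.
Qed.

Lemma cvg_mean_time_outside i : i \notin I ->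
  (\int[P rho]_w T i w)%E @[rho --> F] --> 0%E.
Proof.
move=> iI; apply: (cvg_eqe_near (g := fun rho => ((a rho i)^-1 *
    \sum_(J | indep0 e J) mean_part (pi rho) i J)%:E)).
  by apply: filterS near_rho => rho; exact: mean_timeE.
by apply: cvg_EFin_real; exact: cvg_mean_time_sum.
Qed.

Let weight_pow (z : R) i c :
  power_weight (fun j => if j == i then z else 1) c = z ^+ count_mem i c.
Proof.
rewrite /power_weight; elim: c => [|j c IH]; first by rewrite big_nil.
by rewrite big_cons IH /=; case: eqP => _; rewrite ?exprS// mul1r.
Qed.

(** The distributional form of Little's law at the vanishing rate
    [th * (1 - rho)] turns the transform of the wait into a joint generating
    function of the queue lengths, with limit [1 / (1 + 2 * th)]. *)
Lemma cvg_time_exponential i : i \in I ->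
  cvg_in_distribution (T := R) F P (fun rho w => (1 - rho) * fine (T i w))
    (exponential_prob (1 / 2)) (fun x : R => x).
Proof.
move=> iI h; have lam0 : 0 < 1 / 2 :> R by rewrite divr_gt0.
apply: (laplace_cvg_exponential lam0 (P := P)
  (X := fun rho w => (1 - rho) * fine (T i (rho := rho) w))).
  apply: filterS near_rho => rho hr; have [_ r1] := andP hr; split.
    apply: measurable_funM; first exact: measurable_cst.
    by apply: measurableT_comp => //; exact: mT.
  by move=> w; rewrite mulr_ge0 ?fine_ge0 ?T_ge0// subr_ge0 ltW.
move=> th; rewrite le_eqVlt => /predU1P[<-|th0].
  rewrite addr0 divff ?gt_eqF//; apply: (cvg_eq_near (g := fun=> 1)); last exact: cvg_cst.
  apply: nearW => rho; rewrite -[RHS](Rintegral_prob_cst (P rho)).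
  by apply: eq_Rintegral => w _; rewrite oppr0 mul0r expR0.
have th_le : \forall rho \near F, th * (1 - rho) <= a rho i.
  have c0 : a rho i - th * (1 - rho) @[rho --> F] --> a 1 i - th * (1 - 1).
    apply: cvgB; first exact: cvg_rate.
    apply: cvgM; first exact: cvg_cst.
    by apply: cvgB; [exact: cvg_cst|exact: cvg_rho].
  rewrite subrr mulr0 subr0 in c0.
  have : \forall rho \near F, 0 < a rho i - th * (1 - rho) by exact: (cvgr_gt _ c0).
  by apply: filterS => rho; rewrite subr_gt0 => /ltW.
pose z rho j := if j == i then 1 - th * (1 - rho) / a rho i else 1.
pose s j := if j == i then th / a 1 i else 0.
apply: (cvg_eq_near (g := fun rho => Ex (pi rho) (power_weight (z rho)))).
  apply: filterS2 near_rho th_le => rho hr hth; have [_ r1] := andP hr.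
  have s0 : 0 < th * (1 - rho) by rewrite mulr_gt0// subr_gt0.
  have mfin : (mean_unmatched (pi rho) i < +oo)%E by rewrite meanE// ltry.
  have := laplace_matching_time (rate_pos hr) (rate_sum hr) (input hr) graph_sym
    graph_irr (pi_stat hr) s0 hth mfin.
  rewrite [X in _ = X](@eq_Ex _ _ _ _ (power_weight (z rho))); last first.
    by move=> c; rewrite weight_pow.
  by move=> <-; apply: eq_Rintegral => w _; congr expR; ring.
rewrite [X in _ --> X](_ : _ = 1 / (1 + \sum_(j in I) p j * s j)); last first.
  rewrite (bigD1 i)//= big1 => [|j /andP[_ /negbTE ji]]; last by rewrite /s ji mulr0.
  rewrite /s eqxx /a /arrival_rate iI; field.
  rewrite ?gt_eqF ?addr_gt0 ?mulr_gt0 ?p_gt0//.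
apply: cvg_power_weight.
- apply: filterS2 near_rho th_le => rho hr hth j; have [_ r1] := andP hr.
  rewrite /z; case: ifP => _; last by rewrite ler01 lexx.
  have ai := rate_pos hr i.
  rewrite subr_ge0 ler_pdivrMr// mul1r hth gerBl divr_ge0// ?mulr_ge0//; try exact: ltW.
  by rewrite subr_ge0 ltW.
- by move=> j; rewrite /s; case: ifP => // _; rewrite divr_ge0// ltW.
move=> j; rewrite /z /s; case: ifP => _; last first.
  by under eq_fun do rewrite subrr mul0r; exact: cvg_cst.
apply: (cvg_eq_near (g := fun rho => th / a rho i)).
  apply: filterS near_rho => rho hr; have [_ r1] := andP hr; have := rate_pos hr i.
  move: (a rho i) => x x0; field; rewrite (gt_eqF x0)//= gt_eqF// subr_gt0//.
apply: cvgM; first exact: cvg_cst.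
by apply: cvgV; [rewrite gt_eqF|exact: cvg_rate].
Qed.

(** Away from 0, [h] differs from [h 0] by at most a multiple of the matching time,
    whose mean vanishes. *)
Lemma cvg_time_outside i : i \notin I ->
  cvg_in_distribution (T := R) F P (fun rho w => fine (T i w)) (dirac tt) (fun=> 0).
Proof.
move=> iI h ch [M hM].
rewrite integral_cst//= diracT mule1.
have M0 : 0 <= M by exact: le_trans (hM 0).
have mh : measurable_fun setT h by exact: continuous_measurable_fun.
have mhT rho : rhostar < rho < 1 -> measurable_fun setT (fun w => h (fine (T i (rho := rho) w))).
  move=> hr; apply: measurableT_comp => //.
  by apply: measurableT_comp => //; exact: mT.
have ihT rho : rhostar < rho < 1 ->
    (P rho).-integrable setT (EFin \o (fun w => h (fine (T i (rho := rho) w)))).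
  by move=> hr; apply: (@bounded_integrable _ _ _ _ _ M) => //; exact: mhT.
apply: (cvg_eqe_near (g := fun rho => (\int[P rho]_w h (fine (T i w)))%:E)).
  by apply: filterS near_rho => rho hr; rewrite EFin_Rintegral//; exact: ihT.
apply: cvg_EFin_real; apply/cvgrPdist_lt => eps eps0.
have e2 : 0 < eps / 2 by rewrite divr_gt0.
have [del /= del0 hdel] : \forall y \near 0, `|h 0 - h y| < eps / 2.
  by have /cvgrPdist_lt/(_ _ e2) := ch 0.
pose B := 2 * M / del; have B0 : 0 <= B by rewrite divr_ge0 ?mulr_ge0// ltW.
have pointwise y : 0 <= y -> `|h y - h 0| <= eps / 2 + B * y.
  move=> y0; have By0 : 0 <= B * y by rewrite mulr_ge0.
  have [yd|dy] := ltP y del.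
    rewrite distrC; apply: ler_wpDr => //; apply: ltW; apply: hdel.
    by rewrite /ball_/= sub0r normrN ger0_norm.
  apply: ler_wpDl; first exact: ltW.
  apply: (@le_trans _ _ (2 * M)).
    by rewrite (le_trans (ler_normB _ _))// mulr_natl mulr2n lerD.
  rewrite /B mulrAC -mulrA ler_peMr ?mulr_ge0// ler_pdivlMr ?mul1r//.
have cb : eps / 2 + B * ((a rho i)^-1 * \sum_(J | indep0 e J) mean_part (pi rho) i J)
    @[rho --> F] --> eps / 2 + B * 0.
  apply: cvgD; first exact: cvg_cst.
  by apply: cvgM; [exact: cvg_cst|exact: cvg_mean_time_sum].
have small : eps / 2 + B * 0 < eps by rewrite mulr0 addr0 ltr_pdivrMr// ltr_pMr// ltr1n.
have nb : \forall rho \near F, eps / 2 + B * ((a rho i)^-1 *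
    \sum_(J | indep0 e J) mean_part (pi rho) i J) < eps by exact: (cvgr_lt _ cb).
apply: filterS2 near_rho nb => rho hr; apply: le_lt_trans.
have i0 : (P rho).-integrable setT (EFin \o (fun=> h 0)).
  by apply: (@bounded_integrable _ _ _ _ _ M) => //.
rewrite -[X in `|X - _|](Rintegral_prob_cst (P rho)) distrC -RintegralB//; last exact: ihT.
have id : (P rho).-integrable setT (EFin \o (fun w => h (fine (T i (rho := rho) w)) - h 0)).
  exact: (integrableB measurableT (ihT rho hr) i0).
apply: (le_trans (le_normr_Rintegral measurableT id)).
rewrite -lee_fin EFin_Rintegral; last exact: (integrable_norm id).
rewrite EFinD [X in (_ + X)%E]EFinM -mean_timeE//.
have -> : ((eps / 2)%:E + B%:E * \int[P rho]_w T i w =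
    \int[P rho]_w ((eps / 2)%:E + B%:E * T i w))%E.
  rewrite ge0_integralD//.
  - rewrite ge0_integralZl//; [|exact: mT|by move=> w _; exact: T_ge0].
    by rewrite integral_cst//= probability_setT mule1.
  - by move=> w _; rewrite lee_fin ltW.
  - by move=> w _; rewrite mule_ge0//; exact: T_ge0.
  - by apply: measurable_funeM; exact: mT.
apply: ge0_le_integral => //.
- by apply/measurable_EFinP; apply: measurableT_comp => //; apply: measurable_funB => //; exact: mhT.
- by apply: emeasurable_funD => //; apply: measurable_funeM; exact: mT.
- move=> w _; have T0 := T_ge0 i hr w.
  apply: (@le_trans _ _ (eps / 2 + B * fine (T i w))%:E).
    by rewrite lee_fin pointwise// fine_ge0.
  rewrite EFinD [X in (_ + X <= _)%E]EFinM leeD2l// lee_wpmul2l//.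
  by move: T0; case: (T i w) => // _; exact: leey.
Qed.

End MatchingTimes.

End HeavyTraffic.

Theorem proposition14 (R : realType) (N : nat) (e : rel 'I_N)
    (I : {set 'I_N}) (p q : 'I_N -> R) (rhostar : R)
    (pi : R -> probability (buffer N) R)
    (d : R -> measure_display) (Om : forall rho, measurableType (d rho))
    (P : forall rho, probability (Om rho) R)
    (C : forall rho, Om rho -> buffer N)
    (tau : forall rho, nat -> Om rho -> R)
    (kappa : forall rho, nat -> Om rho -> 'I_N) :
  let a := arrival_rate I p q in
  let T i rho w := matching_time e i (C rho w) (tau rho ^~ w) (kappa rho ^~ w) in
  simple_graph e -> connected_graph e -> ~ bipartite e ->
  maxset (indep e) I ->
  (forall i, i \in I -> 0 < p i) -> (forall i, i \notin I -> 0 < q i) ->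
  \sum_(i in I) p i = 1 -> \sum_(i | i \notin I) q i = 1 ->
  0 <= rhostar < 1 ->
  (forall rho, rhostar < rho < 1 -> stability_condition e (a rho)) ->
  (forall J : {set 'I_N}, indep e J -> J != I ->
    lim (load (a rho) J @[rho --> 1^'-]) <
    lim (load (a rho) (nbrs e J) @[rho --> 1^'-])) ->
  (forall rho, rhostar < rho < 1 ->
    stationary_distribution e (a rho) (pi rho)) ->
  (forall rho, rhostar < rho < 1 ->
    stationary_input (a rho) (pi rho) (P rho) (C rho) (tau rho) (kappa rho)) ->
  (* a: set of unmatched classes *)
  ((pi rho (buffers_of I) @[rho --> 1^'-] --> 1%E) /\
   (forall J : {set 'I_N}, indep0 e J -> J != I ->
      pi rho (buffers_of J) @[rho --> 1^'-] --> 0%E)) /\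
  (* b: waiting probabilities *)
  ((forall i, i \in I -> waiting_prob e (pi rho) i @[rho --> 1^'-] --> 1%E) /\
   (forall i, i \notin I ->
      waiting_prob e (pi rho) i @[rho --> 1^'-] --> 0%E)) /\
  (* c: mean numbers of unmatched items *)
  ((forall i, i \in I ->
      asymp_equiv 1^'- (fun rho => mean_unmatched (pi rho) i)
        (fun rho => p i * (rho / (1 - rho)))) /\
   (forall i, i \notin I ->
      mean_unmatched (pi rho) i @[rho --> 1^'-] --> 0%E) /\
   asymp_equiv 1^'- (fun rho => (\sum_i mean_unmatched (pi rho) i)%E)
     (fun rho => rho / (1 - rho))) /\
  (* d: numbers of unmatched items, in distribution *)
  (cvg_in_distribution (T := 'rV[R]_#|I|) 1^'- pi
     (fun rho c => \row_(k < #|I|) ((1 - rho) * unmatched R (enum_val k) c))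
     (exponential_prob 1) (fun x : R => \row_(k < #|I|) (x * p (enum_val k))) /\
   cvg_in_distribution (T := 'rV[R]_#|~: I|) 1^'- pi
     (fun rho c => \row_(k < #|~: I|) unmatched R (enum_val k) c)
     (dirac tt) (fun=> 0)) /\
  (* e: mean matching times *)
  ((forall i, i \in I ->
      asymp_equiv 1^'- (fun rho => (\int[P rho]_w T i rho w)%E)
        (fun rho => 2 / (1 - rho))) /\
   (forall i, i \notin I ->
      (\int[P rho]_w T i rho w)%E @[rho --> 1^'-] --> 0%E)) /\
  (* f: matching times, in distribution *)
  ((forall i, i \in I ->
      cvg_in_distribution (T := R) 1^'- P (fun rho w => (1 - rho) * fine (T i rho w))
        (exponential_prob (1 / 2)) (fun x : R => x)) /\
   (forall i, i \notin I ->
      cvg_in_distribution (T := R) 1^'- P (fun rho w => fine (T i rho w))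
        (dirac tt) (fun=> 0))).
Proof.
move=> a T simple conn _ I_max p0 q0 p1 q1 rs st stl pst inp.
have prob : forall J : {set 'I_N},
    pi rho (buffers_of J) @[rho --> 1^'-] --> (((J == I)%:R : R)%:E).
  by move=> J; eapply @cvg_prob_buffers; eassumption.
have wait : forall i, waiting_prob e (pi rho) i @[rho --> 1^'-] --> (((i \in I)%:R : R)%:E).
  by move=> i; eapply @cvg_waiting_prob; eassumption.
split; [split|split; [split|split; [split; [|split]|split; [split|split; split]]]].
- by have := prob I; rewrite eqxx.
- by move=> J _ /negbTE JI; have := prob J; rewrite JI.
- by move=> i iI; have := wait i; rewrite iI.
- by move=> i /negbTE iI; have := wait i; rewrite iI.
- by move=> i iI; eapply @asymp_mean; eassumption.
- by move=> i iI; eapply @cvg_mean_outside; eassumption.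
- by eapply @asymp_mean_total; eassumption.
- by eapply @cvg_distribution_I; eassumption.
- by eapply @cvg_distribution_outside; eassumption.
- by move=> i iI; eapply @asymp_mean_time; eassumption.
- by move=> i iI; eapply @cvg_mean_time_outside; eassumption.
- by move=> i iI; eapply @cvg_time_exponential; eassumption.
- by move=> i iI; eapply @cvg_time_outside; eassumption.
Qed.
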